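(* Let $1<p<\infty$ and $2\le q\le\infty$. The Malliavin derivative $D\colon\mathcal S^q(H)\to L^p(\Omega,L^q([0,T],\mathcal L_2^0))$, regarded as an unbounded operator on $L^p(\Omega,H)$ with domain $\mathcal S^q(H)$, is closable.
   Context: Let $T>0$, let $H$ be a separable Hilbert space, $Q$ a bounded selfadjoint positive semidefinite operator on $H$, $H_0=Q^{1/2}(H)$ with inner product $\langle u,v\rangle_{H_0}=\langle Q^{-1/2}u,Q^{-1/2}v\rangle_H$, and $\mathcal{L}_2^0=\mathcal{L}_2(H_0,H)$ the Hilbert–Schmidt operators. On $(\Omega,\mathcal F,(\mathcal F_t)_{t\in[0,T]},\mathbf P)$ let $W$ be a cylindrical $Q$-Wiener process: $t\mapsto W(t)u$ is a real $(\mathcal F_t)$-Brownian motion for each $u\in H_0$, and $\mathbf E[W(s)u\,W(t)v]=\min(s,t)\langle u,v\rangle_{H_0}$; $\mathcal F$ is generated by $W$ and $(\mathcal F_t)$ is its natural filtration. For $\phi\in L^2([0,T],H_0)$ let $I(\phi)=\int_0^T\phi(t)\,\mathrm dW(t)$ (real valued; $H_0\cong\mathcal L_2(H_0,\mathbf R)$). For $2\le q\le\infty$, $\mathcal S^q$ is the set of random variables $F=f(I(\phi_1),\dots,I(\phi_n))$ with $n\in\mathbf N$, $\phi_j\in L^q([0,T],H_0)\subset L^2([0,T],H_0)$ and $f\in\mathcal C^1(\mathbf R^n,\mathbf R)$ with derivatives of polynomial growth, and $D_tF=\sum_{j=1}^n\partial_jf(I(\phi_1),\dots,I(\phi_n))\otimes\phi_j(t)$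 (independent of the representation of $F$). $\mathcal S^q(H)$ is the set of $X=\sum_{j=1}^nh_j\otimes F_j$ with $h_j\in H$, $F_j\in\mathcal S^q$, and $D_tX=\sum_jh_j\otimes D_tF_j\in H\otimes H_0\cong\mathcal L_2^0$. An unbounded operator $B\colon U\to V$ is closable if for every sequence $(u_n)$ in its domain with $u_n\to0$ in $U$ and $Bu_n\to v$ in $V$ one has $v=0$. *)

(* Defs.v *)
From HB Require Import structures.
From mathcomp Require Import all_boot all_order all_algebra.
From mathcomp Require Import all_classical all_reals all_analysis.

Set Implicit Arguments.
Unset Strict Implicit.
Unset Printing Implicit Defensive.

Import Order.TTheory GRing.Theory Num.Theory.
Import numFieldNormedType.Exports.

Local Open Scope classical_set_scope.
Local Open Scope ring_scope.

(** * Hilbert spaces and operators *)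

(* A real Hilbert space is a complete normed module with a dot product [ip]
   inducing its norm. *)
Definition inner_product_norm (R : realType) (H : completeNormedModType R)
    (ip : {dot H for idfun}) : Prop :=
  forall x : H, `|x| ^+ 2 = ip x x.

Definition separable (X : topologicalType) : Prop :=
  exists2 D : set X, countable D & dense D.

Definition positive_op (R : realType) (H : completeNormedModType R)
    (ip : {dot H for idfun}) (Q : {linear H -> H}) : Prop :=
  [/\ exists C : R, forall x, `|Q x| <= C * `|x|,
      forall x y, ip (Q x) y = ip x (Q y)
    & forall x, 0 <= ip (Q x) x].

Definition is_sqrt_op (R : realType) (H : completeNormedModType R)
    (ip : {dot H for idfun}) (Q S : {linear H -> H}) : Prop :=
  positive_op ip S /\ forall x, S (S x) = Q x.

(* Q^(1/2): a positive operator on a Hilbert space has exactly one positive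
   square root; [\0] is only the default value for the other [Q]. *)
Definition sqrt_op (R : realType) (H : completeNormedModType R)
    (ip : {dot H for idfun}) (Q : {linear H -> H}) : {linear H -> H} :=
  match pselect (exists S : {linear H -> H}, is_sqrt_op ip Q S) with
  | left exS => projT1 (cid exS)
  | right _ => (\0 : H -> H)
  end.

(** * The space H_0 = Q^(1/2)(H) *)

Definition in_range (R : realType) (H : completeNormedModType R)
    (S : {linear H -> H}) : {pred H} := fun u => `[< exists x, S x = u >].

Lemma in_range_submod (R : realType) (H : completeNormedModType R)
  (S : {linear H -> H}) : submod_closed (in_range S).
Proof.
split; first by apply/asboolP; exists 0; rewrite linear0.
move=> a u v /asboolP[x <-] /asboolP[y <-]; apply/asboolP.
by exists (a *: x + y); rewrite linearP.
Qed.

HB.instance Definition _ (R : realType) (H : completeNormedModType R)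
    (S : {linear H -> H}) :=
  GRing.isSubmodClosed.Build R H (in_range S) (in_range_submod S).

Record range_of (R : realType) (H : completeNormedModType R)
    (S : {linear H -> H}) :=
  RangeOf { range_val : H; range_valP : range_val \in in_range S }.

HB.instance Definition _ (R : realType) (H : completeNormedModType R)
  (S : {linear H -> H}) := [isSub for @range_val R H S].
HB.instance Definition _ (R : realType) (H : completeNormedModType R)
  (S : {linear H -> H}) := [Choice of range_of S by <:].
HB.instance Definition _ (R : realType) (H : completeNormedModType R)
  (S : {linear H -> H}) := [SubChoice_isSubLmodule of range_of S by <:].

Notation H0 ip Q := (range_of (sqrt_op ip Q)).

(* Q^(-1/2) u is the pseudo-inverse: the preimage of u under Q^(1/2) that is
   orthogonal to the kernel of Q^(1/2). *)
Definition sqrt_inv (R : realType) (H : completeNormedModType R)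
    (ip : {dot H for idfun}) (Q : {linear H -> H}) (u : H0 ip Q) : H :=
  xget 0 [set x | sqrt_op ip Q x = val u /\
                  forall k, sqrt_op ip Q k = 0 -> ip x k = 0].

Definition ipH0 (R : realType) (H : completeNormedModType R)
    (ip : {dot H for idfun}) (Q : {linear H -> H}) (u v : H0 ip Q) : R :=
  ip (sqrt_inv u) (sqrt_inv v).

Definition normH0 (R : realType) (H : completeNormedModType R)
    (ip : {dot H for idfun}) (Q : {linear H -> H}) (u : H0 ip Q) : R :=
  Num.sqrt (ipH0 u u).

(** * Extended norms

   A (semi)normed space is encoded by an extended seminorm [N : V -> \bar R]
   on a module [V]: its elements are the [v] with [N v < +oo], and two of them
   are identified when the seminorm of their difference is 0.  Spaces of
   classes of functions are thus handled through representatives, and the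
   construction [bochner_enorm] below can be iterated. *)

Definition enormH (R : realType) (H : completeNormedModType R) (x : H) :
  \bar R := (`|x|)%:E.

Definition enormH0 (R : realType) (H : completeNormedModType R)
    (ip : {dot H for idfun}) (Q : {linear H -> H}) (u : H0 ip Q) : \bar R :=
  (normH0 u)%:E.

Definition orthonormal_basis (R : realType) (H : completeNormedModType R)
    (ip : {dot H for idfun}) (Q : {linear H -> H}) (E : set (H0 ip Q)) : Prop :=
  [/\ forall e, E e -> ipH0 e e = 1,
      forall e e', E e -> E e' -> e <> e' -> ipH0 e e' = 0
    & forall u, (forall e, E e -> ipH0 u e = 0) -> u = 0].

Definition basisH0 (R : realType) (H : completeNormedModType R)
    (ip : {dot H for idfun}) (Q : {linear H -> H}) : set (H0 ip Q) :=
  xget set0 [set E | orthonormal_basis E].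

(* Norm of L_2(H_0, H): sqrt (sum_e |A e|^2) over an orthonormal basis, +oo if
   A is not a bounded linear operator. *)
Definition hs_enorm (R : realType) (H : completeNormedModType R)
    (ip : {dot H for idfun}) (Q : {linear H -> H}) (A : H0 ip Q -> H) :
    \bar R :=
  if `[< linear A /\ exists C : R, forall u, `|A u| <= C * normH0 u >]
  then ((\esum_(e in @basisH0 R H ip Q) (`|A e| ^+ 2)%:E) `^ 2^-1)%E
  else +oo%E.

(** * Bochner spaces *)

Definition bochner_simple (R : realType) (d : measure_display)
    (X : measurableType d) (V : lmodType R) (N : V -> \bar R) (s : X -> V) :
    Prop :=
  [/\ finite_set (range s),
      forall v, measurable (s @^-1` [set v])
    & forall x, (N (s x) < +oo)%E].

Definition strongly_measurable (R : realType) (d : measure_display)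
    (X : measurableType d) (V : lmodType R) (N : V -> \bar R) (f : X -> V) :
    Prop :=
  exists s : nat -> X -> V, (forall n, bochner_simple N (s n)) /\
    forall x, N (s n x - f x) @[n --> \oo] --> 0%E.

(* Extended norm of L^r(X, V), 1 <= r <= +oo. *)
Definition bochner_enorm (R : realType) (d : measure_display)
    (X : measurableType d) (mu : {measure set X -> \bar R}) (r : \bar R)
    (V : lmodType R) (N : V -> \bar R) (f : X -> V) : \bar R :=
  if `[< strongly_measurable N f >] then Lnorm mu r (N \o f) else +oo%E.

(* Functions on [0, T] are functions on R, considered for the restriction of
   the Lebesgue measure to [0, T]. *)
Definition leb (R : realType) (T : R) :
    {measure set (measurableTypeR R) -> \bar R} :=
  mrestr lebesgue_measure (measurable_itv `[0, T]).

(* L^r([0, T], H_0) *)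
Definition LqH0_enorm (R : realType) (H : completeNormedModType R)
    (ip : {dot H for idfun}) (Q : {linear H -> H}) (T : R) (r : \bar R) :
    (R -> H0 ip Q) -> \bar R :=
  bochner_enorm (leb T) r (@enormH0 R H ip Q).

(* L^p(Omega, H) *)
Definition LpH_enorm (R : realType) (H : completeNormedModType R)
    (d : measure_display) (Omega : measurableType d) (P : probability Omega R)
    (p : R) : (Omega -> H) -> \bar R :=
  bochner_enorm P p%:E (@enormH R H).

(* L^p(Omega, L^q([0, T], L_2(H_0, H))) *)
Definition LpLqHS_enorm (R : realType) (H : completeNormedModType R)
    (ip : {dot H for idfun}) (Q : {linear H -> H})
    (d : measure_display) (Omega : measurableType d) (P : probability Omega R)
    (T p : R) (q : \bar R) : (Omega -> R -> H0 ip Q -> H) -> \bar R :=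
  bochner_enorm P p%:E (bochner_enorm (leb T) q (@hs_enorm R H ip Q)).

(** * Cylindrical Q-Wiener processes *)

Definition increment (R : realType) (Omega : Type) (B : R -> Omega -> R)
    (s t : R) : Omega -> R := fun w => B t w - B s w.

(* [Filt t] is the set of events of the sigma-algebra F_t.  The law
   N(0, sigma^2 (t - s)) of the increments is the image of N(0, 1) under
   multiplication by sigma * sqrt (t - s), so that sigma = 0 is allowed. *)
Record brownian_motion (R : realType) (d : measure_display)
    (Omega : measurableType d) (P : probability Omega R)
    (Filt : R -> set (set Omega)) (T sigma : R) (B : R -> Omega -> R) : Prop :=
  BrownianMotion {
  bm_adapted : forall t : R, 0 <= t <= T ->
    forall C : set (measurableTypeR R), measurable C -> Filt t (B t @^-1` C);
  bm_start : {ae P, forall w, B 0 w = 0};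
  bm_indep : forall s t : R, 0 <= s -> s <= t -> t <= T ->
    forall (A : set Omega) (C : set (measurableTypeR R)),
      Filt s A -> measurable C ->
      P (A `&` increment B s t @^-1` C) = (P A * P (increment B s t @^-1` C))%E;
  bm_gaussian : forall s t : R, 0 <= s -> s <= t -> t <= T ->
    forall C : set (measurableTypeR R), measurable C ->
      P (increment B s t @^-1` C) =
        normal_prob 0 1 ((fun x : R => sigma * Num.sqrt (t - s) * x) @^-1` C);
  bm_continuous :
    {ae P, forall w, {within `[0, T], continuous (fun t => B t w)}} }.

Definition natural_filtration (R : realType) (U Omega : Type)
    (W : R -> U -> Omega -> R) (t : R) : set (set Omega) :=
  <<s [set A | exists (s : R) (u : U) (C : set (measurableTypeR R)),
         [/\ 0 <= s, s <= t, measurable C & A = W s u @^-1` C]] >>.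

(* [W t u] is the random variable W(t)u. *)
Record cylindrical_wiener (R : realType) (H : completeNormedModType R)
    (ip : {dot H for idfun}) (Q : {linear H -> H})
    (d : measure_display) (Omega : measurableType d) (P : probability Omega R)
    (Filt : R -> set (set Omega)) (T : R) (W : R -> H0 ip Q -> Omega -> R) :
    Prop :=
  CylindricalWiener {
  cw_brownian : forall u, brownian_motion P Filt T (normH0 u) (W ^~ u);
  cw_covariance : forall (s t : R) u v, 0 <= s <= T -> 0 <= t <= T ->
    ('E_P [fun w => (W s u w * W t v w)%R])%E = (Num.min s t * ipH0 u v)%:E }.

(** * Integrals of deterministic integrands *)

(* The triple (a, b, u) stands for the integrand 1_]a, b] u. *)
Definition valid_step (R : realType) (U : Type) (T : R)
    (s : seq (R * R * U)) : bool :=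
  all (fun x => [&& 0 <= x.1.1, x.1.1 <= x.1.2 & x.1.2 <= T]) s.

Definition step_fun (R : realType) (U : lmodType R) (s : seq (R * R * U)) :
    R -> U :=
  fun t => \sum_(x <- s) (if x.1.1 < t <= x.1.2 then x.2 else 0).

Definition step_integral (R : realType) (U Omega : Type)
    (W : R -> U -> Omega -> R) (s : seq (R * R * U)) : Omega -> R :=
  fun w => \sum_(x <- s) (W x.1.2 x.2 w - W x.1.1 x.2 w).

(* [Z] is a version of the L^2(Omega)-limit I(phi) of the integrals of step
   functions converging to [phi] in L^2([0, T], H_0). *)
Definition is_wiener_integral (R : realType) (H : completeNormedModType R)
    (ip : {dot H for idfun}) (Q : {linear H -> H})
    (d : measure_display) (Omega : measurableType d) (P : probability Omega R)
    (T : R) (W : R -> H0 ip Q -> Omega -> R)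
    (phi : R -> H0 ip Q) (Z : Omega -> R) : Prop :=
  measurable_fun setT (Z : Omega -> measurableTypeR R) /\
  exists s : nat -> seq (R * R * H0 ip Q),
    [/\ forall n, valid_step T (s n),
        LqH0_enorm T 2%:E (step_fun (s n) - phi) @[n --> \oo] --> 0%E
      & Lnorm P 2%:E (fun w => (step_integral W (s n) w - Z w)%:E)
          @[n --> \oo] --> 0%E].

(** * The Malliavin derivative *)

Definition partial (R : realType) (n : nat) (j : 'I_n) (f : 'rV[R]_n -> R)
    (x : 'rV[R]_n) : R := 'D_(delta_mx 0 j) f x.

Definition C1_poly_growth (R : realType) (n : nat) (f : 'rV[R]_n -> R) : Prop :=
  [/\ forall x, differentiable f x,
      forall j, continuous (partial j f)
    & forall j, exists (C : R) (m : nat),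
        forall x, `|partial j f x| <= C * (1 + `|x|) ^+ m].

(* [F] is in S^q and [DF] is its Malliavin derivative: graph of D on S^q. *)
Definition malliavin (R : realType) (H : completeNormedModType R)
    (ip : {dot H for idfun}) (Q : {linear H -> H})
    (d : measure_display) (Omega : measurableType d) (P : probability Omega R)
    (T : R) (W : R -> H0 ip Q -> Omega -> R) (q : \bar R)
    (F : Omega -> R) (DF : Omega -> R -> H0 ip Q) : Prop :=
  exists (n : nat) (phi : 'I_n -> R -> H0 ip Q) (Z : 'I_n -> Omega -> R)
         (f : 'rV[R]_n -> R),
    [/\ forall j, (LqH0_enorm T q (phi j) < +oo)%E,
        forall j, is_wiener_integral P T W (phi j) (Z j),
        C1_poly_growth f,
        F = (fun w => f (\row_j Z j w))
      & DF = (fun w t => \sum_j partial j f (\row_k Z k w) *: phi j t)].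

(* h (x) g as an operator H_0 -> H *)
Definition tensor (R : realType) (H : completeNormedModType R)
    (ip : {dot H for idfun}) (Q : {linear H -> H}) (h : H) (g : H0 ip Q) :
    H0 ip Q -> H :=
  fun u => ipH0 g u *: h.

(* Graph of D on S^q(H). *)
Definition malliavinH (R : realType) (H : completeNormedModType R)
    (ip : {dot H for idfun}) (Q : {linear H -> H})
    (d : measure_display) (Omega : measurableType d) (P : probability Omega R)
    (T : R) (W : R -> H0 ip Q -> Omega -> R) (q : \bar R)
    (X : Omega -> H) (DX : Omega -> R -> H0 ip Q -> H) : Prop :=
  exists (n : nat) (h : 'I_n -> H) (F : 'I_n -> Omega -> R)
         (DF : 'I_n -> Omega -> R -> H0 ip Q),
    [/\ forall j, malliavin P T W q (F j) (DF j),
        X = (fun w => \sum_j F j w *: h j)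
      & DX = (fun w t => \sum_j tensor (h j) (DF j w t))].

(** * Unbounded operators *)

(* An unbounded operator is given by its graph [B]; since elements of the
   spaces are represented up to null seminorm, being single-valued means that
   [B] descends to classes. *)
Record unbounded_operator (R : realType) (U V : lmodType R)
    (NU : U -> \bar R) (NV : V -> \bar R) (B : U -> V -> Prop) : Prop :=
  UnboundedOperator {
  uo_dom : forall u v, B u v -> (NU u < +oo)%E;
  uo_cod : forall u v, B u v -> (NV v < +oo)%E;
  uo_zero : B 0 0;
  uo_linear : forall (a : R) u v u' v',
    B u v -> B u' v' -> B (a *: u + u') (a *: v + v');
  uo_single : forall u v, B u v -> NU u = 0%E -> NV v = 0%E }.

Definition closable (R : realType) (U V : lmodType R)
    (NU : U -> \bar R) (NV : V -> \bar R) (B : U -> V -> Prop) : Prop :=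
  forall (u : nat -> U) (Bu : nat -> V) (v : V),
    (forall n, B (u n) (Bu n)) ->
    NU (u n) @[n --> \oo] --> 0%E ->
    (NV v < +oo)%E -> NV (Bu n - v) @[n --> \oo] --> 0%E ->
    NV v = 0%E.

(* Main.v *)
From HB Require Import structures.
From mathcomp Require Import all_boot all_order all_algebra.
From mathcomp Require Import all_classical all_reals all_analysis.
From mathcomp Require Import ess_sup_inf measurable_realfun ring lra.
Require Import Defs.

(* The Malliavin derivative is dual to a divergence: for X in S^q(H) and L a
   finite sum of variables W(t)u,
     E[cos(L + c) <D X, 1_[0,b] e (x) h>] = E[<X, h> xi],
   where xi does not depend on X and has all moments.  If X_n -> 0 in L^p and D X_n -> v, then by
     Hoelder the right side
   tends to 0, so E[cos(L + c) <v, 1_[0,b] e (x) h>] = 0 for all L and c.  These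
   cosines are total in L^1, which forces v = 0 after letting b, e and h range
   over countable total sets.

   Integration by parts is first verified for trigonometric functions of
   Gaussian variables, where everything is explicit.  It extends to functions of
   polynomial growth because a vector space of functions that is closed under
   dominated limits and under multiplication by cos(s z_j + b) contains the
   indicators of {z_j < a} (Bernstein polynomials of a sine), hence, by
   approximation on grids, all continuous functions of z. *)

Set Implicit Arguments.
Unset Strict Implicit.
Unset Printing Implicit Defensive.

Import Order.TTheory GRing.Theory Num.Theory.
Import numFieldNormedType.Exports.

Local Open Scope classical_set_scope.
Local Open Scope ring_scope.

(** The variable xi contains the Gaussian factor W(b)e. It is unbounded but lies in every L^r with r
    finite, which is exactly what Hoelder's inequality against L^p with p > 1 asks for. The main
    obstacle is that a formula containing the partial derivatives of f does not pass to dominated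
    limits of f. With c_j = E[Z_j W(b)e] one therefore works with the increment f(Z + eps c) - f(Z):
    tested against cos(L + c) it equals the integral over s in [0, eps] of E[f(Z + s c) xi]. No
    derivative occurs there, and dividing by eps and letting eps tend to 0 brings the derivatives
    back. The second obstacle is that [W] is given one vector u at a time. Linearity in u holds only
    up to null sets and is drawn from the covariance. Joint normality of finite sums comes from the
    independence of increments, after the times have been sorted. Every algebraic identity between
    sums of values of [W] is thus an almost sure one. *)

Lemma quadratic_ge0_eq0 (R : realType) (b c : R) : 0 <= c ->
  (forall t, 0 <= c * t ^+ 2 - 2 * b * t) -> b = 0.
Proof.
(* The denominator c + 1 in place of c, which would give the minimiser, covers c = 0 as well; the
   value of the quadratic there is -(b / (c + 1))^2 (c + 2). *)
move=> c0 /(_ (b / (c + 1))) h.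
have c1 : c + 1 != 0 by apply/negbT/gt_eqF; lra.
have E : c * (b / (c + 1)) ^+ 2 - 2 * b * (b / (c + 1)) =
    - ((b / (c + 1)) ^+ 2 * (c + 2)) by field.
move: h; rewrite E oppr_ge0 => h.
have c2 : (c + 2 == 0) = false by apply/gt_eqF; lra.
have : (b / (c + 1)) ^+ 2 * (c + 2) == 0.
  by rewrite eq_le h mulr_ge0 ?sqr_ge0// addr_ge0.
by rewrite mulf_eq0 c2 orbF sqrf_eq0 mulf_eq0 invr_eq0 (negbTE c1) orbF => /eqP.
Qed.

(** * Positive semidefinite symmetric bilinear forms *)

Section PositiveForms.
Variables (R : realType) (V : lmodType R) (B : V -> V -> R).
Hypothesis BC : forall x y, B x y = B y x.
Hypothesis Bl : forall a x y z, B (a *: x + y) z = a * B x z + B y z.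
Hypothesis B_ge0 : forall x, 0 <= B x x.

Lemma bform0l z : B 0 z = 0.
Proof. by have := Bl (-1) 0 0 z; rewrite scaler0 addr0 mulN1r addNr. Qed.

Lemma bformZl a x z : B (a *: x) z = a * B x z.
Proof. by rewrite -[a *: x]addr0 Bl bform0l addr0. Qed.

Lemma bformDl x y z : B (x + y) z = B x z + B y z.
Proof. by rewrite -[x]scale1r Bl mul1r scale1r. Qed.

Lemma bformNl x z : B (- x) z = - B x z.
Proof. by rewrite -scaleN1r bformZl mulN1r. Qed.

Lemma bformBl x y z : B (x - y) z = B x z - B y z.
Proof. by rewrite bformDl bformNl. Qed.

Lemma bform_suml (I : Type) (s : seq I) (P : pred I) (F : I -> V) z :
  B (\sum_(i <- s | P i) F i) z = \sum_(i <- s | P i) B (F i) z.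
Proof.
apply: (big_morph (B ^~ z)); last exact: bform0l.
by move=> x y; exact: bformDl.
Qed.

Lemma bform_sumr (I : Type) (s : seq I) (P : pred I) (F : I -> V) z :
  B z (\sum_(i <- s | P i) F i) = \sum_(i <- s | P i) B z (F i).
Proof. by rewrite BC bform_suml; apply: eq_bigr => i _; rewrite BC. Qed.

Lemma bform_sqrD x y t :
  B (x + t *: y) (x + t *: y) = B x x + 2 * t * B x y + t ^+ 2 * B y y.
Proof.
rewrite bformDl bformZl ![B _ (x + _)]BC !bformDl !bformZl (BC y x); ring.
Qed.

Lemma psd_CauchySchwarz x y : (B x y) ^+ 2 <= B x x * B y y.
Proof.
have [yy0|yy0] := eqVneq (B y y) 0.
  suff -> : B x y = 0 by rewrite expr0n mulr_ge0.
  have h t : 0 <= B x x + 2 * t * B x y.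
    by have := B_ge0 (x + t *: y); rewrite bform_sqrD yy0 mulr0 addr0.
  (* An affine function of t that stays nonnegative has slope 0: at this t it would take the value
     -1. *)
  have := h (- (B x x + 1) / (2 * B x y)); have := h 0.
  have [//|xy0] := eqVneq (B x y) 0.
  have -> : B x x + 2 * (- (B x x + 1) / (2 * B x y)) * B x y = -1.
    by field.
  by rewrite lerNr oppr0 ler10.
have yy : 0 < B y y by rewrite lt_neqAle eq_sym yy0 B_ge0.
have := B_ge0 (x + (- B x y / B y y) *: y); rewrite bform_sqrD.
have -> : B x x + 2 * (- B x y / B y y) * B x y + (- B x y / B y y) ^+ 2 * B y y
    = (B x x * B y y - B x y ^+ 2) / B y y by field.
by rewrite pmulr_lge0 ?invr_gt0// subr_ge0.
Qed.

Lemma psd_CauchySchwarz_sqrt x y :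
  `|B x y| <= Num.sqrt (B x x) * Num.sqrt (B y y).
Proof.
rewrite -sqrtrM// -sqrtr_sqr; apply: ler_wsqrtr; exact: psd_CauchySchwarz.
Qed.

Lemma psd_sqrt_triangle x y :
  Num.sqrt (B (x + y) (x + y)) <= Num.sqrt (B x x) + Num.sqrt (B y y).
Proof.
rewrite -(ger0_norm (addr_ge0 (sqrtr_ge0 (B x x)) (sqrtr_ge0 (B y y)))).
rewrite -sqrtr_sqr; apply: ler_wsqrtr.
have := bform_sqrD x y 1; rewrite scale1r => ->.
rewrite sqrrD !sqr_sqrtr// mulr1 expr1n mul1r lerD2r lerD2l mulr2n.
have := le_trans (ler_norm _) (psd_CauchySchwarz_sqrt x y); lra.
Qed.

(** Bessel's inequality: with y the orthogonal projection of x on the span of s, both B x y and B y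
    y equal the sum, and B (x - y) (x - y) is nonnegative. *)
Lemma psd_bessel (s : seq V) x : uniq s ->
  (forall e, e \in s -> B e e = 1) ->
  (forall e e', e \in s -> e' \in s -> e <> e' -> B e e' = 0) ->
  \sum_(e <- s) (B x e) ^+ 2 <= B x x.
Proof.
move=> us s1 s0.
set y := \sum_(e <- s) B x e *: e.
have ye e : e \in s -> B y e = B x e.
  move=> es; rewrite /y bform_suml (bigD1_seq e)//= bformZl s1// mulr1.
  rewrite big_seq_cond big1 ?addr0// => e' /andP[e's /eqP e'e].
  by rewrite bformZl (s0 e' e)// mulr0.
have xy : B x y = \sum_(e <- s) (B x e) ^+ 2.
  by rewrite BC /y bform_suml; apply: eq_bigr => e _; rewrite bformZl BC -expr2 BC.
have yy : B y y = \sum_(e <- s) (B x e) ^+ 2.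
  rewrite {2}/y bform_sumr big_seq [RHS]big_seq; apply: eq_bigr => e es.
  by rewrite BC bformZl (BC e y) ye// expr2.
have := B_ge0 (x + (-1) *: y); rewrite bform_sqrD xy yy; lra.
Qed.

End PositiveForms.

(** * Projection in a Hilbert space *)

Section HilbertSpace.
Variables (R : realType) (H : completeNormedModType R) (ip : {dot H for idfun}).
Hypothesis H_hilbert : inner_product_norm ip.

Lemma dotC x y : ip x y = ip y x.
Proof. by rewrite hermC expr0 mul1r. Qed.

Lemma dotPl a x y z : ip (a *: x + y) z = a * ip x z + ip y z.
Proof. by rewrite linearDl /= linearZl_LR. Qed.

Lemma dot_ge0 x : 0 <= ip x x.
Proof. by rewrite -H_hilbert sqr_ge0. Qed.

Lemma dot_normE x : `|x| = Num.sqrt (ip x x).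
Proof. by rewrite -H_hilbert sqrtr_sqr normr_id. Qed.

Lemma dot_CauchySchwarz x y : `|ip x y| <= `|x| * `|y|.
Proof. by rewrite !dot_normE; exact: (psd_CauchySchwarz_sqrt dotC dotPl dot_ge0). Qed.

Lemma dot_parallelogram (x y : H) :
  `|x + y| ^+ 2 + `|x - y| ^+ 2 = 2 * (`|x| ^+ 2 + `|y| ^+ 2).
Proof.
rewrite !H_hilbert.
have := bform_sqrD dotC dotPl x y 1; have := bform_sqrD dotC dotPl x y (-1).
rewrite !scaleN1r !scale1r => -> ->; ring.
Qed.

(** Otherwise some h in D lies at distance less than |x| from x, and |x|^2 = <x, x - h> <= |x| |x -
    h| < |x|^2. *)
Lemma dot_eq0_dense (D : set H) (x : H) : dense D ->
  (forall h, D h -> ip x h = 0) -> x = 0.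
Proof.
move=> dD h0; apply/eqP; apply: contraT => x0.
have nx : 0 < `|x| by rewrite normr_gt0.
have [h [bh Dh]] : ball x `|x| `&` D !=set0.
  apply: dD; last exact: ball_open.
  by exists x; exact: ballxx.
have := dot_CauchySchwarz x (x - h).
have -> : ip x (x - h) = `|x| ^+ 2.
  by rewrite dotC (bformBl dotPl) (dotC h) (h0 h)// subr0 H_hilbert.
rewrite ger0_norm ?sqr_ge0// expr2 ler_pM2l// leNgt.
by move: bh; rewrite -ball_normE /= => ->.
Qed.

(** The Cauchy condition is stated in the shape in which the parallelogram law delivers it for
    minimising sequences. *)
Lemma cauchy_seq_cvg (k : nat -> H) (d : nat -> R) :
  (forall n m, `|k n - k m| ^+ 2 <= d n + d m) -> d n @[n --> \oo] --> 0 ->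
  exists l : H, k n @[n --> \oo] --> l.
Proof.
move=> kd d0; apply/cvg_ex; apply: cauchy_cvg; apply: cauchy_exP => e e0.
have e2 : 0 < e ^+ 2 / 2 by rewrite divr_gt0// exprn_gt0.
have [N _ dN] : \forall n \near \oo, d n < e ^+ 2 / 2.
  by apply: (cvgr_lt 0).
exists (k N); exists N => // n /= Nn.
rewrite -ball_normE /= -(@ltr_pXn2r _ 2)// ?nnegrE// ?ltW//.
rewrite (le_lt_trans (kd _ _))// [ltRHS]splitr ltrD//; apply: dN => //=.
Qed.

Section Projection.
Variable K : set H.
Hypothesis K0 : K 0.
Hypothesis KP : forall a x y, K x -> K y -> K (a *: x + y).
Hypothesis K_closed : closed K.

Lemma hilbert_projection x : exists2 k, K k & forall z, K z -> ip (x - k) z = 0.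
Proof.
pose A := [set `|x - k| ^+ 2 | k in K].
have infA : has_inf A.
  by split; [exists (`|x - 0| ^+ 2); exists 0|exists 0 => _ [k _ <-]; exact: sqr_ge0].
pose dl := inf A.
have dlP k : K k -> dl <= `|x - k| ^+ 2.
  by move=> Kk; apply: ge_inf; [case: infA|exists k].
have /choice[k kP] (n : nat) : exists k, K k /\ `|x - k| ^+ 2 < dl + n.+1%:R^-1.
  have [_ [k Kk <-] h] := @inf_adherent _ A n.+1%:R^-1 ltac:(by rewrite invr_gt0) infA.
  by exists k.
have Kk n : K (k n) := (kP n).1.
have [l kl] : exists l : H, k n @[n --> \oo] --> l.
  apply: (@cauchy_seq_cvg _ (fun n => 2 * n.+1%:R^-1)) => [n m|]; last first.
    rewrite -(mulr0 2); apply: cvgMr => //.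
    by have := @cvg_harmonic R.
  (* The midpoint of k n and k m belongs to K, so its squared distance to x is at least [dl]; the
     parallelogram law then bounds |k n - k m|^2 by the sum of the two excesses, doubled. *)
  have := dot_parallelogram (x - k n) (x - k m).
  have -> : x - k n - (x - k m) = - (k n - k m).
    by rewrite opprB addrCA -addrA subrKC opprB.
  have -> : x - k n + (x - k m) = 2 *: (x - 2^-1 *: (k n + k m)).
    rewrite scalerBr scalerA mulfV// scale1r scaler_nat mulr2n opprD.
    by rewrite addrACA.
  have := dlP (2^-1 *: (k n + k m)).
  rewrite normrN normrZ exprMn => /(_ _)/wrap[].
    rewrite -[_ *: _]addr0; apply: KP => //.
    by rewrite -[k n]scale1r; apply: KP.
  have := (kP n).2; have := (kP m).2.
  rewrite (ger0_norm (ler0n _ 2)); set u := n.+1%:R^-1; set v := m.+1%:R^-1.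
  by move=> *; lra.
have Kl : K l by apply: (closed_cvg _ K_closed _ _ kl); exact: nearW.
exists l => // z Kz.
have xl : `|x - l| ^+ 2 <= dl.
  apply/ler_addgt0Pr => e e0.
  have h : (`|x - k n| ^+ 2) @[n --> \oo] --> `|x - l| ^+ 2.
    apply: (@cvg_comp _ _ _ (fun n => `|x - k n|) (fun y => y ^+ 2)).
      by apply: cvg_norm; exact: (cvgB (cvg_cst x) kl).
    exact: sqr_continuous.
  apply: (cvgr_to_le h); near=> n.
  rewrite (le_trans (ltW (kP n).2))// lerD2l.
  near: n; exact: (cvgr_le 0 (@cvg_harmonic R)).
(* Moving the minimiser l by t z inside K cannot decrease the distance to x; the resulting quadratic
   in t has linear coefficient -2 <x - l, z>. *)
apply: (@quadratic_ge0_eq0 _ _ (ip z z)) => [|t]; first exact: dot_ge0.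
have := dlP (t *: z + l) (KP _ Kz Kl).
have -> : x - (t *: z + l) = (x - l) + (- t) *: z.
  by rewrite scaleNr opprD addrA addrAC.
rewrite H_hilbert (bform_sqrD dotC dotPl) -H_hilbert; lra.
Unshelve. all: by end_near. Qed.

End Projection.
End HilbertSpace.

(** * The space H_0 and its inner product *)

Section SpaceH0.
Variables (R : realType) (H : completeNormedModType R) (ip : {dot H for idfun}).
Hypothesis H_hilbert : inner_product_norm ip.
Variable Q : {linear H -> H}.
Local Notation S := (sqrt_op ip Q).
Local Notation U := (H0 ip Q).

Lemma sqrt_op_pos : positive_op ip S.
Proof.
rewrite /sqrt_op; case: pselect => [exS|_]; first by have [] := projT2 (cid exS).
split=> [|x y|x].
- by exists 0 => x; rewrite mul0r normr0.
- by rewrite (bform0l (dotPl ip)) (dotC ip x) (bform0l (dotPl ip)).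
- by rewrite (bform0l (dotPl ip)).
Qed.

Lemma sqrt_op_ker_closed : closed [set k | S k = 0].
Proof.
have [[C SC] _ _] := sqrt_op_pos.
have Sc : continuous S.
  by apply: bounded_linear_continuous; apply/linear_boundedP; near=> r => x;
    rewrite (le_trans (SC x))// ler_wpM2r//; near: r; exact: nbhs_pinfty_ge.
rewrite [X in closed X](_ : _ = S @^-1` [set 0])//.
apply: (@preimage_closed _ _ S [set 0]) => //.
by apply: accessible_closed_set1; apply: hausdorff_accessible; exact: norm_hausdorff.
Unshelve. all: by end_near. Qed.

(** The point is existence: from any preimage of u subtract its projection on the closed kernel of
    [S]. So [xget] never falls back on its default value. *)
Lemma sqrt_invP (u : U) :
  S (sqrt_inv u) = val u /\ forall k, S k = 0 -> ip (sqrt_inv u) k = 0.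
Proof.
rewrite /sqrt_inv; case: xgetP => [x _ //|noinv].
exfalso; case: u noinv => u /= uS; have /asboolP[x Sx] := uS.
have [||k Kk orth] := @hilbert_projection _ _ _ H_hilbert [set k | S k = 0] _ _
  sqrt_op_ker_closed x.
- exact: linear0.
- by move=> a y z /= y0 z0; rewrite linearP y0 z0 scaler0 addr0.
move=> /(_ (x - k)); apply; split=> //=.
by rewrite linearB Kk subr0.
Qed.

(** The difference of two candidates lies in the kernel of [S] and is orthogonal to it. Linearity of
    the pseudo-inverse follows from this uniqueness. *)
Lemma sqrt_inv_unique (u : U) x :
  S x = val u -> (forall k, S k = 0 -> ip x k = 0) -> sqrt_inv u = x.
Proof.
move=> Sx xk; have [Su uk] := sqrt_invP u.
apply/eqP; rewrite -subr_eq0 -normr_eq0 -sqrf_eq0 H_hilbert.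
have Sk : S (sqrt_inv u - x) = 0 by rewrite linearB Su Sx subrr.
by rewrite (bformBl (dotPl ip)) uk// xk// subrr.
Qed.

Lemma sqrt_invPl a (u v : U) :
  sqrt_inv (a *: u + v) = a *: sqrt_inv u + sqrt_inv v.
Proof.
have [Su uk] := sqrt_invP u; have [Sv vk] := sqrt_invP v.
apply: sqrt_inv_unique => [|k Sk]; first by rewrite linearP Su Sv.
by rewrite dotPl uk// vk// mulr0 addr0.
Qed.

Lemma ipH0C (u v : U) : ipH0 u v = ipH0 v u.
Proof. exact: dotC. Qed.

Lemma ipH0Pl a (u v w : U) : ipH0 (a *: u + v) w = a * ipH0 u w + ipH0 v w.
Proof. by rewrite /ipH0 sqrt_invPl dotPl. Qed.

Lemma ipH0_ge0 (u : U) : 0 <= ipH0 u u.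
Proof. exact: dot_ge0. Qed.

Lemma normH0_sqr (u : U) : normH0 u ^+ 2 = ipH0 u u.
Proof. by rewrite sqr_sqrtr// ipH0_ge0. Qed.

Lemma normH0_ge0 (u : U) : 0 <= normH0 u.
Proof. exact: sqrtr_ge0. Qed.

Lemma normH00 : normH0 (0 : U) = 0.
Proof. by rewrite /normH0 (bform0l ipH0Pl) sqrtr0. Qed.

Lemma ler_normH0D (u v : U) : normH0 (u + v) <= normH0 u + normH0 v.
Proof. exact: (psd_sqrt_triangle ipH0C ipH0Pl ipH0_ge0). Qed.

Lemma normH0Z a (u : U) : normH0 (a *: u) = `|a| * normH0 u.
Proof.
rewrite /normH0 (bformZl ipH0Pl) ipH0C (bformZl ipH0Pl) mulrA -expr2.
by rewrite sqrtrM ?sqr_ge0// sqrtr_sqr.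
Qed.

Lemma ipH0_CauchySchwarz (u v : U) : `|ipH0 u v| <= normH0 u * normH0 v.
Proof. exact: (psd_CauchySchwarz_sqrt ipH0C ipH0Pl ipH0_ge0). Qed.

Lemma normH0_inv (u : U) : normH0 u = `|sqrt_inv u|.
Proof. by rewrite (dot_normE H_hilbert). Qed.

(** Distinct members of E are at distance sqrt 2. Separability of H is carried to H_0 by the
    isometry [sqrt_inv]: attach to each e a point of D within 1/2 of [sqrt_inv e]; two members with
    the same point would be at distance less than 1. *)
Lemma orthonormal_countable (E : set U) : separable H ->
  (forall e, E e -> ipH0 e e = 1) ->
  (forall e e', E e -> E e' -> e <> e' -> ipH0 e e' = 0) -> countable E.
Proof.
move=> [D cD dD] E1 E0.
have /choice[g gP] (e : U) : exists x, D x /\ `|sqrt_inv e - x| < 2^-1.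
  have [x [bx Dx]] : ball (sqrt_inv e) 2^-1 `&` D !=set0.
    by apply: dD; [exists (sqrt_inv e); exact: ballxx|exact: ball_open].
  by exists x; split=> //; move: bx; rewrite -ball_normE.
have /countable_injP[f f_inj] := cD.
apply/countable_injP; exists (f \o g) => e e' /set_mem Ee /set_mem Ee' /= fg.
have [//|/E0 ee'] := pselect (e = e'); exfalso.
have {}fg : g e = g e' by apply: f_inj fg; rewrite inE; apply: (gP _).1.
have : normH0 (e - e') ^+ 2 = 2.
  have -> : e - e' = e + (-1) *: e' by rewrite scaleN1r.
  rewrite normH0_sqr (bform_sqrD ipH0C ipH0Pl) !E1// ee'//; ring.
have h : normH0 (e - e') < 1.
  rewrite (le_lt_trans (_ : _ <= normH0 (e - e')))// normH0_inv.
  have -> : sqrt_inv (e - e') = (sqrt_inv e - g e) - (sqrt_inv e' - g e').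
    rewrite fg opprB addrA subrK -[e - e']addrC -scaleN1r sqrt_invPl scaleN1r.
    by rewrite addrC.
  rewrite (le_lt_trans (ler_normB _ _))// [ltRHS](splitr 1) mul1r.
  by apply: ltrD; apply: (gP _).2.
by move/eqP; rewrite lt_eqF// expr2 (le_lt_trans (_ : _ <= 1))// ?ltr1n// mulr_ile1 ?normH0_ge0
  ?ltW.
Qed.

End SpaceH0.

(** * Bochner spaces and Hilbert-Schmidt operators *)

Section LnormReal.
Context d (X : measurableType d) (R : realType).
Variable mu : {measure set X -> \bar R}.
Implicit Types (f g : X -> R) (r : \bar R).

Lemma measurable_powR_norm f (p : R) : measurable_fun setT f ->
  measurable_fun setT (fun x => `|f x| `^ p).
Proof.
move=> mf; apply/(@measurableT_comp _ _ _ _ _ _ (@powR R ^~ p)) => //.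
exact: measurableT_comp.
Qed.

Lemma le_Lnorm r f g : (1 <= r)%E -> measurable_fun setT f -> measurable_fun setT g ->
  (forall x, `|f x| <= `|g x|) -> (Lnorm mu r (EFin \o f) <= Lnorm mu r (EFin \o g))%E.
Proof.
move=> r1 mf mg fg; rewrite unlock; case: r r1 => [r|_|//]; last first.
  by case: ifPn => // _; apply: le_ess_sup; apply/nearW => x /=; rewrite lee_fin.
rewrite lee_fin => r1; have r0 : 0 < r := lt_le_trans ltr01 r1.
apply: gt0_ler_poweR; first by rewrite invr_ge0 ltW.
- by rewrite in_itv/= leey andbT integral_ge0// => x _; exact: poweR_ge0.
- by rewrite in_itv/= leey andbT integral_ge0// => x _; exact: poweR_ge0.
apply: ge0_le_integral => //.
- by move=> x _; exact: poweR_ge0.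
- by apply/measurable_EFinP; exact: measurable_powR_norm.
- by apply/measurable_EFinP; exact: measurable_powR_norm.
move=> x _ /=; rewrite lee_fin ge0_ler_powR ?nnegrE//.
exact: ltW.
Qed.

Lemma LnormZ_real r f a : (1 <= r)%E -> measurable_fun setT f ->
  (Lnorm mu r (EFin \o (fun x => (a * f x)%R)) = `|a|%:E * Lnorm mu r (EFin \o f))%E.
Proof.
move=> r1 mf; rewrite unlock; case: r r1 => [r|_|//]; last first.
  case: ifPn => muT; last by rewrite mule0.
  rewrite -ess_supZl//; congr ess_sup; apply/funext => x /=.
  by rewrite normrM EFinM.
rewrite lee_fin => r1; have r0 : 0 < r := lt_le_trans ltr01 r1.
under eq_integral => x _.
  rewrite /= normrM powRM// EFinM; over.
have mp := measurable_powR_norm r mf.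
rewrite ge0_integralZl//=; last exact/measurable_EFinP.
rewrite poweRM ?lee_fin ?powR_ge0//; last first.
  by apply: integral_ge0 => x _; rewrite lee_fin powR_ge0.
by rewrite poweR_EFin -powRrM mulfV ?gt_eqF// powRr1.
Qed.

(** The constant depends on r and on the total mass only. For r = +oo the integrand is bounded by
    its essential supremum, for r = 1 there is equality, and otherwise this is Hoelder's inequality
    against the constant 1. *)
Lemma integral_le_Lnorm r : (1 <= r)%E -> mu setT \is a fin_num ->
  exists2 C : R, 0 <= C & forall f, measurable_fun setT f ->
    (\int[mu]_x `|f x|%:E <= C%:E * Lnorm mu r (EFin \o f))%E.
Proof.
move=> r1 muT; case: r r1 => [r||//]; last first.
  move=> _; exists (fine (mu setT)); first by rewrite fine_ge0.
  move=> f mf; rewrite fineK// unlock.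
  have mnf : measurable_fun setT (EFin \o (fun x => `|f x|)).
    by apply/measurable_EFinP; exact: measurableT_comp.
  have [mu0|mu0] := ltP 0%E (mu setT); last first.
    have mu0' : mu setT = 0%E by apply/eqP; rewrite eq_le mu0 measure_ge0.
    by rewrite mu0' mul0e null_set_integral.
  set M := ess_sup _ _.
  have M0 : (0 <= M)%E by apply: ess_sup_gee => //; apply/nearW => x; exact: abse_ge0.
  rewrite muleC -integral_cst//; apply: ae_ge0_le_integral => //.
  by apply: filterS (ess_sup_ge mu (abse \o (EFin \o f))) => x /= h _.
rewrite lee_fin le_eqVlt => /predU1P[<-|r1].
  by exists 1 => // f mf; rewrite mul1e Lnorm1.
have r0 : 0 < r := lt_trans ltr01 r1.
pose r' := (1 - r^-1)^-1.
have r'0 : 0 < r' by rewrite invr_gt0 subr_gt0 invf_lt1.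
exists (fine (Lnorm mu r'%:E (EFin \o cst 1%R))); first by rewrite fine_ge0// Lnorm_ge0.
move=> f mf; rewrite fineK; last first.
  by rewrite Lnorm_cst1 fin_num_poweR.
have := @hoelder _ _ _ mu f (cst 1) r r' mf (measurable_cst _) r0 r'0.
rewrite /r' invrK addrC subrK => /(_ erefl); rewrite Lnorm1 muleC.
by under eq_integral do rewrite /= mulr1.
Qed.

End LnormReal.

(** This class is stable under [bochner_enorm], so whatever is proved for it applies at each stage
    of the iterated norm of L^p(Omega, L^q([0, T], L_2(H_0, H))). In [esnZ] the product 0 * +oo is
    0. *)
Record eseminorm (R : realType) (V : lmodType R) (N : V -> \bar R) : Prop :=
  ESeminorm {
  esn0 : N 0 = 0%E;
  esn_ge0 : forall x, (0 <= N x)%E;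
  esnD : forall x y, (N (x + y)%R <= N x + N y)%E;
  esnZ : forall (a : R) x, (N (a *: x)%R <= `|a|%:E * N x)%E }.

Section ESeminorm.
Variables (R : realType) (V : lmodType R) (N : V -> \bar R).
Hypothesis sN : eseminorm N.
Local Open Scope ereal_scope.

Lemma esnN x : N (- x)%R = N x.
Proof.
have le y : N (- y)%R <= N y.
  by rewrite -scaleN1r (le_trans (esnZ sN _ _))// normrN normr1 mul1e.
by apply/eqP; rewrite eq_le le/= -{1}(opprK x) le.
Qed.

Lemma esnB x y : N (x - y)%R <= N x + N y.
Proof. by rewrite (le_trans (esnD sN _ _))// esnN. Qed.

Lemma esn_le_sub x y : N x <= N y + N (x - y)%R.
Proof. by rewrite (le_trans _ (esnD sN _ _))// addrC subrK. Qed.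

Lemma esn_sum_lty (I : Type) (s : seq I) (F : I -> V) :
  (forall i, N (F i) < +oo) -> N (\sum_(i <- s) F i)%R < +oo.
Proof.
move=> F_fin; elim/big_rec: _ => [|i x _ Nx]; first by rewrite (esn0 sN).
by rewrite (le_lt_trans (esnD sN _ _))// lte_add_pinfty.
Qed.

Lemma esn_dist x y : N x < +oo -> N y < +oo ->
  (`|fine (N x) - fine (N y)|%:E <= N (x - y)%R).
Proof.
move=> xoo yoo.
have xfin : N x \is a fin_num by rewrite ge0_fin_numE ?esn_ge0.
have yfin : N y \is a fin_num by rewrite ge0_fin_numE ?esn_ge0.
have [xyoo|xyoo] := eqVneq (N (x - y)%R) +oo; first by rewrite xyoo leey.
have xyfin : N (x - y)%R \is a fin_num by rewrite ge0_fin_numE ?esn_ge0// ltey.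
rewrite -(fineK xyfin) lee_fin ler_norml; apply/andP; split.
  rewrite lerBrDl lerBlDr -lee_fin EFinD !fineK// (le_trans (esn_le_sub y x))//.
  by apply: leeD2l; rewrite -esnN opprB.
by rewrite lerBlDl -lee_fin EFinD !fineK// esn_le_sub.
Qed.

End ESeminorm.

Import HBSimple.

Section StrongMeasurability.
Context d (X : measurableType d) (R : realType).
Local Open Scope ereal_scope.

Lemma simple_comp2 (A B C : Type) (F : A -> B -> C) (s : X -> A) (t : X -> B) :
  finite_set (range s) -> (forall v, measurable (s @^-1` [set v])) ->
  finite_set (range t) -> (forall v, measurable (t @^-1` [set v])) ->
  finite_set (range (fun x => F (s x) (t x))) /\
  forall v, measurable ((fun x => F (s x) (t x)) @^-1` [set v]).
Proof.
move=> fs ms ft mt; split.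
  apply: (sub_finite_set _ (finite_image2 F fs ft)) => _ [x _ <-].
  by exists (s x); [exists x|exists (t x); [exists x|]].
move=> v; rewrite (_ : _ @^-1` _ = \bigcup_(a in range s)
   \bigcup_(b in range t) (if `[< F a b = v >] then
      s @^-1` [set a] `&` t @^-1` [set b] else set0)).
  apply: fin_bigcup_measurable => // a _; apply: fin_bigcup_measurable => // b _.
  by case: ifP => // _; exact: measurableI.
apply/seteqP; split=> [x /= xv|x [_ [y _ <-]] [_ [z _ <-]]].
  exists (s x); first by exists x.
  by exists (t x); [exists x|rewrite asboolT].
by case: asboolP => // <- /= [-> ->].
Qed.

Lemma simple_comp (A C : Type) (F : A -> C) (s : X -> A) :
  finite_set (range s) -> (forall v, measurable (s @^-1` [set v])) ->
  finite_set (range (F \o s)) /\ forall v, measurable ((F \o s) @^-1` [set v]).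
Proof.
by move=> fs ms; have := @simple_comp2 _ _ _ (fun a _ => F a) s s fs ms fs ms.
Qed.

Lemma simple_measurable (s : X -> R) :
  finite_set (range s) -> (forall v, measurable (s @^-1` [set v])) ->
  measurable_fun setT s.
Proof.
move=> fs ms _ B mB; rewrite setTI.
rewrite (_ : s @^-1` B = \bigcup_(v in range s `&` B) s @^-1` [set v]).
  by apply: fin_bigcup_measurable => //; exact: finite_setIl.
by apply/seteqP; split=> [x /= Bx|x [_ [[y _ <-]] Bs /= ->//]]; exists (s x) => //;
  split=> //; exists x.
Qed.

Section Seminorm.
Variables (V : lmodType R) (N : V -> \bar R).
Hypothesis sN : eseminorm N.

(** Simple functions have finite seminorm everywhere, and f x is at seminorm distance less than 1
    from one of them. *)
Lemma strongly_measurable_lty (f : X -> V) x : strongly_measurable N f -> N (f x) < +oo.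
Proof.
move=> [s [ss sf]].
have [n _ /(_ n (leqnn n)) h] : \forall n \near \oo, N (s n x - f x)%R < 1%:E.
  by have := sf x => /fine_cvgP[+ /cvgr_lt/(_ 1%R ltr01)]; apply: filterS2 => n fin;
    rewrite -lte_fin fineK.
rewrite (le_lt_trans (esn_le_sub sN _ (s n x)))// lte_add_pinfty//; first by have [_ _] := ss n.
by rewrite -esnN// opprB (lt_trans h)// ltry.
Qed.

Lemma strongly_measurable_comp (lam : V -> R) (f : X -> V) :
  (forall (u : nat -> V) l, (forall n, N (u n) < +oo) -> N l < +oo ->
     N (u n - l)%R @[n --> \oo] --> 0 -> lam (u n) @[n --> \oo] --> lam l) ->
  strongly_measurable N f -> measurable_fun setT (lam \o f).
Proof.
move=> lamc mf; have [s [ss sf]] := mf.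
apply: (@measurable_fun_cvg _ _ _ setT (fun n => lam \o s n)).
  by move=> n; have [fs ms _] := ss n; have [] := simple_comp lam fs ms; exact: simple_measurable.
move=> x _; apply: lamc => [n| |]; [by have [_ _] := ss n| |exact: sf].
exact: strongly_measurable_lty.
Qed.

(** The Lipschitz bound is asked only between points of finite seminorm: a functional such as
    [pairing] is an integral, which is meaningful only there. *)
Lemma strongly_measurable_lip (lam : V -> R) (C : R) (f : X -> V) :
  (forall x y, N x < +oo -> N y < +oo -> (`|lam x - lam y|%:E <= C%:E * N (x - y)%R)) ->
  strongly_measurable N f -> measurable_fun setT (lam \o f).
Proof.
move=> lamC; apply: strongly_measurable_comp => u l ufin lfin ul.
have h : `|lam (u n) - lam l|%:E @[n --> \oo] --> 0.
  apply: (@squeeze_cvge _ _ _ _ (fun _ => 0) _ (fun n => C%:E * N (u n - l)%R)).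
  - by apply: nearW => n; rewrite lee_fin normr_ge0 lamC.
  - exact: cvg_cst.
  - by rewrite -[0](mule0 C%:E); apply: cvgeZl.
apply/cvgrPdist_le => e e0.
have := h => /fine_cvgP[_ /cvgr_le/(_ e e0)]; apply: filterS => n /=.
by rewrite distrC.
Qed.

Lemma measurable_fine_norm (f : X -> V) :
  strongly_measurable N f -> measurable_fun setT (fine \o (N \o f)).
Proof.
move=> mf; apply: (@strongly_measurable_lip (fine \o N) 1%R) => // x y xoo yoo.
by rewrite mul1e; exact: esn_dist.
Qed.

Lemma fine_normK (f : X -> V) :
  strongly_measurable N f -> N \o f = EFin \o (fine \o (N \o f)).
Proof.
move=> mf; apply/funext => x /=; rewrite fineK// ge0_fin_numE ?esn_ge0//.
exact: strongly_measurable_lty.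
Qed.

Lemma bochner_simpleD (s t : X -> V) :
  bochner_simple N s -> bochner_simple N t -> bochner_simple N (s + t)%R.
Proof.
move=> [fs ms Ns] [ft mt Nt].
have [fst mst] := simple_comp2 (fun a b => a + b)%R fs ms ft mt.
by split=> // x; rewrite (le_lt_trans (esnD sN _ _))// lte_add_pinfty.
Qed.

Lemma bochner_simpleZ a (s : X -> V) :
  bochner_simple N s -> bochner_simple N (a *: s)%R.
Proof.
move=> [fs ms Ns].
have [fst mst] := simple_comp (fun v => a *: v)%R fs ms.
by split=> // x; rewrite (le_lt_trans (esnZ sN _ _))// lte_mul_pinfty.
Qed.

Lemma bochner_simple_cst v : N v < +oo -> bochner_simple N (fun _ : X => v).
Proof.
move=> Nv; split=> // [|w].
  by apply: (sub_finite_set _ (finite_set1 v)) => _ [x _ <-].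
have [<-|/eqP vw] := eqVneq v w.
  by rewrite [X in measurable X](_ : _ = setT)//; apply/seteqP; split.
by rewrite [X in measurable X](_ : _ = set0)//; apply/seteqP; split.
Qed.

Lemma bochner_simple_strongly (s : X -> V) :
  bochner_simple N s -> strongly_measurable N s.
Proof.
move=> ss; exists (fun _ => s); split=> // x.
under eq_fun do rewrite subrr (esn0 sN); exact: cvg_cst.
Qed.

Lemma strongly_measurableD (f g : X -> V) :
  strongly_measurable N f -> strongly_measurable N g -> strongly_measurable N (f + g)%R.
Proof.
move=> [s [ss sf]] [t [st tg]]; exists (fun n => s n + t n)%R; split=> [n|x].
  exact: bochner_simpleD.
apply: (@squeeze_cvge _ _ _ _ (fun _ => 0) _ (fun n => N (s n x - f x)%R + N (t n x - g x)%R)).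
- apply: nearW => n; rewrite esn_ge0//= (le_trans _ (esnD sN _ _))//.
  by rewrite addrACA -opprD.
- exact: cvg_cst.
- by rewrite -[0]adde0; apply: cvgeD.
Qed.

Lemma strongly_measurableZ a (f : X -> V) :
  strongly_measurable N f -> strongly_measurable N (a *: f)%R.
Proof.
move=> [s [ss sf]]; exists (fun n => a *: s n)%R; split=> [n|x].
  exact: bochner_simpleZ.
apply: (@squeeze_cvge _ _ _ _ (fun _ => 0) _ (fun n => `|a|%:E * N (s n x - f x)%R)).
- apply: nearW => n; rewrite esn_ge0//= (le_trans _ (esnZ sN _ _))//.
  by rewrite scalerBr.
- exact: cvg_cst.
- by rewrite -[0](mule0 `|a|%:E); apply: cvgeZl => //; exact: sf.
Qed.

Lemma strongly_measurable_scale (c : X -> R) (v : V) :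
  measurable_fun setT c -> N v < +oo -> strongly_measurable N (fun x => c x *: v)%R.
Proof.
move=> mc Nv.
have mEc : measurable_fun setT (EFin \o c) by apply/measurable_EFinP.
have [g gc] := approximation_sfun (@measurableT _ X) mEc.
exists (fun n x => g n x *: v)%R; split=> [n|x].
  have [fs ms] := simple_comp (fun a : R => a *: v)%R
    (@fimfunP _ _ (g n)) (fun w => measurable_funPTI (g n) (measurable_set1 w)).
  by split=> // x; rewrite (le_lt_trans (esnZ sN _ _))// lte_mul_pinfty.
apply: (@squeeze_cvge _ _ _ _ (fun _ => 0) _ (fun n => `|g n x - c x|%:E * N v)).
- apply: nearW => n; rewrite esn_ge0//= (le_trans _ (esnZ sN _ _))//.
  by rewrite scalerBl.
- exact: cvg_cst.
- rewrite -[0](mul0e (N v)); apply: cvgeZr; first by rewrite ge0_fin_numE// esn_ge0.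
  have := gc x Logic.I => /fine_cvgP[_ gcx].
  apply: cvg_EFin; first exact: nearW.
  rewrite -[X in _ --> X](normr0 R) -(subrr (c x)).
  by apply: cvg_norm; apply: cvgB => //; exact: cvg_cst.
Qed.

Variables (mu : {measure set X -> \bar R}) (r : \bar R).
Hypothesis r1 : 1 <= r.

Lemma bochner_enorm_seminorm : eseminorm (bochner_enorm mu r N).
Proof.
split.
- rewrite /bochner_enorm asboolT.
    rewrite (eq_Lnorm _ _ (g := cst 0)) ?Lnorm0// => [|x /=]; last by rewrite (esn0 sN).
    by rewrite gt_eqF// (lt_le_trans lte01).
  by apply/bochner_simple_strongly/bochner_simple_cst; rewrite (esn0 sN).
- by move=> f; rewrite /bochner_enorm; case: ifP => _; rewrite ?Lnorm_ge0 ?leey.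
- move=> f g; rewrite /bochner_enorm.
  case: (asboolP (strongly_measurable N f)) => [mf|_]; last first.
    by rewrite addye ?leey// -ltNye (lt_le_trans (ltNyr 0%R))//; case: ifP => _;
      rewrite ?Lnorm_ge0 ?leey.
  case: (asboolP (strongly_measurable N g)) => [mg|_]; last first.
    by rewrite addey ?leey// -ltNye (lt_le_trans (ltNyr 0%R))// Lnorm_ge0.
  have mfg := strongly_measurableD mf mg.
  rewrite asboolT//.
  have mf' := measurable_fine_norm mf; have mg' := measurable_fine_norm mg.
  rewrite (fine_normK mf) (fine_normK mg) (fine_normK mfg).
  apply: le_trans (eminkowski mu mf' mg' r1).
  apply: le_Lnorm => //; [exact: measurable_fine_norm|exact: measurable_funD|].
  move=> x /=; rewrite !ger0_norm ?addr_ge0 ?fine_ge0 ?esn_ge0//.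
  have fx := strongly_measurable_lty x mf; have gx := strongly_measurable_lty x mg.
  have fgx : N (f x + g x)%R < +oo := strongly_measurable_lty x mfg.
  rewrite -lee_fin EFinD !fineK ?ge0_fin_numE ?esn_ge0//.
  exact: (esnD sN (f x) (g x)).
- move=> a f; rewrite /bochner_enorm.
  (* For a = 0 the left side is 0 even when f is not strongly measurable, so this case cannot share
     the argument where [bochner_enorm] is +oo. *)
  have [->|a0] := eqVneq a 0%R.
    rewrite normr0 mul0e scale0r asboolT.
      rewrite (eq_Lnorm _ _ (g := cst 0)) ?Lnorm0// => [|x /=]; last by rewrite (esn0 sN).
      by rewrite gt_eqF// (lt_le_trans lte01).
    by apply/bochner_simple_strongly/bochner_simple_cst; rewrite (esn0 sN).
  case: (asboolP (strongly_measurable N f)) => [mf|_]; last first.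
    by rewrite gt0_muley ?leey// lte_fin normr_gt0.
  have maf := strongly_measurableZ a mf.
  rewrite asboolT// (fine_normK mf) (fine_normK maf).
  have mf' := measurable_fine_norm mf.
  rewrite -[`|a|%R]normr_id -LnormZ_real//.
  apply: le_Lnorm => //; [exact: measurable_fine_norm|exact: measurable_funM|].
  move=> x /=; rewrite normrM normr_id !(ger0_norm (fine_ge0 (esn_ge0 sN _))).
  have fx := strongly_measurable_lty x mf.
  have afx : N (a *: f x)%R < +oo := strongly_measurable_lty x maf.
  rewrite -lee_fin EFinM !fineK ?ge0_fin_numE ?esn_ge0//.
  exact: (esnZ sN a (f x)).
Qed.

Lemma bochner_enorm_scale_lty (c : X -> R) (v : V) :
  measurable_fun setT c -> Lnorm mu r (EFin \o c) < +oo -> N v < +oo ->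
  bochner_enorm mu r N (fun x => c x *: v)%R < +oo.
Proof.
move=> mc coo voo; rewrite /bochner_enorm.
have mcv := strongly_measurable_scale mc voo.
have vfin : N v \is a fin_num by rewrite ge0_fin_numE ?esn_ge0.
rewrite asboolT// (fine_normK mcv).
apply: (@le_lt_trans _ _ (Lnorm mu r (EFin \o (fun x => fine (N v) * c x)%R))).
  apply: le_Lnorm => //; [exact: measurable_fine_norm|exact: measurable_funM|].
  move=> x /=; rewrite normrM !(ger0_norm (fine_ge0 _)) ?esn_ge0//.
  rewrite -lee_fin EFinM !fineK// 1?muleC; first exact: esnZ.
  by rewrite ge0_fin_numE ?esn_ge0//; exact: (strongly_measurable_lty x mcv).
by rewrite LnormZ_real// lte_mul_pinfty.
Qed.

Lemma bochner_enorm_lty (f : X -> V) :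
  bochner_enorm mu r N f < +oo -> strongly_measurable N f.
Proof. by rewrite /bochner_enorm; case: asboolP. Qed.

End Seminorm.
End StrongMeasurability.

Section BoundedImage.
Context d (X : measurableType d) (R : realType).
Variables (V V' : lmodType R) (N : V -> \bar R) (N' : V' -> \bar R).
Hypotheses (sN : eseminorm N) (sN' : eseminorm N').
Variables (L : V -> V') (C : R).
Hypotheses (C_ge0 : 0 <= C) (LB : forall x y, L (x - y) = L x - L y).
Hypothesis LC : forall x, (N' (L x) <= C%:E * N x)%E.
Variables (mu : {measure set X -> \bar R}) (r : \bar R).
Hypothesis r1 : (1 <= r)%E.

Lemma strongly_measurable_image (f : X -> V) :
  strongly_measurable N f -> strongly_measurable N' (L \o f).
Proof.
move=> [s [ss sf]]; exists (fun n => L \o s n); split=> [n|x].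
  have [fs ms Ns] := ss n; have [fLs mLs] := simple_comp L fs ms.
  by split=> // x; rewrite (le_lt_trans (LC _))// lte_mul_pinfty// ge0_fin_numE ?esn_ge0.
apply: (@squeeze_cvge _ _ _ _ (fun _ => 0%E) _ (fun n => C%:E * N (s n x - f x)%R)%E).
- by apply: nearW => n; rewrite esn_ge0//= -LB LC.
- exact: cvg_cst.
- by rewrite -[0%E](mule0 C%:E); apply: cvgeZl => //; exact: sf.
Qed.

Lemma bochner_enorm_image_lty (f : X -> V) : (bochner_enorm mu r N f < +oo ->
  bochner_enorm mu r N' (L \o f) < +oo)%E.
Proof.
move=> foo; have mf := bochner_enorm_lty foo.
have mLf := strongly_measurable_image mf; move: foo.
rewrite /bochner_enorm !asboolT// (fine_normK sN mf) (fine_normK sN' mLf) => foo.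
apply: (@le_lt_trans _ _ (Lnorm mu r (EFin \o (fun x => C * fine (N (f x)))%R))).
  apply: le_Lnorm => //; [exact: measurable_fine_norm|apply: measurable_funM => //|].
    exact: measurable_fine_norm.
  move=> x /=; rewrite normrM !(ger0_norm (fine_ge0 _)) ?esn_ge0// (ger0_norm C_ge0).
  have fx := strongly_measurable_lty sN x mf.
  have Lfx := strongly_measurable_lty sN' x mLf.
  by rewrite -lee_fin EFinM !fineK ?ge0_fin_numE ?esn_ge0//; exact: LC.
have mf' := measurable_fine_norm sN mf.
by rewrite LnormZ_real// lte_mul_pinfty.
Qed.

End BoundedImage.

(** * Square-summable families *)

Section SquareSums.
Variables (R : realType) (I : choiceType) (E : set I).
Implicit Types f g : I -> R.
Local Notation l2 f := ((\esum_(e in E) ((f e) ^+ 2)%:E) `^ 2^-1)%E.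

Lemma esum_sqr_ge0 f : (0 <= \esum_(e in E) ((f e) ^+ 2)%:E)%E.
Proof. by apply: esum_ge0 => e _; rewrite lee_fin sqr_ge0. Qed.

Lemma esum_sqr_le f (c : R) :
  (forall s : seq I, uniq s -> (forall e, e \in s -> E e) ->
     \sum_(e <- s) (f e) ^+ 2 <= c ^+ 2) -> 0 <= c -> (l2 f <= c%:E)%E.
Proof.
move=> fc c0.
have -> : c%:E = ((c ^+ 2)%:E `^ 2^-1)%E.
  by rewrite poweR_EFin powR12_sqrt ?sqr_ge0// sqrtr_sqr ger0_norm.
apply: gt0_ler_poweR; [by rewrite invr_ge0| | |].
- by rewrite in_itv/= leey andbT esum_sqr_ge0.
- by rewrite in_itv/= leey andbT lee_fin sqr_ge0.
apply: ge_ereal_sup => _ [A [Afin AE] <-].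
rewrite fsbig_finite// sumEFin lee_fin; apply: fc => // e.
by rewrite in_fset_set// inE => /AE.
Qed.

Lemma esum_sqr_ge f (s : seq I) : uniq s -> (forall e, e \in s -> E e) ->
  ((Num.sqrt (\sum_(e <- s) (f e) ^+ 2))%:E <= l2 f)%E.
Proof.
move=> us sE.
have s0 : 0 <= \sum_(e <- s) (f e) ^+ 2 by apply: sumr_ge0 => e _; rewrite sqr_ge0.
rewrite -(powR12_sqrt s0) -poweR_EFin.
apply: gt0_ler_poweR; [by rewrite invr_ge0| | |].
- by rewrite in_itv/= leey andbT lee_fin.
- by rewrite in_itv/= leey andbT esum_sqr_ge0.
apply: ereal_sup_ubound; exists [set` s].
  by split; [exact: finite_seq|move=> e /= es; exact: sE].
by rewrite -fsbig_seq// sumEFin.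
Qed.

Lemma l2_lty f : (l2 f < +oo)%E -> exists c, [/\ 0 <= c, (l2 f = c%:E)%E &
  forall s : seq I, uniq s -> (forall e, e \in s -> E e) ->
     \sum_(e <- s) (f e) ^+ 2 <= c ^+ 2].
Proof.
move=> foo; have ffin : (l2 f \is a fin_num)%E by rewrite ge0_fin_numE ?poweR_ge0.
exists (fine (l2 f)%E); split; [by rewrite fine_ge0// poweR_ge0|by rewrite fineK|].
move=> s us sE.
have s0 : 0 <= \sum_(e <- s) (f e) ^+ 2 by apply: sumr_ge0 => e _; rewrite sqr_ge0.
rewrite -(sqr_sqrtr s0) ler_pXn2r ?nnegrE ?sqrtr_ge0 ?fine_ge0 ?poweR_ge0//.
by rewrite -lee_fin fineK// esum_sqr_ge.
Qed.

(** Domination in place of h = f + g, because it will be used with the norms of A e, B e and (A + B)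
    e. *)
Lemma l2D f g (h : I -> R) : (forall e, E e -> `|h e| <= `|f e| + `|g e|) ->
  (l2 h <= l2 f + l2 g)%E.
Proof.
move=> hfg.
have l20 (k : I -> R) : (0 <= l2 k)%E by exact: poweR_ge0.
have [->|foo] := eqVneq (l2 f)%E +oo%E.
  by rewrite addye ?leey// -ltNye (lt_le_trans _ (l20 _)).
have [->|goo] := eqVneq (l2 g)%E +oo%E.
  by rewrite addey ?leey// -ltNye (lt_le_trans _ (l20 _)).
have /l2_lty[a [a0 -> fa]] : (l2 f < +oo)%E by rewrite ltey.
have /l2_lty[b [b0 -> gb]] : (l2 g < +oo)%E by rewrite ltey.
rewrite -EFinD; apply: esum_sqr_le; last exact: addr_ge0.
move=> s us sE.
(* For a fixed finite s this is a positive semidefinite form on functions, so Minkowski's inequality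
   is [psd_sqrt_triangle]. *)
pose B (u v : I -> R^o) : R := \sum_(e <- s) u e * v e.
have BC u v : B u v = B v u by apply: eq_bigr => e _; rewrite mulrC.
have Bl (c : R) u v w : B (c *: u + v) w = c * B u w + B v w.
  rewrite /B mulr_sumr -big_split /=; apply: eq_bigr => e _.
  by rewrite mulrDl mulrA.
have B0 u : 0 <= B u u by apply: sumr_ge0 => e _; rewrite -expr2 sqr_ge0.
have BE u : B u u = \sum_(e <- s) u e ^+ 2 by apply: eq_bigr => e _; rewrite expr2.
have := psd_sqrt_triangle BC Bl B0 (fun e => `|f e|) (fun e => `|g e|).
rewrite !BE => tri.
have le1 : \sum_(e <- s) h e ^+ 2 <=
    \sum_(e <- s) ((fun e => `|f e|) + (fun e => `|g e|) : I -> R^o) e ^+ 2.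
  rewrite big_seq [leRHS]big_seq; apply: ler_sum => e es /=.
  rewrite -[h e ^+ 2]real_normK ?num_real// ler_pXn2r ?nnegrE ?addr_ge0//.
  exact/hfg/sE.
rewrite (le_trans le1)// -[leLHS]sqr_sqrtr; last by apply: sumr_ge0 => e _; rewrite sqr_ge0.
rewrite ler_pXn2r ?nnegrE ?sqrtr_ge0 ?addr_ge0// (le_trans tri)// lerD//.
  rewrite -(ger0_norm a0) -sqrtr_sqr ler_wsqrtr// (le_trans _ (fa _ us sE))//.
  by apply: ler_sum => e _; rewrite real_normK ?num_real.
rewrite -(ger0_norm b0) -sqrtr_sqr ler_wsqrtr// (le_trans _ (gb _ us sE))//.
by apply: ler_sum => e _; rewrite real_normK ?num_real.
Qed.

Lemma l2Z f g (a : R) : (forall e, E e -> `|g e| <= `|a| * `|f e|) ->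
  (l2 g <= `|a|%:E * l2 f)%E.
Proof.
move=> gf; have [a0|a0] := eqVneq a 0.
  rewrite a0 normr0 mul0e; apply: esum_sqr_le => // s us sE.
  rewrite big_seq big1 ?expr0n// => e es; apply/eqP; rewrite sqrf_eq0.
  by rewrite -normr_le0 (le_trans (gf _ (sE _ es)))// a0 normr0 mul0r.
have [->|foo] := eqVneq (l2 f)%E +oo%E.
  by rewrite gt0_muley ?leey// lte_fin normr_gt0.
have /l2_lty[c [c0 -> fc]] : (l2 f < +oo)%E by rewrite ltey.
rewrite -EFinM; apply: esum_sqr_le => [s us sE|]; last exact: mulr_ge0.
rewrite exprMn (le_trans _ (ler_wpM2l _ (fc _ us sE))) ?sqr_ge0// mulr_sumr.
rewrite big_seq [leRHS]big_seq; apply: ler_sum => e es.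
rewrite -[g e ^+ 2]real_normK ?num_real// -[f e ^+ 2]real_normK ?num_real//.
rewrite -exprMn ler_pXn2r ?nnegrE ?mulr_ge0//; exact/gf/sE.
Qed.

Lemma l2_eq0 f : (l2 f = 0)%E <-> forall e, E e -> f e = 0.
Proof.
split=> [f0 e Ee|f0].
  have := @esum_sqr_ge f [:: e] isT; rewrite f0 big_seq1 lee_fin sqrtr_sqr.
  by rewrite normr_le0 => h; apply/eqP/h => e'; rewrite inE => /eqP ->.
apply/eqP; rewrite eq_le poweR_ge0 andbT; apply: esum_sqr_le => // s us sE.
by rewrite big_seq big1 ?expr0n// => e /sE /f0 ->; rewrite expr0n.
Qed.

End SquareSums.

(** * The norms of H, H_0 and L_2(H_0, H) *)

Section Norms.
Variables (R : realType) (H : completeNormedModType R) (ip : {dot H for idfun}).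
Hypothesis H_hilbert : inner_product_norm ip.
Variable Q : {linear H -> H}.
Local Notation U := (H0 ip Q).

Lemma enormH_seminorm : eseminorm (@enormH R H).
Proof.
split=> [|x|x y|a x]; rewrite /enormH.
- by rewrite normr0.
- by rewrite lee_fin.
- by rewrite -EFinD lee_fin ler_normD.
- by rewrite -EFinM lee_fin normrZ.
Qed.

Lemma enormH0_seminorm : eseminorm (@enormH0 R H ip Q).
Proof.
split=> [|x|x y|a x]; rewrite /enormH0.
- by rewrite normH00.
- by rewrite lee_fin normH0_ge0.
- by rewrite -EFinD lee_fin ler_normH0D.
- by rewrite -EFinM lee_fin normH0Z.
Qed.

Definition bounded_op (A : U -> H) : Prop :=
  linear A /\ exists C : R, forall u, `|A u| <= C * normH0 u.

Lemma bounded_op0 : bounded_op 0.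
Proof.
split=> [a u v|]; first by rewrite scaler0 addr0.
by exists 0 => u; rewrite normr0 mul0r.
Qed.

Lemma bounded_opPl a A B : bounded_op A -> bounded_op B -> bounded_op (a *: A + B).
Proof.
move=> [linA [C AC]] [linB [D BD]]; split.
  by move=> b u v; rewrite !fctE linA linB !scalerDr !scalerA (mulrC a b) addrACA.
exists (`|a| * C + D) => u; rewrite (le_trans (ler_normD _ _))// normrZ mulrDl lerD//.
by rewrite -mulrA ler_wpM2l.
Qed.

Lemma bounded_opZ a A : bounded_op A -> bounded_op (a *: A).
Proof. by move=> bA; rewrite -[_ *: _]addr0; apply: bounded_opPl => //; exact: bounded_op0. Qed.

Lemma bounded_opD A B : bounded_op A -> bounded_op B -> bounded_op (A + B).
Proof. by move=> bA bB; rewrite -[A]scale1r; apply: bounded_opPl. Qed.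

Local Notation hs := (@hs_enorm R H ip Q).
Local Notation E := (@basisH0 R H ip Q).

Lemma hs_lty A : (hs A < +oo)%E -> bounded_op A.
Proof. by rewrite /hs_enorm; case: asboolP. Qed.

Lemma hsE A : bounded_op A -> hs A = ((\esum_(e in E) (`|A e| ^+ 2)%:E) `^ 2^-1)%E.
Proof. by move=> bA; rewrite /hs_enorm asboolT. Qed.

Lemma hs_seminorm : eseminorm hs.
Proof.
have hs0 A : (0 <= hs A)%E.
  by rewrite /hs_enorm; case: ifP => _; rewrite ?poweR_ge0 ?leey.
have hsN A : ~ bounded_op A -> hs A = +oo%E by move=> nA; rewrite /hs_enorm asboolF.
split=> //.
- rewrite hsE; last exact: bounded_op0.
  by apply/(@l2_eq0 _ _ _ (fun e => `|(0 : U -> H) e|)) => e _; rewrite normr0.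
- move=> A B; have [bA|/hsN ->] := pselect (bounded_op A); last first.
    by rewrite addye ?leey// -ltNye (lt_le_trans _ (hs0 _)).
  have [bB|/hsN ->] := pselect (bounded_op B); last first.
    by rewrite addey ?leey// -ltNye (lt_le_trans _ (hs0 _)).
  rewrite !hsE//; last exact: bounded_opD.
  apply: (@l2D _ _ _ (fun e => `|A e|) (fun e => `|B e|) (fun e => `|(A + B) e|)).
  by move=> e _; rewrite !normr_id ler_normD.
- move=> a A; have [->|a0] := eqVneq a 0.
    rewrite scale0r normr0 mul0e hsE; last exact: bounded_op0.
    rewrite (_ : (_ `^ _)%E = 0%E)//.
    by apply/(@l2_eq0 _ _ _ (fun e => `|(0 : U -> H) e|)) => e _; rewrite normr0.
  have [bA|/hsN ->] := pselect (bounded_op A); last first.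
    by rewrite gt0_muley ?leey// lte_fin normr_gt0.
  rewrite !hsE//; last exact: bounded_opZ.
  apply: (@l2Z _ _ _ (fun e => `|A e|) (fun e => `|(a *: A) e|)).
  by move=> e _; rewrite !normr_id normrZ.
Qed.

Lemma hs_ge A e : E e -> (`|A e|%:E <= hs A)%E.
Proof.
move=> Ee; have [bA|nA] := pselect (bounded_op A); last first.
  by rewrite /hs_enorm asboolF// leey.
rewrite hsE//; have := @esum_sqr_ge _ _ E (fun e => `|A e|) [:: e] isT.
rewrite big_seq1 sqrtr_sqr normr_id; apply=> e'; rewrite inE => /eqP ->//.
Qed.

Lemma hs_eq0 A : bounded_op A -> (forall e, E e -> A e = 0) -> hs A = 0%E.
Proof.
move=> bA A0; rewrite hsE//; apply/(@l2_eq0 _ _ _ (fun e => `|A e|)) => e Ee.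
by rewrite A0// normr0.
Qed.

(** In the default case of [xget] the set is empty and both claims are vacuous. *)
Lemma basisH0_orthonormal : (forall e, E e -> ipH0 e e = 1) /\
  (forall e e', E e -> E e' -> e <> e' -> ipH0 e e' = 0).
Proof. by rewrite /basisH0; case: xgetP => [F _ []|_]; split. Qed.

Lemma basisH0_countable : separable H -> countable E.
Proof.
move=> sepH; have [E1 E0] := basisH0_orthonormal.
exact: orthonormal_countable.
Qed.

Lemma tensor_bounded h (g : U) : bounded_op (tensor h g).
Proof.
split=> [a u v|].
  by rewrite /tensor ipH0C// ipH0Pl// scalerDl scalerA !(ipH0C _ g).
exists (`|h| * normH0 g) => u; rewrite /tensor normrZ mulrC -mulrA ler_wpM2l//.
exact: ipH0_CauchySchwarz.
Qed.

(** Bessel's inequality for g, applied to the finite partial sums of the Hilbert-Schmidt norm. *)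
Lemma hs_tensor_le h (g : U) : (hs (tensor h g) <= `|h|%:E * enormH0 g)%E.
Proof.
rewrite hsE; last exact: tensor_bounded.
have [E1 E0] := basisH0_orthonormal.
rewrite -EFinM; apply: (@esum_sqr_le _ _ _ (fun e => `|tensor h g e|)) => [s us sE|].
  under eq_bigr do rewrite /tensor normrZ exprMn real_normK ?num_real//.
  rewrite -mulr_suml exprMn mulrC ler_wpM2l ?sqr_ge0// normH0_sqr//.
  apply: (@psd_bessel _ _ (@ipH0 R H ip Q)) => //.
  - exact: ipH0C.
  - exact: ipH0Pl.
  - exact: ipH0_ge0.
  - by move=> e /sE; exact: E1.
  - by move=> e e' /sE ? /sE ?; exact: E0.
by rewrite mulr_ge0// normH0_ge0.
Qed.

Lemma tensorB h (g g' : U) : tensor h (g - g') = tensor h g - tensor h g'.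
Proof.
apply/funext => u; rewrite /tensor !fctE (bformBl (@ipH0Pl _ _ _ H_hilbert Q)).
by rewrite scalerBl.
Qed.

End Norms.

(** * Polynomial approximation of a step function *)

Section StepApproximation.
Variable R : realType.
Implicit Types (x u v y a : R) (m n : nat).

Lemma bernoulli_le x n : 0 <= x <= 1 -> 1 - n%:R * x <= (1 - x) ^+ n.
Proof.
move=> /andP[x0 x1]; elim: n => [|n IH]; first by rewrite mul0r subr0 expr0.
rewrite exprS (le_trans _ (ler_wpM2l _ IH)) ?subr_ge0//.
rewrite -subr_ge0 (_ : _ - _ = n%:R * x ^+ 2); first by rewrite mulr_ge0// sqr_ge0.
rewrite -natr1; ring.
Qed.

Lemma geometric_le v m : 0 <= v < 1 -> m%:R * v ^+ m * (1 - v) <= 1.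
Proof.
move=> /andP[v0 v1].
have h : m%:R * v ^+ m <= \sum_(i < m) v ^+ i.
  rewrite mulr_natl -[X in _ *+ X](card_ord m) -sumr_const.
  by apply: ler_sum => i _; apply: ler_wiXn2l => //; [exact: ltW|exact: ltnW].
rewrite (le_trans (ler_wpM2r _ h)) ?subr_ge0 ?(ltW v1)//.
have -> : (\sum_(i < m) v ^+ i) * (1 - v) = - (v ^+ m - 1) by rewrite subrX1; ring.
have := exprn_ge0 m v0; lra.
Qed.

(** Exponent times inner power is m 4^m u^(2m) = m (2u)^(2m). It tends to 0 for u < 1/2 and is at
    least m for u >= 1/2; the factor m settles the borderline u = 1/2. So these polynomials tend to
    the indicator of u < 1/2. *)
Definition bern u m := (1 - u ^+ (2 * m)) ^+ (m * 4 ^ m).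

Lemma bern_itv u m : 0 <= u <= 1 -> 0 <= bern u m <= 1.
Proof.
move=> /andP[u0 u1]; rewrite /bern.
have h : 0 <= u ^+ (2 * m) <= 1 by rewrite exprn_ge0// exprn_ile1.
by rewrite exprn_ge0 ?exprn_ile1 ?subr_ge0 ?lerBlDl ?lerDr//; case/andP: h.
Qed.

Lemma bern_expE u m : (m * 4 ^ m)%:R * u ^+ (2 * m) = m%:R * (2 * u) ^+ m * (2 * u) ^+ m.
Proof.
rewrite natrM natrX (_ : 4%:R = 2 ^+ 2 :> R); last by rewrite expr2 -natrM.
by rewrite -exprM -!mulrA -exprMn -exprD addnn -mul2n.
Qed.

(** With v = 2u: for v < 1, Bernoulli's inequality and m v^m <= 1 / (1 - v) give the lower bound 1 -
    v^m / (1 - v). For v >= 1, from 1 - y <= exp(-y) one gets the upper bound exp(-m v^(2m)) <= 1 /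
    (m + 1). *)
Lemma cvg_bern u : 0 <= u <= 1 -> bern u m @[m --> \oo] --> ((u < 2^-1)%R%:R : R).
Proof.
move=> /andP[u0 u1]; have u01 : 0 <= u <= 1 by rewrite u0.
have [u2|u2] := ltP u 2^-1.
  have v01 : 0 <= 2 * u < 1 by rewrite mulr_ge0//=; lra.
  have v1 : 0 < 1 - 2 * u by lra.
  apply: (@squeeze_cvgr _ _ _ _ (fun m => 1 - (2 * u) ^+ m / (1 - 2 * u)) (fun=> 1)).
  - apply: nearW => m; have /andP[_ ->] := bern_itv m u01; rewrite andbT.
    rewrite (le_trans _ (bernoulli_le _ _)) ?exprn_ge0 ?exprn_ile1//.
    rewrite bern_expE lerD2l lerN2 ler_pdivlMr//.
    have := geometric_le m v01; rewrite -subr_ge0.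
    have w0 : 0 <= (2 * u) ^+ m by rewrite exprn_ge0// mulr_ge0.
    move=> /(mulr_ge0 w0); lra.
  - rewrite -[X in _ --> X]subr0 -(mul0r (1 - 2 * u)^-1).
    apply: cvgB; first exact: cvg_cst.
    apply: cvgMl; apply: cvg_expr; rewrite ger0_norm ?mulr_ge0//; lra.
  - exact: cvg_cst.
apply: (@squeeze_cvgr _ _ _ _ (fun=> 0) harmonic).
- apply: nearW => m; have /andP[-> _]/= := bern_itv m u01.
  have x1 : u ^+ (2 * m) <= 1 by rewrite exprn_ile1.
  rewrite (@le_trans _ _ (expR (- ((m * 4 ^ m)%:R * u ^+ (2 * m)))))//.
    rewrite -mulrN expRM_natl lerXn2r ?nnegrE ?subr_ge0 ?expR_ge0//.
    exact: expR_ge1Dx.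
  rewrite expRN lef_pV2 ?posrE ?expR_gt0// (le_trans _ (expR_ge1Dx _))// -natr1 addrC lerD2l.
  rewrite bern_expE -mulrA ler_peMr// -exprD exprn_ege1//; lra.
- exact: cvg_cst.
- exact: cvg_harmonic.
Qed.

End StepApproximation.

(** * Function classes stable under dominated limits and multiplication by cosines *)

Section TrigonometricClass.
Variables (R : realType) (X : Type) (V : (X -> R) -> Prop) (G : X -> R).
Implicit Types (f g : X -> R).
Hypothesis G_ge1 : forall x, 1 <= G x.
Hypothesis VP : forall (a : R) f g, V f -> V g -> V (fun x => a * f x + g x).
Hypothesis V_lim : forall (f_ : nat -> X -> R) f (C : R),
  (forall k, V (f_ k)) -> (forall k x, `|f_ k x| <= C * G x) ->
  (forall x, f_ k x @[k --> \oo] --> f x) -> V f.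

Definition bounded_in f := V f /\ exists C : R, forall x, `|f x| <= C.

(** Only bounded members of [V] are multiplied. Nothing bounds a general member by [G], whereas a
    bounded member times a bounded sequence of multipliers is dominated by a constant, hence by a
    multiple of [G]. This makes multipliers stable under bounded limits. *)
Definition multiplier g := (exists C : R, forall x, `|g x| <= C) /\
  forall f, bounded_in f -> V (fun x => f x * g x).

Lemma bounded_in_mul f g : bounded_in f -> multiplier g -> bounded_in (fun x => f x * g x).
Proof.
move=> bf [[D gD] Vg]; split; first exact: Vg.
have [_ [C fC]] := bf; exists (C * D) => x; rewrite normrM.
by apply: ler_pM.
Qed.

Lemma multiplierP (a : R) f g : multiplier f -> multiplier g ->
  multiplier (fun x => a * f x + g x).
Proof.
move=> [[C fC] Vf] [[D gD] Vg]; split.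
  exists (`|a| * C + D) => x; rewrite (le_trans (ler_normD _ _))// normrM lerD//.
  by rewrite ler_wpM2l.
move=> h bh; have := VP a (Vf _ bh) (Vg _ bh); congr V.
by apply/funext => x; ring.
Qed.

Lemma multiplierM f g : multiplier f -> multiplier g -> multiplier (fun x => f x * g x).
Proof.
move=> mf mg; split.
  have [[C fC] _] := mf; have [[D gD] _] := mg.
  by exists (C * D) => x; rewrite normrM; apply: ler_pM.
move=> h bh; have := mg.2 _ (bounded_in_mul bh mf); congr V.
by apply/funext => x; rewrite mulrA.
Qed.

Lemma multiplier1 : multiplier (fun=> 1).
Proof.
split; first by exists 1 => x; rewrite normr1.
by move=> h [Vh _]; move: Vh; congr V; apply/funext => x; rewrite mulr1.
Qed.

Lemma multiplier0 : multiplier (fun=> 0).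
Proof.
have := multiplierP (-1) multiplier1 multiplier1; congr multiplier.
by apply/funext => x; rewrite mulr1 addNr.
Qed.

Lemma multiplierX f n : multiplier f -> multiplier (fun x => f x ^+ n).
Proof.
move=> mf; elim: n => [|n IH]; first exact: multiplier1.
have := multiplierM mf IH; congr multiplier.
by apply/funext => x; rewrite exprS.
Qed.

Lemma multiplierZ (a : R) f : multiplier f -> multiplier (fun x => a * f x).
Proof.
move=> mf; have := multiplierP a mf multiplier0; congr multiplier.
by apply/funext => x; rewrite addr0.
Qed.

Lemma multiplierB f g : multiplier f -> multiplier g -> multiplier (fun x => f x - g x).
Proof.
move=> mf mg; have := multiplierP (-1) mg mf; congr multiplier.
by apply/funext => x; rewrite mulN1r addrC.
Qed.

Lemma multiplier_lim (f_ : nat -> X -> R) f (C : R) :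
  (forall k, multiplier (f_ k)) -> (forall k x, `|f_ k x| <= C) ->
  (forall x, f_ k x @[k --> \oo] --> f x) -> multiplier f.
Proof.
move=> mf fC ff; split.
  exists C => x; apply: (cvgr_to_le (cvg_norm (ff x))); exact: nearW.
move=> h bh; have [Vh [D hD]] := bh.
apply: (@V_lim (fun k x => h x * f_ k x) _ (D * C)) => [k|k x|x].
- exact: (mf k).2.
- have DC : `|h x * f_ k x| <= D * C by rewrite normrM; apply: ler_pM.
  by rewrite (le_trans DC)// ler_peMr// (le_trans _ DC).
- by apply: cvgMr; exact: ff.
Qed.

Lemma multiplier_prod (I : Type) (s : seq I) (g : I -> X -> R) :
  (forall i, multiplier (g i)) -> multiplier (fun x => \prod_(i <- s) g i x).
Proof.
move=> mg; elim: s => [|i s IH].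
  by have := multiplier1; congr multiplier; apply/funext => x; rewrite big_nil.
by have := multiplierM (mg i) IH; congr multiplier; apply/funext => x; rewrite big_cons.
Qed.

Lemma multiplier_sum (I : Type) (s : seq I) (a : I -> R) (g : I -> X -> R) :
  (forall i, multiplier (g i)) -> multiplier (fun x => \sum_(i <- s) a i * g i x).
Proof.
move=> mg; elim: s => [|i s IH].
  by have := multiplier0; congr multiplier; apply/funext => x; rewrite big_nil.
by have := multiplierP (a i) (mg i) IH; congr multiplier; apply/funext => x; rewrite big_cons.
Qed.

(** Two limits are taken. For fixed L, [bern] applied to the affine image [u L] of the sine with
    values in [0, 1] gives the indicator of {sin ((z - a) / L) < 0}. Since that set is periodic in
    z, it agrees with {z < a} at x only once |z x - a| < pi L; so L tends to infinity next. *)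
Lemma multiplier_lt (z : X -> R) (a : R) :
  (forall s b : R, multiplier (fun x => cos (s * z x + b))) ->
  multiplier (fun x => (z x < a)%R%:R).
Proof.
move=> mcos.
pose u L x := 2^-1 + 2^-1 * sin (L^-1 * (z x - a)).
have u01 L x : 0 <= u L x <= 1.
  have := sin_geN1 (L^-1 * (z x - a)); have := sin_le1 (L^-1 * (z x - a)).
  rewrite /u; set y := sin _; lra.
have mu L : multiplier (u L).
  have := multiplierP 2^-1 (mcos L^-1 (- (L^-1 * a) - pi / 2)) (multiplierZ 2^-1 multiplier1).
  congr multiplier; apply/funext => x.
  by rewrite /u mulr1 addrC addrA cosBpihalf mulrBr.
have mi L : multiplier (fun x => (u L x < 2^-1)%R%:R).
  apply: (@multiplier_lim (fun m x => bern (u L x) m) _ 1) => [m|m x|x].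
  - rewrite /bern; apply: multiplierX.
    by apply: (multiplierB multiplier1); exact: multiplierX.
  - by have /andP[b0 b1] := bern_itv m (u01 L x); rewrite ger0_norm.
  - exact: cvg_bern.
apply: (@multiplier_lim (fun m x => (u m.+1%:R x < 2^-1)%R%:R) _ 1) => [m //|m x|x].
  by case: (_ < _)%R; rewrite ?normr1 ?normr0.
(* From some m on, |z x - a| / (m + 1) < pi, and the sign of the sine is that of z x - a. *)
apply: cvg_near_cst; near=> m.
have m0 : (0 : R) < m.+1%:R by [].
have zm : `|m.+1%:R^-1 * (z x - a)| < pi.
  rewrite normrM gtr0_norm ?invr_gt0// mulrC ltr_pdivrMr//.
  rewrite (lt_le_trans (_ : _ < m.+1%:R))//; last by rewrite ler_peMl ?pi_ge2// (le_trans _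
    (pi_ge2 R))// ler1n.
  have : `|z x - a| <= m%:R by near: m; exact: nbhs_infty_ger.
  by move=> /le_lt_trans; apply; rewrite ltr_nat.
congr (nat_of_bool _)%:R; rewrite /u; apply/idP/idP => [h|h].
  rewrite ltNge; apply/negP => az.
  have : 0 <= sin (m.+1%:R^-1 * (z x - a)).
    by rewrite sin_ge0_pi// mulr_ge0 ?subr_ge0//= ltW// (le_lt_trans (ler_norm _)).
  by move: h; set y := sin _; lra.
have : 0 < sin (- (m.+1%:R^-1 * (z x - a))).
  apply: sin_gt0_pi; apply/andP; split.
    by rewrite oppr_gt0 pmulr_rlt0 ?invr_gt0// subr_lt0 h.
  by rewrite (le_lt_trans (ler_norm _)) ?normrN.
by rewrite sinN; set y := sin _; lra.
Unshelve. all: by end_near. Qed.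

Section ContinuousFunctions.
Variables (n : nat) (z : 'I_n -> X -> R).
Hypothesis V1 : V (fun=> 1).
Hypothesis z_lt : forall j (a : R), multiplier (fun x => (z j x < a)%R%:R).

(** The 2 (k + 1)^2 cells of width 1 / (k + 1) starting here tile the interval [-(k + 1), k + 1). A
    cell is half-open, so that its indicator is a difference of indicators of {y < a}. *)
Let cell_lo (k i : nat) : R := i%:R / k.+1%:R - k.+1%:R.
Let cell (k i : nat) (y : R) : R :=
  (y < cell_lo k i.+1)%R%:R - (y < cell_lo k i)%R%:R.

Let cellE k i y : cell k i y = (cell_lo k i <= y < cell_lo k i.+1)%R%:R.
Proof.
have lo : cell_lo k i <= cell_lo k i.+1.
  by rewrite lerD2r ler_pM2r ?invr_gt0// ler_nat.
rewrite /cell; have [y0|y0] := ltP y (cell_lo k i).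
  by rewrite (lt_le_trans y0 lo) subrr.
by rewrite subr0.
Qed.

Let cell_uniq k i i' y : cell_lo k i <= y < cell_lo k i.+1 ->
  cell_lo k i' <= y < cell_lo k i'.+1 -> i = i'.
Proof.
have k0 : (0 : R) < k.+1%:R by [].
move=> /andP[a b] /andP[a' b'].
have := le_lt_trans a b'; have := le_lt_trans a' b.
rewrite /cell_lo !ltrD2r !ltr_pM2r ?invr_gt0// !ltr_nat !ltnS => h h'.
by apply/eqP; rewrite eqn_leq h h'.
Qed.

Let grid_approx (f : 'rV[R]_n -> R) (k : nat) (x : X) : R :=
  \sum_(t : {ffun 'I_n -> 'I_(2 * k.+1 ^ 2)})
    f (\row_j cell_lo k (t j)) * \prod_j cell k (t j) (z j x).

Let grid_approx_cell (f : 'rV[R]_n -> R) k x (t : {ffun 'I_n -> 'I_(2 * k.+1 ^ 2)}) :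
  (forall j, cell_lo k (t j) <= z j x < cell_lo k (t j).+1) ->
  exists2 y : 'rV[R]_n, grid_approx f k x = f y &
    forall j, `|y 0 j - z j x| <= k.+1%:R^-1.
Proof.
have k0 : (0 : R) < k.+1%:R by [].
move=> tz; exists (\row_j cell_lo k (t j)).
  rewrite /grid_approx (bigD1 t)//= [X in _ + X]big1 ?addr0 => [|t' t't].
    by rewrite big1 ?mulr1// => j _; rewrite cellE tz.
  have [j tj] : exists j, t j != t' j.
    by apply/existsP; rewrite -negb_forall; apply: contraNN t't => /forallP h;
      apply/eqP/ffunP => j; apply/esym/eqP/h.
  rewrite (bigD1 j)//= cellE; case: (boolP (_ <= _ < _)) => [h|_]; last by rewrite mul0r mulr0.
  by move: tj; rewrite -val_eqE /= (cell_uniq (tz j) h) eqxx.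
move=> j; rewrite mxE.
have /andP[a b] := tz j; rewrite distrC ger0_norm ?subr_ge0//.
move: b; rewrite /cell_lo -(natr1 (t j)) mulrDl mul1r; set w := _^-1; lra.
Qed.

(** Covers also the points outside the grid, as domination is needed for all k and x;
    [grid_approx_near] excludes the first alternative for large k. *)
Let grid_approxP (f : 'rV[R]_n -> R) k x : grid_approx f k x = 0 \/
  exists2 y : 'rV[R]_n, grid_approx f k x = f y &
     forall j, `|y 0 j - z j x| <= k.+1%:R^-1.
Proof.
have [[t tz]|nt] := pselect (exists t : {ffun 'I_n -> 'I_(2 * k.+1 ^ 2)},
    forall j, cell_lo k (t j) <= z j x < cell_lo k (t j).+1).
  by right; exact: grid_approx_cell tz.
left; rewrite /grid_approx big1// => t _.
have /existsNP[j zj] : ~ forall j, cell_lo k (t j) <= z j x < cell_lo k (t j).+1.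
  by move=> tz; apply: nt; exists t.
by rewrite (bigD1 j)//= cellE (negbTE (introN idP zj)) mul0r mulr0.
Qed.

Let grid_approx_near (f : 'rV[R]_n -> R) x : \forall k \near \oo,
  exists2 y : 'rV[R]_n, grid_approx f k x = f y &
     forall j, `|y 0 j - z j x| <= k.+1%:R^-1.
Proof.
have : \forall k \near \oo, forall j, `|z j x| < k%:R.
  by apply: filter_forall => j; exact: nbhs_infty_gtr.
apply: filterS => k zk.
have k0 : (0 : R) < k.+1%:R by [].
have zk' j : `|z j x| < k.+1%:R by rewrite (lt_trans (zk j))// ltr_nat.
(* The integer part of this rescaled coordinate is the index of the cell containing z j x. *)
pose y j := (z j x + k.+1%:R) * k.+1%:R.
have y0 j : 0 <= y j.
  by rewrite mulr_ge0//; have := zk' j; rewrite ltr_norml => /andP[]; lra.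
have ylt j : (Num.truncn (y j) < 2 * k.+1 ^ 2)%N.
  rewrite truncn_lt_nat// natrM natrX expr2 mulrA ltr_pM2r//.
  by have := zk' j; rewrite ltr_norml => /andP[]; lra.
apply: (@grid_approx_cell _ _ _ [ffun j => Ordinal (ylt j)]) => j; rewrite ffunE /=.
have /andP[a b] := truncn_itv (y0 j); rewrite /cell_lo lerBlDr ler_pdivrMr// a /=.
by rewrite ltrBrDr ltr_pdivlMr.
Qed.

(** The grid functions evaluate f at corners up to 1 / (k + 1) away from z x. Hence the growth bound
    is required on the whole unit neighbourhood of z x. *)
Lemma class_continuous (f : 'rV[R]_n -> R) (C : R) : continuous f ->
  (forall x (y : 'rV[R]_n), (forall j, `|y 0 j - z j x| <= 1) -> `|f y| <= C * G x) ->
  V (fun x => f (\row_j z j x)).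
Proof.
move=> fc fG.
have k1 k : (k.+1%:R : R)^-1 <= 1 by rewrite invf_le1// ler1n.
have C0 x : 0 <= C * G x.
  by rewrite (le_trans _ (fG x (\row_j z j x) _))// => j; rewrite mxE subrr normr0.
apply: (@V_lim (grid_approx f) _ C) => [k|k x|x].
- have mcell i j : multiplier (fun x => cell k i (z j x)).
    by apply: multiplierB; exact: z_lt.
  have m_k : multiplier (grid_approx f k).
    by apply: multiplier_sum => t; exact: multiplier_prod.
  have := m_k.2 (fun=> 1); rewrite (_ : (fun x => 1 * _) = grid_approx f k).
    by apply; split=> //; exists 1 => x; rewrite normr1.
  by apply/funext => x; rewrite mul1r.
- have [->|[y -> yz]] := grid_approxP f k x; first by rewrite normr0.
  by apply: fG => j; rewrite (le_trans (yz j)).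
apply/cvgrPdist_le => e e0.
have := fc (\row_j z j x) => /cvgrPdist_le/(_ e e0)/nbhs_ballP[r /= r0 fr].
near=> k.
have [y -> yz] : exists2 y : 'rV[R]_n, grid_approx f k x = f y &
     forall j, `|y 0 j - z j x| <= k.+1%:R^-1.
  by near: k; exact: grid_approx_near.
apply: fr; split=> // i j; rewrite ord1 mxE /ball /= distrC (le_lt_trans (yz j))//.
near: k; exact: near_infty_natSinv_lt (PosNum r0).
Unshelve. all: by end_near. Qed.

End ContinuousFunctions.
End TrigonometricClass.

(** * Integrals of real functions *)

Section RealIntegrals.
Context d (X : measurableType d) (R : realType).
Variable mu : {measure set X -> \bar R}.
Implicit Types f g h : X -> R.

Definition L1 f := mu.-integrable setT (EFin \o f).
Definition intg f : R := \int[mu]_x f x.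

Lemma L1_measurable f : L1 f -> measurable_fun setT f.
Proof. by move=> /integrableP[/measurable_EFinP]. Qed.

Lemma L1_le f g : measurable_fun setT f -> (forall x, `|f x| <= `|g x|) -> L1 g -> L1 f.
Proof.
move=> mf fg; apply: le_integrable => //; first exact/measurable_EFinP.
by move=> x _ /=; rewrite lee_fin.
Qed.

Lemma L1_norm f : L1 f -> L1 (fun x => `|f x|).
Proof.
move=> If; apply: (@L1_le _ f) => // [|x]; last by rewrite normr_id.
by apply: measurableT_comp => //; exact: L1_measurable.
Qed.

Lemma L1P (a : R) f g : L1 f -> L1 g -> L1 (fun x => a * f x + g x).
Proof.
move=> If Ig; rewrite /L1 (_ : _ \o _ = (fun x => a%:E * (EFin \o f) x)%E \+ (EFin \o g)).
  by apply: integrableD => //; exact: integrableZl.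
by apply/funext => x /=; rewrite EFinD EFinM.
Qed.

Lemma L1_0 : L1 (fun=> 0).
Proof. exact: integrable0. Qed.

Lemma L1Z (a : R) f : L1 f -> L1 (fun x => a * f x).
Proof.
move=> If; have := L1P a If L1_0; congr L1; apply/funext => x; exact: addr0.
Qed.

Lemma L1D f g : L1 f -> L1 g -> L1 (fun x => f x + g x).
Proof.
move=> If Ig; have := L1P 1 If Ig; congr L1; apply/funext => x; by rewrite mul1r.
Qed.

Lemma L1B f g : L1 f -> L1 g -> L1 (fun x => f x - g x).
Proof.
move=> If Ig; have := L1P (-1) Ig If; congr L1; apply/funext => x; rewrite mulN1r; exact: addrC.
Qed.

Lemma L1_sum (I : Type) (s : seq I) (F : I -> X -> R) :
  (forall i, L1 (F i)) -> L1 (fun x => \sum_(i <- s) F i x).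
Proof.
move=> IF; elim: s => [|i s IH].
  by have := L1_0; congr L1; apply/funext => x; rewrite big_nil.
by have := L1D (IF i) IH; congr L1; apply/funext => x; rewrite big_cons.
Qed.

Lemma L1_bdd f g (C : R) : L1 f -> measurable_fun setT g -> (forall x, `|g x| <= C) ->
  L1 (fun x => f x * g x).
Proof.
move=> If mg gC; have C0 x : 0 <= C := le_trans (normr_ge0 _) (gC x).
apply: (@L1_le _ (fun x => C * f x)) => [|x|]; last exact: L1Z.
  by apply: measurable_funM => //; exact: L1_measurable.
rewrite !normrM mulrC ler_wpM2r//; apply: (le_trans (gC x)).
exact: ler_norm.
Qed.

Lemma intgP (a : R) f g : L1 f -> L1 g ->
  intg (fun x => a * f x + g x) = a * intg f + intg g.
Proof.
by move=> If Ig; rewrite /intg RintegralD// ?RintegralZl//; exact: L1Z.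
Qed.

Lemma intgZ (a : R) f : L1 f -> intg (fun x => a * f x) = a * intg f.
Proof. by move=> If; rewrite /intg RintegralZl. Qed.

Lemma intgD f g : L1 f -> L1 g -> intg (fun x => f x + g x) = intg f + intg g.
Proof. by move=> If Ig; rewrite /intg RintegralD. Qed.

Lemma intgB f g : L1 f -> L1 g -> intg (fun x => f x - g x) = intg f - intg g.
Proof. by move=> If Ig; rewrite /intg RintegralB. Qed.

Lemma intg_sum (I : Type) (s : seq I) (F : I -> X -> R) :
  (forall i, L1 (F i)) -> intg (fun x => \sum_(i <- s) F i x) = \sum_(i <- s) intg (F i).
Proof.
move=> IF; elim: s => [|i s IH].
  rewrite big_nil /intg (_ : (fun x => _) = cst 0) ?Rintegral_cst ?mul0r//.
  by apply/funext => x; rewrite big_nil.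
rewrite big_cons -IH -intgD//; last exact: L1_sum.
by congr intg; apply/funext => x; rewrite big_cons.
Qed.

Lemma intg_ge0 f : (forall x, 0 <= f x) -> 0 <= intg f.
Proof. by move=> f0; apply: Rintegral_ge0. Qed.

Lemma le_intg f g : L1 f -> L1 g -> (forall x, f x <= g x) -> intg f <= intg g.
Proof. by move=> If Ig fg; apply: le_Rintegral. Qed.

Lemma norm_intg f : L1 f -> `|intg f| <= intg (fun x => `|f x|).
Proof. by move=> If; apply: le_normr_Rintegral. Qed.

Lemma EFin_intg f : L1 f -> ((intg f)%:E = \int[mu]_x (f x)%:E)%E.
Proof. by move=> If; rewrite /intg fineK//; exact: integrable_fin_num. Qed.

Lemma eq_intg_ae f g : measurable_fun setT f -> measurable_fun setT g ->
  {ae mu, forall x, f x = g x} -> intg f = intg g.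
Proof.
move=> mf mg fg; congr fine; apply: ae_eq_integral => //; try exact/measurable_EFinP.
by apply: filterS fg => x -> _.
Qed.

Lemma L1_ae f g : measurable_fun setT g -> L1 f ->
  {ae mu, forall x, f x = g x} -> L1 g.
Proof.
move=> mg If fg; have mf := L1_measurable If.
apply/integrableP; split; first exact/measurable_EFinP.
have /integrableP[_] := If; congr (_ < _)%E.
apply: ae_eq_integral => //; try by apply: measurableT_comp => //; exact/measurable_EFinP.
by apply: filterS fg => x /= -> _.
Qed.

Lemma intg_dct (f_ : nat -> X -> R) f g :
  (forall n, measurable_fun setT (f_ n)) -> L1 g ->
  (forall n x, `|f_ n x| <= g x) -> (forall x, f_ n x @[n --> \oo] --> f x) ->
  L1 f /\ intg (f_ n) @[n --> \oo] --> intg f.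
Proof.
move=> mf Ig fg ff.
have mf' : measurable_fun setT f by apply: measurable_fun_cvg => // x _; exact: ff.
have fg' x : `|f x| <= g x.
  by apply: (cvgr_to_le (cvg_norm (ff x))); exact: nearW.
have If : L1 f.
  by apply: (L1_le _ _ Ig) => // x; rewrite (le_trans (fg' x))// ler_norm.
have Ifn n : L1 (f_ n).
  by apply: (L1_le _ _ Ig) => // x; rewrite (le_trans (fg n x))// ler_norm.
split=> //; apply: fine_cvg; have := EFin_intg If; rewrite {1}/intg => ->.
apply: (@dominated_cvg _ _ _ mu setT measurableT (fun n =>
  EFin \o f_ n) (EFin \o f) (EFin \o g)) => //.
- by move=> n; exact/measurable_EFinP.
- by move=> x _; apply: cvg_EFin; [exact: nearW|exact: ff].
- by move=> n x _ /=; rewrite lee_fin.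
Qed.

Lemma intg_norm_eq0 f : L1 f -> intg (fun x => `|f x|) = 0 ->
  {ae mu, forall x, f x = 0}.
Proof.
move=> If f0; have mf : measurable_fun setT (EFin \o f) by case/integrableP: If.
have [+ _] := ae_eq_integral_abs mu measurableT mf.
rewrite (_ : (\int[mu]_x _ = 0)%E); last first.
  by rewrite -[RHS]/(0%R%:E) -f0 EFin_intg//; exact: L1_norm.
by move=> /(_ erefl); apply: filterS => x /= /(_ Logic.I) [].
Qed.

Lemma measurable_fun_indic (A : set X) : measurable A ->
  measurable_fun setT (\1_A : X -> R).
Proof. exact: measurable_indic. Qed.

Lemma norm_indic_le1 (A : set X) x : `|\1_A x : R| <= 1.
Proof. by rewrite indicE; case: (_ \in _); rewrite ?normr1 ?normr0. Qed.

Lemma L1_indic (A : set X) f : measurable A -> L1 f -> L1 (fun x => f x * \1_A x).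
Proof.
by move=> mA If; apply: (L1_bdd If (measurable_fun_indic mA)); exact: norm_indic_le1.
Qed.

(** The sets over which f has integral 0 form a Dynkin system; [intg f = 0] supplies the whole
    space, which [G] may fail to contain. *)
Lemma ae0_of_pi_system (G : set (set X)) f :
  @measurable _ X = <<s G >> -> setI_closed G -> L1 f -> intg f = 0 ->
  (forall A, G A -> intg (fun x => f x * \1_A x) = 0) ->
  {ae mu, forall x, f x = 0}.
Proof.
move=> GE GI If f0 fG; have mf := L1_measurable If.
have h A : measurable A -> intg (fun x => f x * \1_A x) = 0.
  rewrite GE; apply: (@dynkin_induction _ X G (fun A => intg (fun x =>
    f x * \1_A x) = 0) GE GI) => //.
  - by rewrite -f0; congr intg; apply/funext => x; rewrite indicT mulr1.
  - move=> S mS S0; rewrite -[RHS](subrr 0) -{1}f0 -S0 -intgB//; last exact: L1_indic.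
    congr intg; apply/funext => x; rewrite !indicE in_setC.
    by case: (_ \in _); rewrite /= ?mulr0 ?mulr1 ?subrr ?subr0.
  - move=> F mF tF F0.
    (* By disjointness this is f times the indicator of a finite union, so |f| dominates and the
       limit may be taken under the integral. *)
    pose g n x := \sum_(i < n) f x * \1_(F i) x.
    have g0 n : intg (g n) = 0.
      by rewrite intg_sum ?big1// => i; exact: L1_indic.
    have gE n x : g n x = f x * \1_(\bigcup_(k < n) F k) x.
      rewrite /g -mulr_sumr; congr (_ * _); rewrite indicE.
      case: (boolP (x \in _)) => [|xF].
        rewrite inE => -[k /= kn Fkx].
        rewrite (bigD1 (Ordinal kn))//= indicE mem_set// big1 ?addr0// => i ik.
        rewrite indicE memNset// => Fix; move/eqP: ik; apply; apply/val_inj => /=.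
        by apply: (tF i k Logic.I Logic.I); exists x.
      rewrite big1// => i _; rewrite indicE memNset// => Fix.
      by move: xF; rewrite notin_setE; apply; exists (val i) => //=.
    have mg n : measurable_fun setT (g n).
      by apply: L1_measurable; apply: L1_sum => i; exact: L1_indic.
    have gf n x : `|g n x| <= `|f x|.
      by rewrite gE normrM ler_piMr// norm_indic_le1.
    have glim x : g n x @[n --> \oo] --> f x * \1_(\bigcup_k F k) x.
      apply: cvg_near_cst.
      have [[k _ Fkx]|nFx] := pselect ((\bigcup_k F k) x); last first.
        apply: nearW => n; rewrite gE !indicE (memNset nFx) memNset// => -[k _ Fk].
        by apply: nFx; exists k.
      exists k.+1 => // n /= kn; rewrite gE !indicE !mem_set//; first by exists k.
      by exists k.
    have [_] := intg_dct mg (L1_norm If) gf glim.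
    under eq_fun do rewrite g0.
    by move=> h0; rewrite -(cvg_lim _ h0)// lim_cst.
have mfE : measurable_fun setT (EFin \o f) by exact/measurable_EFinP.
have : ae_eq mu setT (EFin \o f) (EFin \o cst 0).
  apply: (@integral_ae_eq _ _ _ mu setT measurableT (EFin \o cst 0) (EFin \o f)) => // [|E _ mE].
    exact/measurable_EFinP.
  rewrite [RHS]integral0.
  rewrite -[RHS]/(0%R%:E) -(h E mE) EFin_intg; last exact: L1_indic.
  rewrite integral_mkcond; apply: eq_integral => x _ /=.
  by rewrite /patch indicE; case: ifPn => _; rewrite ?mulr1 ?mulr0.
by apply: filterS => x /= /(_ Logic.I)[].
Qed.

End RealIntegrals.

(** * Gaussian variables and the Wiener process *)

Section StandardNormal.
Variable R : realType.
Local Notation leb1 := (@lebesgue_measure R).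
Local Notation N := (@normal_prob R 0 1).
Local Notation w := (@normal_pdf R 0 1).

(** The Radon-Nikodym derivative of the normal law agrees almost everywhere with [normal_pdf], both
    having the same integral over every measurable set. *)
Lemma normal_density_ge0 (f : R -> \bar R) : measurable_fun setT f -> (forall x, (0 <= f x)%E) ->
  (\int[N]_x f x = \int[leb1]_x (f x * (w x)%:E))%E.
Proof.
move=> mf f0; have dom := @normal_prob_dominates R 0 1.
rewrite -(Radon_Nikodym_SigmaFinite.change_of_variables dom f0 measurableT mf).
apply: ae_eq_integral => //.
- apply: emeasurable_funM => //; apply: (measurable_int leb1).
  exact: Radon_Nikodym_SigmaFinite.f_integrable.
- apply: emeasurable_funM => //; apply/measurable_EFinP.
  exact: measurable_normal_pdf.
- apply: ae_eqe_mul2l; apply: integral_ae_eq => //.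
  + exact: Radon_Nikodym_SigmaFinite.f_integrable.
  + by apply/measurable_EFinP; exact: measurable_normal_pdf.
  + by move=> E _ mE; rewrite -(Radon_Nikodym_SigmaFinite.f_integral dom).
Qed.

Lemma normal_pdf_expR x : w x = normal_peak 1 * expR (- (x ^+ 2 / 2)).
Proof.
by rewrite normal_pdfE ?oner_neq0// /normal_fun subr0 expr1n mulNr.
Qed.

(** Completing the square turns an exponential moment into the mass of a shifted normal law. *)
Lemma normal_pdf_shift t x : expR (t * x) * w x = expR (t ^+ 2 / 2) * normal_pdf t 1 x.
Proof.
rewrite !normal_pdfE ?oner_neq0// /normal_fun subr0 expr1n mulrCA [RHS]mulrCA.
congr (_ * _); rewrite -!expRD; congr expR; lra.
Qed.

Lemma L1_normal_ge0 (f : R -> R) : measurable_fun setT f -> (forall x, 0 <= f x) ->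
  L1 leb1 (fun x => f x * w x) -> L1 N f.
Proof.
move=> mf f0 /integrableP[_ foo]; apply/integrableP; split; first exact/measurable_EFinP.
rewrite (le_lt_trans _ foo)// normal_density_ge0//; last first.
  by apply: measurableT_comp => //; exact/measurable_EFinP.
rewrite le_eqVlt; apply/orP; left; apply/eqP; apply: eq_integral => x _ /=.
by rewrite -EFinM normrM (ger0_norm (normal_pdf_ge0 _ _ _)).
Qed.

Lemma L1_normal (f : R -> R) : L1 N f ->
  L1 leb1 (fun x => f x * w x) /\ intg N f = intg leb1 (fun x => f x * w x).
Proof.
have ge0 (g : R -> R) : (forall x, 0 <= g x) -> L1 N g ->
    L1 leb1 (fun x => g x * w x) /\ intg N g = intg leb1 (fun x => g x * w x).
  move=> g0 Ig; have mg := L1_measurable Ig.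
  have E : (\int[N]_x (g x)%:E = \int[leb1]_x (g x * w x)%:E)%E.
    by rewrite normal_density_ge0//; exact/measurable_EFinP.
  split; last by rewrite /intg /Rintegral E.
  have /integrableP[_ goo] := Ig; apply/integrableP; split.
    by apply/measurable_EFinP/measurable_funM => //; exact: measurable_normal_pdf.
  move: goo; congr (_ < _)%E.
  transitivity (\int[N]_x (g x)%:E)%E.
    by apply: eq_integral => x _ /=; rewrite ger0_norm.
  by rewrite E; apply: eq_integral => x _ /=; rewrite ger0_norm// mulr_ge0// normal_pdf_ge0.
move=> If; have mf := L1_measurable If.
pose fp x := Num.max (f x) 0; pose fm x := Num.max (- f x) 0.
have fE x : f x = fp x - fm x.
  rewrite /fp /fm; case: (leP 0 (f x)) => h.
    by rewrite max_r ?subr0// oppr_le0.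
  by rewrite max_l ?sub0r ?opprK// oppr_ge0 ltW.
have Ip : L1 N fp.
  apply: (L1_le _ _ If) => [|x]; first exact: measurable_maxr.
  by rewrite /fp ger0_norm ?le_max ?lexx ?orbT// ge_max ler_norm normr_ge0.
have Im : L1 N fm.
  apply: (L1_le _ _ If) => [|x]; first by apply: measurable_maxr => //; exact: measurableT_comp.
  by rewrite /fm ger0_norm ?le_max ?lexx ?orbT// ge_max -normrN ler_norm normr_ge0.
have [Lp Ep] := ge0 fp (fun x => ltac:(by rewrite le_max lexx orbT)) Ip.
have [Lm Em] := ge0 fm (fun x => ltac:(by rewrite le_max lexx orbT)) Im.
have FE : (fun x => f x * w x) = (fun x => fp x * w x - fm x * w x).
  by apply/funext => x; rewrite -mulrBl -fE.
rewrite FE; split; first exact: L1B.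
by rewrite intgB// -Ep -Em -intgB//; congr intg; apply/funext => x; exact: fE.
Qed.

Lemma L1_normal_expR t : L1 N (fun x => expR (t * x)).
Proof.
apply: L1_normal_ge0 => [|x|]; [|exact: expR_ge0|].
  by apply: measurableT_comp => //; exact: measurable_funM.
under [X in L1 _ X]eq_fun do rewrite normal_pdf_shift.
by apply: L1Z; exact: integrable_normal_pdf.
Qed.

(** From the exponential series, |x|^k <= k! exp |x| <= k! (exp x + exp (-x)). *)
Lemma L1_normal_normX k : L1 N (fun x => `|x| ^+ k).
Proof.
have Ig : L1 N (fun x => k`!%:R * (expR (1 * x) + expR (-1 * x))).
  by apply: L1Z; apply: L1D; exact: L1_normal_expR.
apply: (L1_le _ _ Ig) => [|x].
- by apply: measurable_funX; exact: normr_measurable.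
- have E0 y : 0 <= expR (y * x) by exact: expR_ge0.
  rewrite normrX normr_id [leRHS]ger0_norm; last by rewrite mulr_ge0// addr_ge0.
  have ex : expR `|x| <= expR (1 * x) + expR (-1 * x).
    rewrite mul1r mulN1r; have := expR_ge0 x; have := expR_ge0 (- x).
    by case: (ger0P x) => _ ? ?; lra.
  apply: (le_trans _ (ler_wpM2l _ ex)) => //.
  case: k {Ig} => [|k]; first by rewrite expr0 fact0 mul1r -expR0 ler_expR.
  rewrite -ler_pdivrMl ?ltr0n ?fact_gt0// mulrC.
  by have := expR_ge1Dxn k (normr_ge0 x); apply: le_trans; rewrite lerDr.
Qed.

Lemma cvg_normal_pdf0 : w n%:R @[n --> \oo] --> 0.
Proof.
apply: (@squeeze_cvgr _ _ _ _ (fun=> 0) (fun n => normal_peak 1 * 2 * n.+1%:R^-1)).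
- apply: nearW => n; rewrite normal_pdf_ge0/= normal_pdf_expR -mulrA ler_wpM2l ?normal_peak_ge0//.
  rewrite expRN (le_trans (_ : _ <= (1 + n%:R ^+ 2 / 2)^-1))//.
    by rewrite lef_pV2 ?posrE ?expR_gt0 ?expR_ge1Dx// ltr_wpDr// divr_ge0// sqr_ge0.
  rewrite -[leLHS]mul1r ler_pdivrMr ?ltr_wpDr ?divr_ge0 ?sqr_ge0//.
  rewrite mulrAC ler_pdivlMr// mul1r -natr1.
  have := ler0n R n; have := sqr_ge0 (n%:R - 1 : R); rewrite sqrrB mulr1 expr1n; set y := n%:R; lra.
- exact: cvg_cst.
- by rewrite -(mulr0 (normal_peak 1 * 2)); apply: cvgMr; have := @cvg_harmonic R.
Qed.

Lemma is_derive_normal_sin (s b x : R) :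
  is_derive x 1 (fun x => w x * sin (s * x + b))
    ((s * cos (s * x + b) - x * sin (s * x + b)) * w x).
Proof.
rewrite (_ : (fun x => _) = (fun x => normal_peak 1 * (expR (- (x ^+ 2 / 2)) * sin (s * x +
  b)))); last first.
  by apply/funext => y; rewrite normal_pdf_expR mulrA.
rewrite normal_pdf_expR.
apply: is_derive_eq.
by rewrite /GRing.scale/=; by field.
Qed.

Lemma measurable_sin_lin (s b : R) : measurable_fun setT (fun x : R => sin (s * x + b)).
Proof.
apply: continuous_measurable_fun => x.
by apply: differentiable_continuous; exact/derivable1_diffP.
Qed.

Lemma measurable_cos_lin (s b : R) : measurable_fun setT (fun x : R => cos (s * x + b)).
Proof.
apply: continuous_measurable_fun => x.
by apply: differentiable_continuous; exact/derivable1_diffP.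
Qed.

Lemma norm_cos_le1 (y : R) : `|cos y| <= 1.
Proof. by rewrite ler_norml cos_geN1 cos_le1. Qed.

Lemma norm_sin_le1 (y : R) : `|sin y| <= 1.
Proof. by rewrite ler_norml sin_geN1 sin_le1. Qed.

Lemma L1_normal_id : L1 N id.
Proof.
apply: (L1_le _ _ (L1_normal_normX 1)) => // x; by rewrite expr1 normr_id.
Qed.

(** The difference of the two sides is the integral of the derivative of w(x) sin (s x + b). The
    fundamental theorem on [-(n + 1), n + 1] leaves boundary terms of size at most 2 w(n + 1), which
    vanish. *)
Lemma normal_ibp (s b : R) :
  intg N (fun x => x * sin (s * x + b)) = s * intg N (fun x => cos (s * x + b)).
Proof.
have Ic : L1 N (fun x => cos (s * x + b)).
  apply: (L1_le _ _ (L1_normal_normX 0)) => [|x]; first exact: measurable_cos_lin.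
  by rewrite expr0 normr1 norm_cos_le1.
have Is : L1 N (fun x => x * sin (s * x + b)).
  by apply: (L1_bdd L1_normal_id (measurable_sin_lin s b)) => x; exact: norm_sin_le1.
have I' : L1 N (fun x => s * cos (s * x + b) - x * sin (s * x + b)).
  by apply: L1B => //; exact: L1Z.
apply/eqP; rewrite eq_sym -subr_eq0 -intgZ// -intgB//; last exact: L1Z.
have [Iw ->] := L1_normal I'.
pose h x := (s * cos (s * x + b) - x * sin (s * x + b)) * w x.
pose F x := w x * sin (s * x + b).
have dF (x : R) : is_derive x 1 F (h x) := is_derive_normal_sin s b x.
have hc : continuous h.
  have hc1 : continuous (fun x : R => s * cos (s * x + b) - x * sin (s * x + b)).
    by move=> x; apply: differentiable_continuous; exact/derivable1_diffP.
  by move=> x; apply: cvgM; [exact: hc1|exact: continuous_normal_pdf (oner_neq0 _) x].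
have mh : measurable_fun setT h by exact: L1_measurable Iw.
have hE n : intg leb1 (fun x => h x * \1_(`[- n.+1%:R, n.+1%:R]) x) = F n.+1%:R - F (- n.+1%:R).
  have lt : - n.+1%:R < n.+1%:R :> R by rewrite gtrN.
  have Fc : continuous F.
    by move=> x; apply: differentiable_continuous; apply/derivable1_diffP; have [] := dF x.
  have := @continuous_FTC2 _ h F _ _ lt.
  move=> /(_ _ _ _)/wrap[].
  - exact: continuous_subspaceT.
  - split; [by move=> x _; have [] := dF x| |].
      by apply: cvg_at_right_filter; exact: Fc.
    by apply: cvg_at_left_filter; exact: Fc.
  - by move=> x _; rewrite derive1E; have [] := dF x.
  move=> FTC; apply: EFin_inj; rewrite EFinB -FTC EFin_intg; last first.
    by apply: L1_indic => //; exact: Iw.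
  rewrite [RHS]integral_mkcond; apply: eq_integral => x _ /=.
  by rewrite /patch indicE; case: ifPn => _; rewrite ?mulr1 ?mulr0.
have [||n x|x|_] := @intg_dct _ _ _ leb1 (fun n x =>
  h x * \1_(`[- n.+1%:R, n.+1%:R]) x) h (fun x => `|h x|).
- by move=> n; apply: measurable_funM => //; exact: measurable_indic.
- exact: L1_norm.
- by rewrite normrM ler_piMr// norm_indic_le1.
- apply: cvg_near_cst; near=> n; rewrite indicE mem_set ?mulr1//= in_itv/= -ler_norml.
  near: n; apply: filterS (nbhs_infty_ger `|x|) => n; move=> /le_trans; apply.
  by rewrite ler_nat.
under eq_fun do rewrite hE.
move=> lim_h.
suff lim0 : F n.+1%:R - F (- n.+1%:R) @[n --> \oo] --> 0.
  by apply/eqP; apply: (cvg_unique _ lim_h lim0).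
apply/cvgr0Pnorm_le => e e0.
near=> n.
have wN : w (- n.+1%:R) = w n.+1%:R by rewrite !normal_pdf_expR sqrrN.
have wle y : `|w n.+1%:R * sin y| <= w n.+1%:R.
  rewrite normrM (ger0_norm (normal_pdf_ge0 _ _ _)) ler_piMr ?normal_pdf_ge0//.
  exact: norm_sin_le1.
rewrite /F wN (le_trans (ler_normB _ _))// (le_trans (lerD (wle _) (wle _)))//.
have : w n.+1%:R <= e / 2.
  near: n; have := cvg_normal_pdf0; rewrite -(cvg_shiftS (fun n => w n%:R)).
  by move=> /cvgr_le; apply; rewrite divr_gt0.
lra.
Unshelve. all: by end_near. Qed.

(** Differentiating under the integral, with |x| as domination, and using [normal_ibp] gives G' = -
    s G. So G(s) exp (s^2 / 2) is constant. *)
Lemma normal_cos (s b : R) : intg N (fun x => cos (s * x + b)) = cos b * expR (- (s ^+ 2 / 2)).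
Proof.
pose G s := intg N (fun x => cos (s * x + b)).
have Ic s' : L1 N (fun x => cos (s' * x + b)).
  apply: (L1_le _ _ (L1_normal_normX 0)) => [|x]; first exact: measurable_cos_lin.
  by rewrite expr0 normr1 norm_cos_le1.
have dcos (s' x : R) : is_derive s' (1:R) (fun s => cos (s * x + b)) (- (x * sin (s' * x + b))).
  by apply: is_derive_eq; rewrite /GRing.scale/=; ring.
have dG (s' : R) : is_derive s' (1:R) G (- s' * G s').
  have int1 s1 : `]s' - 1, s' + 1[%classic s1 -> N.-integrable setT (EFin \o (fun x =>
    cos (s1 * x + b))).
    by move=> _; exact: Ic.
  have der1 s1 (x : R) : `]s' - 1, s' + 1[%classic s1 -> setT x -> derivable (fun s : R =>
    cos (s * x + b)) s1 1.
    by move=> _ _; have [] := dcos s1 x.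
  have ub (s1 x : R) : `]s' - 1, s' + 1[%classic s1 -> setT x ->
      `|partial1of2 (fun s x : R => cos (s * x + b)) s1 x| <= `|x|.
    move=> _ _; rewrite partial1of2E; have [_ ->] := dcos s1 x.
    by rewrite normrN normrM ler_piMr// norm_sin_le1.
  have s'in : `]s' - 1, s' + 1[%classic s' by rewrite /= in_itv/=; apply/andP; split; lra.
  have Iabs : N.-integrable setT (EFin \o (fun x : R => `|x|)) := L1_norm L1_normal_id.
  split.
    exact: (derivable_under_integral measurableT s'in int1 der1 (fun x => normr_ge0 x) Iabs ub).
  rewrite -derive1E (differentiation_under_integral measurableT s'in int1 der1 (fun x =>
    normr_ge0 x) Iabs ub).
  transitivity (intg N (fun x => -1 * (x * sin (s' * x + b)))).
    congr intg; apply/funext => x; rewrite mulN1r /= partial1of2E.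
    by have [_ ->] := dcos s' x.
  rewrite intgZ ?normal_ibp ?mulN1r ?mulNr//.
  by apply: (L1_bdd L1_normal_id (measurable_sin_lin s' b)) => x; exact: norm_sin_le1.
have cst : (fun s => G s * expR (s ^+ 2 / 2)) s = (fun s => G s * expR (s ^+ 2 / 2)) 0.
  apply: (@is_derive_0_is_cst _ (fun s => G s * expR (s ^+ 2 / 2)) s 0) => s'.
  have := dG s' => dGs.
  by apply: is_derive_eq; rewrite /GRing.scale/=; by field.
have G0 : G 0 = cos b.
  rewrite /G; under eq_fun do rewrite mul0r add0r.
  rewrite /intg Rintegral_cst// -[X in _ * X]/(fine (N setT)) probability_setT mulr1//.
move: cst => /=; rewrite expr0n /= mul0r expR0 mulr1 G0 => <-.
by rewrite -mulrA -expRD subrr expR0 mulr1.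
Qed.

End StandardNormal.

(** * Transfer of laws and independence *)

Section GaussianLaw.
Context (R : realType) d (Omega : measurableType d) (P : probability Omega R).
Local Notation N := (@normal_prob R 0 1).

(** Integrals are compared through the two image measures, which agree on measurable sets; for
    [sg = 0] the law has no density. *)
Lemma transfer_law (X : Omega -> R) (sg : R) (g : R -> R) :
  measurable_fun setT (X : Omega -> measurableTypeR R) ->
  (forall C : set (measurableTypeR R), measurable C ->
     P (X @^-1` C) = N ((fun x => sg * x) @^-1` C)) ->
  measurable_fun setT g ->
  L1 N (fun x => g (sg * x)) ->
  L1 P (g \o X) /\ intg P (g \o X) = intg N (fun x => g (sg * x)).
Proof.
move=> mX XN mg IN.
have msg : measurable_fun setT (fun x : measurableTypeR R => sg * x : measurableTypeR R).
  exact: measurable_funM.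
have mge : measurable_fun setT (EFin \o g) by exact/measurable_EFinP.
pose sc (x : measurableTypeR R) : measurableTypeR R := sg * x.
have mX' : @measurable_fun _ _ Omega (measurableTypeR R) setT X := mX.
pose Xm : {mfun Omega >-> measurableTypeR R} :=
  HB.pack X (@isMeasurableFun.Build _ _ Omega (measurableTypeR R) X mX').
pose scm : {mfun measurableTypeR R >-> measurableTypeR R} :=
  HB.pack sc (isMeasurableFun.Build _ _ _ _ sc msg).
have eqi (f : measurableTypeR R -> \bar R) :
    (\int[pushforward P Xm]_x f x = \int[pushforward N scm]_x f x)%E.
  by apply: eq_measure_integral => A mA _; exact: XN.
have I1 : L1 P (g \o X).
  apply/integrableP; split; first by apply/measurable_EFinP/measurableT_comp.
  have /integrableP[_] := IN; congr (_ < _)%E.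
  have mag : @measurable_fun _ _ (measurableTypeR R) _ setT (fun x => `|(EFin \o g) x|%E).
    by apply: measurableT_comp => //; exact: mge.
  have := eqi (fun x => `|(EFin \o g) x|%E).
  rewrite (ge0_integral_pushforward msg N (measurableT) mag)//.
  by rewrite (ge0_integral_pushforward mX' P (measurableT) mag)// => ->.
split=> //.
rewrite /intg /Rintegral; congr fine.
have mge' : @measurable_fun _ _ (measurableTypeR R) _ setT (EFin \o g) := mge.
have h1 := @integral_pushforward _ _ Omega (measurableTypeR R) R X mX' P setT (EFin \o g) mge' I1
  measurableT.
have h2 := @integral_pushforward _ _ _ (measurableTypeR R) R sc msg N setT (EFin \o g) mge' IN
  measurableT.
exact: (etrans (esym h1) (etrans (eqi (EFin \o g)) h2)).
Qed.

Lemma L1_bounded (f : Omega -> R) (K : R) : measurable_fun setT f ->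
  (forall w, `|f w| <= K) -> L1 P f.
Proof.
move=> mf fK.
have Ic : L1 P (fun=> K) by exact: finite_measure_integrable_cst.
apply: (L1_le _ _ Ic) => // w; rewrite (le_trans (fK w))//; exact: ler_norm.
Qed.

Lemma intg_bounded_cvg (f_ : nat -> Omega -> R) (f : Omega -> R) (K : R) :
  (forall n, measurable_fun setT (f_ n)) -> (forall n w, `|f_ n w| <= K) ->
  (forall w, f_ n w @[n --> \oo] --> f w) -> intg P (f_ n) @[n --> \oo] --> intg P f.
Proof.
move=> mf fK ff; have IK : L1 P (fun=> K) by exact: finite_measure_integrable_cst.
by have [] := intg_dct mf IK fK ff.
Qed.

Lemma intg_cst (K : R) : intg P (fun=> K) = K.
Proof. by rewrite /intg Rintegral_cst// -[X in _ * X]/(fine (P setT)) probability_setT mulr1. Qed.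

Lemma measurable_preimage (X : Omega -> R) (C : set (measurableTypeR R)) :
  measurable_fun setT X -> measurable C -> measurable (X @^-1` C).
Proof. by move=> mX mC; rewrite -[_ @^-1` _]setTI; exact: mX. Qed.

Section Independence.
Variables (X : Omega -> R) (g0 : Omega -> R) (c : R).
Hypotheses (mX : measurable_fun setT X) (mg0 : measurable_fun setT g0).
Variable K0 : R.
Hypothesis g0K : forall w, `|g0 w| <= K0.
Hypothesis Xg0 : forall C : set (measurableTypeR R), measurable C ->
  intg P (fun w => \1_(X @^-1` C) w * g0 w) = intg P \1_(X @^-1` C) * c.

(** The free set C makes the class stable under multiplication by the indicator of {X < a}: that
    indicator is absorbed by intersecting C with a half-line. *)
Let V (f : Omega -> R) := [/\ measurable_fun setT f, exists K : R, forall w, `|f w| <= K &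
  forall C : set (measurableTypeR R), measurable C ->
    intg P (fun w => f w * \1_(X @^-1` C) w * g0 w) =
    intg P (fun w => f w * \1_(X @^-1` C) w) * c].

Let L1b (f : Omega -> R) (C : set (measurableTypeR R)) : measurable C ->
  measurable_fun setT f -> (exists K : R, forall w, `|f w| <= K) ->
  L1 P (fun w => f w * \1_(X @^-1` C) w).
Proof.
move=> mC mf [K fK]; apply: L1_indic; first exact: measurable_preimage.
exact: L1_bounded fK.
Qed.

Let L1bg (f : Omega -> R) (C : set (measurableTypeR R)) : measurable C ->
  measurable_fun setT f -> (exists K : R, forall w, `|f w| <= K) ->
  L1 P (fun w => f w * \1_(X @^-1` C) w * g0 w).
Proof. by move=> mC mf bf; apply: (L1_bdd _ mg0 g0K); exact: L1b. Qed.

Lemma indep_half (h : R -> R) (K : R) : continuous h -> (forall x, `|h x| <= K) ->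
  intg P (fun w => h (X w) * g0 w) = intg P (h \o X) * c.
Proof.
move=> hc hK.
have VP (a : R) f g : V f -> V g -> V (fun w => a * f w + g w).
  move=> [mf bf fE] [mg bg gE]; split.
  - by apply: measurable_funD => //; exact: measurable_funM.
  - have [C fC] := bf; have [D gD] := bg; exists (`|a| * C + D) => w.
    rewrite (le_trans (ler_normD _ _))// normrM lerD//.
    exact: ler_wpM2l.
  - move=> C mC.
    transitivity (intg P (fun w => a * (f w * \1_(X @^-1` C) w * g0 w) + g w * \1_(X @^-1` C) w *
      g0 w)).
      by congr intg; apply/funext => w; ring.
    rewrite intgP ?fE ?gE//; try exact: L1bg.
    rewrite mulrA -mulrDl -intgP; try exact: L1b.
    by congr (intg _ _ * _); apply/funext => w; ring.
have Vlim (f_ : nat -> Omega -> R) (f : Omega -> R) (C : R) : (forall k, V (f_ k)) ->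
    (forall k w, `|f_ k w| <= C * 1) -> (forall w, f_ k w @[k --> \oo] --> f w) -> V f.
  move=> Vf fC ff; have mf k : measurable_fun setT (f_ k) by have [] := Vf k.
  split.
  - by apply: measurable_fun_cvg => // w _; exact: ff.
  - by exists (C * 1) => w; apply: (cvgr_to_le (cvg_norm (ff w))); exact: nearW.
  - move=> D mD.
    have mXD := measurable_preimage mX mD.
    have b1 k w : `|f_ k w * \1_(X @^-1` D) w| <= C * 1.
      by rewrite normrM (le_trans _ (fC k w))// ler_piMr// norm_indic_le1.
    have m1 k : measurable_fun setT (fun w => f_ k w * \1_(X @^-1` D) w).
      by apply: measurable_funM => //; exact: measurable_indic.
    have c1 w : f_ k w * \1_(X @^-1` D) w @[k --> \oo] --> f w * \1_(X @^-1` D) w.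
      by apply: cvgMl; exact: ff.
    have l1 := intg_bounded_cvg m1 b1 c1.
    have l2 : intg P (fun w => f_ k w * \1_(X @^-1` D) w * g0 w) @[k --> \oo] -->
        intg P (fun w => f w * \1_(X @^-1` D) w * g0 w).
      apply: (@intg_bounded_cvg _ _ (C * 1 * K0)) => [k|k w|w].
      - exact: measurable_funM.
      - by rewrite normrM; apply: ler_pM.
      - by apply: cvgMl; exact: c1.
    have l1' : intg P (fun w => f_ k w * \1_(X @^-1` D) w) * c @[k --> \oo] -->
        intg P (fun w => f w * \1_(X @^-1` D) w) * c by apply: cvgMl.
    rewrite (_ : (fun k => _) = (fun k => intg P (fun w => f_ k w * \1_(X @^-1` D) w) * c)) in l2.
      by rewrite -(cvg_lim _ l2)// -(cvg_lim _ l1').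
    by apply/funext => k; have [_ _] := Vf k; exact.
have V1 : V (fun=> 1).
  split=> [//||C mC]; first by exists 1 => w; rewrite normr1.
  transitivity (intg P (fun w => \1_(X @^-1` C) w * g0 w)).
    by congr intg; apply/funext => w; rewrite mul1r.
  by rewrite Xg0//; congr (intg _ _ * _); apply/funext => w; rewrite mul1r.
have ltE a w : (X w < a)%R%:R = \1_(X @^-1` `]-oo, a[%classic) w :> R.
  rewrite indicE; congr (nat_of_bool _)%:R.
  by apply/idP/idP => [h'|]; [rewrite inE /= in_itv|rewrite inE /= in_itv].
have mlt (j : 'I_1) a : multiplier V (fun w => (X w < a)%R%:R).
  split; first by exists 1 => w; case: (_ < _)%R; rewrite ?normr1 ?normr0.
  move=> f [[mf bf fE] _].
  have -> : (fun w => f w * (X w < a)%R%:R) = (fun w => f w * \1_(X @^-1` `]-oo, a[%classic) w).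
    by apply/funext => w; rewrite ltE.
  have mA : measurable (`]-oo, a[%classic : set (measurableTypeR R)) by exact: measurable_itv.
  have mXA := measurable_preimage mX mA.
  split.
  - by apply: measurable_funM => //; exact: measurable_indic.
  - have [C fC] := bf; exists C => w.
    by rewrite normrM (le_trans _ (fC w))// ler_piMr// norm_indic_le1.
  - move=> C mC.
    have E w : f w * \1_(X @^-1` `]-oo, a[%classic) w * \1_(X @^-1` C) w =
        f w * \1_(X @^-1` (`]-oo, a[%classic `&` C)) w.
      by rewrite preimage_setI indicI -mulrA.
    under eq_fun do rewrite E.
    rewrite fE; last exact: measurableI.
    by congr (intg _ _ * _); apply/funext => w; rewrite E.
have := @class_continuous R Omega V (fun=> 1) VP Vlim 1 (fun _ => X) V1 mlt
  (fun y => h (y 0 0)) K.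
have -> : (fun w => h ((\row__ X w : 'rV[R]_1) 0 0)) = h \o X by apply/funext => w; rewrite mxE.
case.
- move=> y; apply: (@continuous_comp _ _ _ (fun y : 'rV[R]_1 => y 0 0) h); last exact: hc.
  exact: coord_continuous.
- by move=> w y _; rewrite mulr1.
move=> _ _ /(_ setT measurableT).
rewrite preimage_setT.
under eq_fun do rewrite indicT mulr1.
by under [X in _ = intg P X * _ -> _]eq_fun do rewrite indicT mulr1.
Qed.

End Independence.

(** Two applications of [indep_half]: one replaces the indicators of Y by g(Y) for a fixed event of
    X, the other replaces the indicators of X by h(X). *)
Lemma indep_continuous (X Y : Omega -> R) (h g : R -> R) (K K' : R) :
  measurable_fun setT X -> measurable_fun setT Y ->
  (forall C C' : set (measurableTypeR R), measurable C -> measurable C' ->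
     P (X @^-1` C `&` Y @^-1` C') = (P (X @^-1` C) * P (Y @^-1` C'))%E) ->
  continuous h -> (forall x, `|h x| <= K) -> continuous g -> (forall x, `|g x| <= K') ->
  intg P (fun w => h (X w) * g (Y w)) = intg P (h \o X) * intg P (g \o Y).
Proof.
move=> mX mY XY hc hK gc gK.
have indP (A : set Omega) : measurable A -> intg P \1_A = fine (P A).
  by move=> mA; rewrite /intg /Rintegral integral_indic// setIT.
have mgY : measurable_fun setT (g \o Y).
  by apply: measurableT_comp => //; exact: continuous_measurable_fun.
apply: (@indep_half X (g \o Y) _ mX mgY K') hc hK => [w|C mC]; first exact: gK.
have mXC := measurable_preimage mX mC.
have mI : measurable_fun setT (\1_(X @^-1` C) : Omega -> R) by exact: measurable_indic.
have H2 : forall C' : set (measurableTypeR R), measurable C' ->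
    intg P (fun w => \1_(Y @^-1` C') w * \1_(X @^-1` C) w) =
    intg P \1_(Y @^-1` C') * intg P \1_(X @^-1` C).
  move=> C' mC'; have mYC := measurable_preimage mY mC'.
  rewrite (_ : (fun w => _) = \1_(Y @^-1` C' `&` X @^-1` C)); last first.
    by apply/funext => w; rewrite indicI.
  rewrite !indP//; last exact: measurableI.
  by rewrite setIC XY// fineM ?fin_num_measure// mulrC.
have := @indep_half Y _ _ mY mI 1 (fun w => ltac:(exact: norm_indic_le1)) H2 g K' gc gK.
by rewrite mulrC => <-; congr intg; apply/funext => w; rewrite mulrC.
Qed.

End GaussianLaw.

(** * Square-integrable and centred Gaussian variables *)

Section SquareIntegrable.
Context (R : realType) d (Omega : measurableType d) (P : probability Omega R).
Implicit Types f g : Omega -> R.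

Definition L2 f := measurable_fun setT f /\ L1 P (fun w => f w ^+ 2).

Lemma L2_mul f g : L2 f -> L2 g -> L1 P (fun w => f w * g w).
Proof.
move=> [mf If] [mg Ig]; apply: (L1_le _ _ (L1D If Ig)) => [|w].
  exact: measurable_funM.
rewrite [leRHS]ger0_norm ?addr_ge0 ?sqr_ge0// normrM.
rewrite -[f w ^+ 2]real_normK ?num_real// -[g w ^+ 2]real_normK ?num_real//.
have := sqr_ge0 (`|f w| - `|g w|); rewrite sqrrB mulr2n.
have := mulr_ge0 (normr_ge0 (f w)) (normr_ge0 (g w)); lra.
Qed.

Lemma L2_cst c : L2 (fun=> c).
Proof. by split=> //; exact: finite_measure_integrable_cst. Qed.

Lemma L2_L1 f : L2 f -> L1 P f.
Proof.
move=> L2f; have := L2_mul L2f (L2_cst 1); congr L1; apply/funext => w; exact: mulr1.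
Qed.

Lemma L2P (a : R) f g : L2 f -> L2 g -> L2 (fun w => a * f w + g w).
Proof.
move=> L2f L2g; split.
  by apply: measurable_funD; [apply: measurable_funM => //; exact: L2f.1|exact: L2g.1].
have := L1D (L1P (a ^+ 2) L2f.2 L2g.2) (L1Z (2 * a) (L2_mul L2f L2g)).
by congr L1; apply/funext => w; ring.
Qed.

Lemma L2Z (a : R) f : L2 f -> L2 (fun w => a * f w).
Proof.
move=> L2f; have := L2P a L2f (L2_cst 0); congr L2; apply/funext => w; exact: addr0.
Qed.

Lemma L2D f g : L2 f -> L2 g -> L2 (fun w => f w + g w).
Proof.
move=> L2f L2g; have := L2P 1 L2f L2g; congr L2; apply/funext => w; by rewrite mul1r.
Qed.

Lemma L2B f g : L2 f -> L2 g -> L2 (fun w => f w - g w).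
Proof.
move=> L2f L2g; have := L2P (-1) L2g L2f; congr L2; apply/funext => w.
by rewrite mulN1r; exact: addrC.
Qed.

Lemma L2_ae f g : measurable_fun setT g -> L2 f -> {ae P, forall w, f w = g w} -> L2 g.
Proof.
move=> mg [mf If] fg; split=> //; apply: (L1_ae _ If); first exact: measurable_funX.
by apply: filterS fg => w ->.
Qed.

Lemma L1_cos f b : measurable_fun setT f -> L1 P (fun w => cos (f w + b)).
Proof.
move=> mf; apply: (@L1_bounded _ _ _ _ _ 1) => [|w]; last exact: norm_cos_le1.
apply: (@measurableT_comp _ _ _ _ _ _ (@cos R)).
  by apply: continuous_measurable_fun; exact: continuous_cos.
exact: measurable_funD.
Qed.

(** The characteristic function, at frequency 1, of the centred normal law with variance E[f^2]; the
    phase b covers real and imaginary part. Other frequencies are reached by applying this to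
    multiples of f, within a linear space of such variables. *)
Definition gaussian f := forall b : R,
  intg P (fun w => cos (f w + b)) = cos b * expR (- (intg P (fun w => f w ^+ 2) / 2)).

Lemma gaussian_ae f g : measurable_fun setT f -> measurable_fun setT g ->
  {ae P, forall w, f w = g w} -> gaussian f -> gaussian g.
Proof.
move=> mf mg fg Gf b.
have -> : intg P (fun w => g w ^+ 2) = intg P (fun w => f w ^+ 2).
  apply: eq_intg_ae; [exact: measurable_funX|exact: measurable_funX|].
  by apply: filterS fg => w ->.
rewrite -Gf; apply: eq_intg_ae.
- exact: L1_measurable (L1_cos b mg).
- exact: L1_measurable (L1_cos b mf).
- by apply: filterS fg => w ->.
Qed.

End SquareIntegrable.

(** * Finite sums of values of the Wiener process *)

Section Wiener.
Variables (R : realType) (T : R) (H : completeNormedModType R) (ip : {dot H for idfun}).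
Hypothesis T_ge0 : 0 <= T.
Hypothesis H_hilbert : inner_product_norm ip.
Variable Q : {linear H -> H}.
Local Notation U := (H0 ip Q).
Context d (Omega : measurableType d) (P : probability Omega R).
Variable W : R -> U -> Omega -> R.
Hypothesis W_wiener : cylindrical_wiener P (natural_filtration W) T W.
Hypothesis F_gen : @measurable d Omega = natural_filtration W T.
Local Notation N := (@normal_prob R 0 1).
Local Notation E := (intg P).

Lemma filtration_measurable t A : t <= T -> natural_filtration W t A -> measurable A.
Proof.
move=> tT; rewrite F_gen; apply: sub_sigma_algebra2 => B [s [u [C [s0 st mC ->]]]].
by exists s, u, C; split=> //; exact: le_trans tT.
Qed.

Lemma W_measurable t u : 0 <= t <= T -> measurable_fun setT (W t u).
Proof.
move=> /[dup] t0T /andP[_ tT] _ C mC; rewrite setTI; apply: (filtration_measurable tT).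
exact: (bm_adapted (cw_brownian W_wiener u) t0T).
Qed.

Lemma increment_law s t u (g : R -> R) : 0 <= s -> s <= t -> t <= T ->
  measurable_fun setT g -> L1 N (fun x => g (normH0 u * Num.sqrt (t - s) * x)) ->
  L1 P (fun w => g (W t u w - W s u w)) /\
  E (fun w => g (W t u w - W s u w)) = intg N (fun x => g (normH0 u * Num.sqrt (t - s) * x)).
Proof.
move=> s0 st tT mg Ig.
apply: (@transfer_law _ _ _ P (increment (W ^~ u) s t) _ g) => //.
- by apply: measurable_funB; apply: W_measurable; apply/andP; split=> //;
    [exact: le_trans s0 st|exact: le_trans st tT].
- by move=> C mC; exact: (bm_gaussian (cw_brownian W_wiener u)).
Qed.

Lemma W_start u : {ae P, forall w, W 0 u w = 0}.
Proof. exact: (bm_start (cw_brownian W_wiener u)). Qed.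

Lemma W_L2 t u : 0 <= t <= T -> L2 P (W t u).
Proof.
move=> t0T; have /andP[t0 tT] := t0T.
have mX : measurable_fun setT (fun x : R => x ^+ 2) by exact: measurable_funX.
have [|I _] := @increment_law 0 t u _ (lexx 0) t0 tT mX.
  under eq_fun do rewrite exprMn.
  apply: L1Z; have := L1_normal_normX R 2; congr L1.
  by apply/funext => x; rewrite real_normK ?num_real.
apply: (@L2_ae _ _ _ _ (fun w => W t u w - W 0 u w)).
- exact: W_measurable.
- split=> //; apply: measurable_funB; apply: W_measurable => //.
  by rewrite lexx (le_trans t0 tT).
- by apply: filterS (W_start u) => w ->; rewrite subr0.
Qed.

Lemma W_cov s t u v : 0 <= s <= T -> 0 <= t <= T ->
  E (fun w => W s u w * W t v w) = Num.min s t * ipH0 u v.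
Proof.
move=> sT tT; apply: EFin_inj; rewrite EFin_intg; last by apply: L2_mul; exact: W_L2.
by have := cw_covariance W_wiener u v sT tT; rewrite unlock.
Qed.

(** No coefficients are stored: up to a null set a scalar can be moved into the vector by
    [W_scale_ae]. *)
Definition chaos (l : seq (R * U)) (w : Omega) : R := \sum_(x <- l) W x.1 x.2 w.

Definition valid_times (l : seq (R * U)) := all (fun x => 0 <= x.1 <= T) l.

Lemma chaos_cons x l w : chaos (x :: l) w = W x.1 x.2 w + chaos l w.
Proof. by rewrite /chaos big_cons. Qed.

Lemma chaos_cat l l' w : chaos (l ++ l') w = chaos l w + chaos l' w.
Proof. by rewrite /chaos big_cat. Qed.

Lemma chaos_L2 l : valid_times l -> L2 P (chaos l).
Proof.
elim: l => [_|x l IH /= /andP[x0T lT]].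
  by have := L2_cst P 0; congr L2; apply/funext => w; rewrite /chaos big_nil.
have := L2D (W_L2 x.2 x0T) (IH lT); congr L2.
by apply/funext => w; rewrite chaos_cons.
Qed.

(** The second moment of the defect is a combination of covariances, and by bilinearity of [ipH0] it
    vanishes. *)
Lemma W_linear_ae t a u v : 0 <= t <= T ->
  {ae P, forall w, W t (a *: u + v) w = a * W t u w + W t v w}.
Proof.
move=> tT.
have Lu := W_L2 u tT; have Lv := W_L2 v tT; have Luv := W_L2 (a *: u + v) tT.
have Ld := L2B Luv (L2P a Lu Lv).
suff d0 : E (fun w => `|(W t (a *: u + v) w - (a * W t u w + W t v w)) ^+ 2|) = 0.
  have := intg_norm_eq0 Ld.2 d0; apply: filterS => w /eqP.
  by rewrite sqrf_eq0 subr_eq0 => /eqP.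
under eq_fun do rewrite ger0_norm ?sqr_ge0//.
rewrite (_ : (fun w => _) = (fun w => W t (a *: u + v) w * W t (a *: u + v) w +
  (-2 * a * (W t (a *: u + v) w * W t u w) + (-2 * (W t (a *: u + v) w * W t v w) +
  (a ^+ 2 * (W t u w * W t u w) + (2 * a * (W t u w * W t v w) + W t v w * W t v w))))));
    last first.
  by apply/funext => w; ring.
have I1 := L2_mul Luv Luv; have I2 := L2_mul Luv Lu; have I3 := L2_mul Luv Lv.
have I4 := L2_mul Lu Lu; have I5 := L2_mul Lu Lv; have I6 := L2_mul Lv Lv.
rewrite intgD//; last by do 4 apply: L1P => //.
rewrite !intgP//; try by do ?apply: L1P.
rewrite !W_cov// minxx !(ipH0C u) !(ipH0C v) !ipH0Pl//.
rewrite !(ipH0C _ (a *: u + v)) !ipH0Pl// (ipH0C v u); ring.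
Qed.

Lemma W_scale_ae t a u : 0 <= t <= T -> {ae P, forall w, W t (a *: u) w = a * W t u w}.
Proof.
move=> tT; have := W_linear_ae a u 0 tT; have := W_linear_ae (-1) (0 : U) 0 tT.
rewrite scaler0 addr0; apply: filterS2 => w h0.
rewrite addr0 => ->; move: h0; rewrite mulN1r addNr => ->; by rewrite addr0.
Qed.

Lemma increment_cos s t u b : 0 <= s -> s <= t -> t <= T ->
  E (fun w => cos (W t u w - W s u w + b)) = cos b * expR (- ((t - s) * ipH0 u u / 2)).
Proof.
move=> s0 st tT.
have mg : measurable_fun setT (fun x : R => cos (x + b)).
  by have := @measurable_cos_lin R 1 b; congr measurable_fun; apply/funext => x; rewrite mul1r.
have [|_ ->] := @increment_law s t u (fun x => cos (x + b)) s0 st tT mg.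
  apply: (L1_le _ _ (L1_normal_normX R 0)) => [|x]; first exact: measurable_cos_lin.
  by rewrite expr0 normr1 norm_cos_le1.
by rewrite normal_cos exprMn normH0_sqr// sqr_sqrtr ?subr_ge0// (mulrC (ipH0 u u)).
Qed.

(** This feeds [bm_indep]: sums of values up to time s are independent of later increments. *)
Lemma chaos_adapted s l C : measurable (C : set (measurableTypeR R)) ->
  all (fun x => 0 <= x.1 <= s) l -> natural_filtration W s (chaos l @^-1` C).
Proof.
set G := [set A | exists (s0 : R) (u : U) (C : set (measurableTypeR R)),
         [/\ 0 <= s0, s0 <= s, measurable C & A = W s0 u @^-1` C]].
pose Os := g_sigma_algebraType G.
move=> mC ls.
have : @measurable_fun _ _ Os (measurableTypeR R) setT (chaos l).
  elim: l ls => [_|x l IH /= /andP[/andP[x0 xs] ls]].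
    rewrite (_ : chaos [::] = cst 0); first exact: measurable_cst.
    by apply/funext => w; rewrite /chaos big_nil.
  rewrite (_ : chaos _ = (fun w : Os => W x.1 x.2 w + chaos l w)); last first.
    by apply/funext => w; rewrite chaos_cons.
  apply: (@measurable_funD _ Os) => //; last exact: IH.
  move=> _ B mB; rewrite setTI; apply: sub_sigma_algebra.
  by exists x.1, x.2, B.
by move=> /(_ measurableT C mC); rewrite setTI.
Qed.

Lemma chaos_mul_E l Z : valid_times l -> L2 P Z ->
  E (fun w => chaos l w * Z w) = \sum_(x <- l) E (fun w => W x.1 x.2 w * Z w).
Proof.
move=> + L2Z; elim: l => [_|x l IH /= /andP[x0T lT]].
  rewrite big_nil -[RHS](intg_cst P 0); congr intg; apply/funext => w.
  by rewrite /chaos big_nil mul0r.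
rewrite big_cons -IH// -intgD.
- by congr intg; apply/funext => w; rewrite chaos_cons mulrDl.
- by apply: L2_mul => //; exact: W_L2.
- by apply: L2_mul => //; exact: chaos_L2.
Qed.

(** By independence the expectation of the cosine of the sum factorises. The sine part drops out
    because the increment has E[sin] = 0, and the variances add because the cross covariance is
    min(s, t') - min(s, t) = 0 for s <= t. *)
Lemma gaussian_add_increment l t t' u : all (fun x => 0 <= x.1 <= t) l ->
  0 <= t -> t <= t' -> t' <= T -> gaussian P (chaos l) ->
  gaussian P (fun w => chaos l w + (W t' u w - W t u w)).
Proof.
move=> lt t0 tt' t'T Gl b.
have tT : 0 <= t <= T by rewrite t0 (le_trans tt').
have t'0T : 0 <= t' <= T by rewrite t'T (le_trans t0).
have vl : valid_times l.
  by apply: sub_all lt => x /andP[-> /le_trans]; apply; case/andP: tT.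
have LA := chaos_L2 vl; have Lt := W_L2 u tT; have Lt' := W_L2 u t'0T.
pose inc w := W t' u w - W t u w.
have LI : L2 P inc by exact: L2B.
have icos a : E (fun w => cos (inc w + a)) = cos a * expR (- ((t' - t) * ipH0 u u / 2)).
  exact: increment_cos.
have ind (a a' : R) : E (fun w => cos (chaos l w + a) * cos (inc w + a')) =
    E (fun w => cos (chaos l w + a)) * E (fun w => cos (inc w + a')).
  have cc (c : R) : continuous (fun x : R => cos (x + c)).
    by move=> x; apply: differentiable_continuous; exact/derivable1_diffP.
  apply: (@indep_continuous _ _ _ P (chaos l) inc (fun x => cos (x + a)) (fun x =>
    cos (x + a')) 1 1) => //.
  - exact: LA.1.
  - exact: LI.1.
  - move=> C C' mC mC'; apply: (bm_indep (cw_brownian W_wiener u)) => //.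
    exact: chaos_adapted.
  - by move=> x; exact: norm_cos_le1.
  - by move=> x; exact: norm_cos_le1.
have mcA a : measurable_fun setT (fun w => cos (chaos l w + a)).
  exact: (L1_measurable (L1_cos P a LA.1)).
have mcI a : measurable_fun setT (fun w => cos (inc w + a)).
  exact: (L1_measurable (L1_cos P a LI.1)).
(* The addition formula for cos, with each sine written as a cosine shifted by pi / 2, so that [ind]
   applies to both products. *)
have cosE : E (fun w => cos (chaos l w + (W t' u w - W t u w) + b)) =
    E (fun w => cos (chaos l w + b)) * E (fun w => cos (inc w + 0)) -
    E (fun w => cos (chaos l w + (b - pi / 2))) * E (fun w => cos (inc w + (- (pi / 2)))).
  rewrite -!ind -intgB; first last.
  - apply: (@L1_bounded _ _ _ _ _ 1) => [|w]; last first.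
      by rewrite normrM mulr_ile1 ?norm_cos_le1.
    by apply: measurable_funM; [exact: mcA|exact: mcI].
  - apply: (@L1_bounded _ _ _ _ _ 1) => [|w]; last first.
      by rewrite normrM mulr_ile1 ?norm_cos_le1.
    by apply: measurable_funM; [exact: mcA|exact: mcI].
  congr intg; apply/funext => w.
  rewrite -[W t' u w - W t u w]/(inc w) [chaos l w + inc w + b]addrAC (cosD (chaos l w + b)) addr0.
  by rewrite [chaos l w + (b - pi / 2)]addrA !cosBpihalf.
have Iinc : E (fun w => inc w ^+ 2) = (t' - t) * ipH0 u u.
  have -> : (fun w => inc w ^+ 2) = (fun w => W t' u w * W t' u w + ((-2) * (W t' u w * W t u w)
    + W t u w * W t u w)).
    by apply/funext => w; rewrite /inc; ring.
  rewrite intgD ?intgP ?W_cov ?minxx//; try by do ?apply: L1P => //; exact: L2_mul.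
  by rewrite (min_r tt'); ring.
have I0 : E (fun w => chaos l w * inc w) = 0.
  rewrite chaos_mul_E// big1_seq// => x /= xl.
  have /andP[x0 xt] := allP lt x xl.
  have xT : 0 <= x.1 <= T by rewrite x0 (le_trans xt)//; case/andP: tT.
  rewrite (_ : (fun w => _) = (fun w => W x.1 x.2 w * W t' u w - W x.1 x.2 w * W t u w));
    last first.
    by apply/funext => w; rewrite mulrBr.
  rewrite intgB ?W_cov//; try by apply: L2_mul => //; exact: W_L2.
  by rewrite (min_l xt) (min_l (le_trans xt tt')) subrr.
rewrite cosE !icos cosN cos_pihalf mul0r mulr0 subr0 cos0 mul1r Gl -mulrA -expRD.
congr (_ * expR _).
have -> : (fun w => (chaos l w + (W t' u w - W t u w)) ^+ 2) =
    (fun w => chaos l w ^+ 2 + (2 * (chaos l w * inc w) + inc w ^+ 2)).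
  by apply/funext => w; rewrite /inc; ring.
rewrite intgD ?intgP ?I0 ?Iinc//; first by ring.
- exact: L2_mul.
- exact: LI.2.
- exact: LA.2.
- by apply: L1P; [exact: L2_mul|exact: LI.2].
Qed.

(** Induction on the length. For the last two entries, almost surely W(t)u + W(t')u' = W(t)(u + u')
    + (W(t')u' - W(t)u'): a shorter list ending at t plus an increment after t. A single entry is an
    increment from time 0. *)
Lemma chaos_gaussian_sorted l : valid_times l ->
  sorted (fun x y : R * U => x.1 <= y.1) l -> gaussian P (chaos l).
Proof.
move: {2}(size l) (leqnn (size l)) => n; elim: n l => [|n IH] l.
  rewrite leqn0 => /nilP -> _ _ b.
  rewrite (_ : (fun w => cos _) = fun=> cos b); last first.
    by apply/funext => w; rewrite /chaos big_nil add0r.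
  rewrite (_ : (fun w => _ ^+ 2) = fun=> 0); last first.
    by apply/funext => w; rewrite /chaos big_nil expr0n.
  by rewrite !intg_cst mul0r oppr0 expR0 mulr1.
case/lastP: l => [|l [t' u']]; first by move=> _; exact: (IH [::]).
rewrite size_rcons ltnS => ln vl srt.
have vl' : valid_times l /\ 0 <= t' <= T by move: vl; rewrite /valid_times all_rcons /= => /andP[].
have {vl'}[vl' t'T] := vl'; have /andP[t'0 t'leT] := t'T.
have le_tr : transitive (fun x y : R * U => x.1 <= y.1) by move=> y x z; exact: le_trans.
case/lastP: l ln vl' srt vl => [|l [t u]].
  move=> _ _ _ _.
  have G0 : gaussian P (chaos [::]) by exact: (IH [::]).
  have := @gaussian_add_increment [::] 0 t' u' isT (lexx 0) t'0 t'leT G0.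
  have v0 : valid_times [:: (t', u')] by rewrite /valid_times /= t'T.
  have LW := W_L2 u' t'T; have L0 : L2 P (W 0 u') by apply: W_L2; rewrite lexx T_ge0.
  apply: gaussian_ae.
  - by apply: measurable_funD; [exact: (chaos_L2 (l := [::]) isT).1|exact: (L2B LW L0).1].
  - exact: (chaos_L2 v0).1.
  - by apply: filterS (W_start u') => w h; rewrite /chaos big_nil big_seq1 h /= add0r subr0.
rewrite size_rcons => ln vl' srt vl.
have [vl2 tT] : valid_times l /\ 0 <= t <= T by move: vl';
  rewrite /valid_times all_rcons /= => /andP[].
have /andP[t0 tleT] := tT.
have srt' : sorted (fun x y : R * U => x.1 <= y.1) (rcons l (t, u)).
  by move: srt; rewrite -cats1 => /cat_sorted2[].
have lt : all (fun x => 0 <= x.1 <= t) l.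
  apply/allP => x xl; have /andP[-> _] /= := allP vl2 x xl.
  move: srt'; rewrite sorted_pairwise// pairwise_rcons => /andP[/allP h _].
  exact: (h x xl).
have tt' : t <= t'.
  move: srt; rewrite sorted_pairwise// pairwise_rcons => /andP[/allP h _].
  by apply: (h (t, u)); rewrite mem_rcons inE eqxx.
have GA : gaussian P (chaos (rcons l (t, u + u'))).
  apply: IH; first by rewrite size_rcons.
    by rewrite /valid_times all_rcons /= tT.
  move: srt'; rewrite !sorted_pairwise// !pairwise_rcons => /andP[h ->]; rewrite andbT.
  exact: h.
have vA : valid_times (rcons l (t, u + u')) by rewrite /valid_times all_rcons /= tT.
have ltA : all (fun x => 0 <= x.1 <= t) (rcons l (t, u + u')).
  by rewrite all_rcons /= t0 lexx.
have := gaussian_add_increment u' ltA t0 tt' t'leT GA.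
have L1' := W_L2 u' t'T; have L2' := W_L2 u' tT.
apply: gaussian_ae.
- by apply: measurable_funD; [exact: (chaos_L2 vA).1|exact: (L2B L1' L2').1].
- exact: (chaos_L2 vl).1.
- have := W_linear_ae 1 u u' tT; rewrite scale1r; apply: filterS => w.
  rewrite -!cats1 !chaos_cat /chaos !big_seq1 /= mul1r => ->; ring.
Qed.

Lemma chaos_gaussian l : valid_times l -> gaussian P (chaos l).
Proof.
move=> vl; pose l' := sort (fun x y : R * U => x.1 <= y.1) l.
have -> : chaos l = chaos l'.
  by apply/funext => w; rewrite /chaos (perm_big _ (permEl (perm_sort _ l))).
apply: chaos_gaussian_sorted; first by rewrite /valid_times all_sort.
by apply: sort_sorted => x y; exact: le_total.
Qed.

End Wiener.

Lemma cos_lipschitz (R : realType) (x y : R) : `|cos x - cos y| <= `|x - y|.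
Proof.
wlog xy : x y / y <= x => [h|].
  have [/h//|/ltW/h yx] := leP y x.
  by rewrite distrC (distrC x).
rewrite le_eqVlt in xy; case/predU1P : xy => [->|xy]; first by rewrite !subrr normr0.
have cc : {within `[y, x], continuous (@cos R)}.
  by apply: continuous_subspaceT; exact: continuous_cos.
have [c _ ->] := MVT xy (fun z _ => is_derive_cos z) cc.
by rewrite normrM normrN ler_piMl// norm_sin_le1.
Qed.

(** * Mean-square limits of Gaussian variables *)

Section L2Convergence.
Context (R : realType) d (Omega : measurableType d) (P : probability Omega R).
Implicit Types f g : Omega -> R.
Local Notation E := (intg P).
Local Notation L2 := (L2 P).

Lemma L2_CauchySchwarz f g : L2 f -> L2 g ->
  E (fun w => `|f w * g w|) <= Num.sqrt (E (fun w => f w ^+ 2)) * Num.sqrt (E (fun w => g w ^+ 2)).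
Proof.
move=> Lf Lg.
pose a := E (fun w => f w ^+ 2); pose c := E (fun w => g w ^+ 2).
pose b := E (fun w => `|f w * g w|).
have Ifg : L1 P (fun w => `|f w * g w|) by apply: L1_norm; exact: L2_mul.
have q (s t : R) : 0 <= s ^+ 2 * a + 2 * (s * t) * b + t ^+ 2 * c.
  have -> : s ^+ 2 * a + 2 * (s * t) * b + t ^+ 2 * c =
      E (fun w => s ^+ 2 * f w ^+ 2 + (2 * (s * t) * `|f w * g w| + t ^+ 2 * g w ^+ 2)).
    rewrite intgP ?intgP ?intgZ ?addrA//; [exact: Lg.2|exact: L1Z Lg.2|exact: Lf.2|].
    by apply: L1P => //; exact: L1Z Lg.2.
  apply: intg_ge0 => w.
  have := sqr_ge0 (s * `|f w| + t * `|g w|); congr (_ <= _).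
  by rewrite -[f w ^+ 2]real_normK ?num_real// -[g w ^+ 2]real_normK ?num_real// normrM; ring.
(* [L2] is a predicate and not a module, so the abstract inequality is applied to the quadratic form
   with coefficients a, b, c on the plane, at the two unit vectors. *)
pose B (x y : R^o * R^o) : R := x.1 * y.1 * a + (x.1 * y.2 + x.2 * y.1) * b + x.2 * y.2 * c.
have BC x y : B x y = B y x by rewrite /B; ring.
have Bl k x y z : B (k *: x + y) z = k * B x z + B y z.
  by rewrite /B /= /GRing.scale /=; ring.
have B0 x : 0 <= B x x by have := q x.1 x.2; rewrite /B; congr (_ <= _); ring.
have := psd_CauchySchwarz_sqrt BC Bl B0 (1, 0) (0, 1).
rewrite /B /= !(mulr0, mul0r, mulr1, addr0, add0r, mul1r).
by apply: le_trans; exact: ler_norm.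
Qed.

Lemma L2_norm_E_mul f g : L2 f -> L2 g ->
  `|E (fun w => f w * g w)| <= Num.sqrt (E (fun w => f w ^+ 2)) * Num.sqrt (E (fun w => g w ^+ 2)).
Proof.
by move=> Lf Lg; rewrite (le_trans (norm_intg (L2_mul Lf Lg)))// L2_CauchySchwarz.
Qed.

Definition cvgL2 (f_ : nat -> Omega -> R) f :=
  [/\ forall n, L2 (f_ n), L2 f & E (fun w => (f_ n w - f w) ^+ 2) @[n --> \oo] --> 0].

Lemma cvgL2_cst f : L2 f -> cvgL2 (fun=> f) f.
Proof.
move=> Lf; split=> //; rewrite (_ : (fun n => _) = fun=> 0); first exact: cvg_cst.
apply/funext => n; rewrite -[RHS](intg_cst P 0); congr intg.
by apply/funext => w; rewrite subrr expr0n.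
Qed.

Lemma cvgL2P (a : R) (f_ g_ : nat -> Omega -> R) f g : cvgL2 f_ f -> cvgL2 g_ g ->
  cvgL2 (fun n w => a * f_ n w + g_ n w) (fun w => a * f w + g w).
Proof.
move=> [Lf_ Lf cf] [Lg_ Lg cg]; split=> [n||]; [exact: L2P|exact: L2P|].
have Lfd n : L2 (fun w => f_ n w - f w) by exact: L2B.
have Lgd n : L2 (fun w => g_ n w - g w) by exact: L2B.
apply: (@squeeze_cvgr _ _ _ _ (fun=> 0) (fun n =>
  2 * a ^+ 2 * E (fun w => (f_ n w - f w) ^+ 2) + 2 * E (fun w => (g_ n w - g w) ^+ 2))).
- apply: nearW => n; rewrite intg_ge0//= => [|w]; last exact: sqr_ge0.
  have <- : E (fun w => 2 * a ^+ 2 * (f_ n w - f w) ^+ 2 + 2 * (g_ n w - g w) ^+ 2) =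
      2 * a ^+ 2 * E (fun w => (f_ n w - f w) ^+ 2) + 2 * E (fun w => (g_ n w - g w) ^+ 2).
    by rewrite intgP ?intgZ//; [exact: (Lgd n).2|exact: (Lfd n).2|exact: L1Z (Lgd n).2].
  apply: le_intg.
  - by have := (L2B (L2P a (Lf_ n) (Lg_ n)) (L2P a Lf Lg)).2.
  - by apply: L1P; [exact: (Lfd n).2|exact: L1Z (Lgd n).2].
  - move=> w; rewrite -subr_ge0.
    have := sqr_ge0 (a * (f_ n w - f w) - (g_ n w - g w)); congr (_ <= _); ring.
- exact: cvg_cst.
- have c1 : 2 * a ^+ 2 * E (fun w => (f_ n w - f w) ^+ 2) @[n --> \oo] --> 2 * a ^+ 2 * 0.
    by apply: cvgMr.
  have c2 : 2 * E (fun w => (g_ n w - g w) ^+ 2) @[n --> \oo] --> 2 * (0 : R).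
    by apply: cvgMr.
  have c12 := cvgD c1 c2; rewrite !mulr0 addr0 in c12; exact: c12.
Qed.

Lemma cvgL2_E_mul (f_ : nat -> Omega -> R) f Y : cvgL2 f_ f -> L2 Y ->
  E (fun w => f_ n w * Y w) @[n --> \oo] --> E (fun w => f w * Y w).
Proof.
move=> [Lf_ Lf cf] LY.
have Lfd n : L2 (fun w => f_ n w - f w) by exact: L2B.
have h : Num.sqrt (E (fun w => (f_ n w - f w) ^+ 2)) * Num.sqrt (E (fun w =>
  Y w ^+ 2)) @[n --> \oo] --> 0.
  rewrite -[X in _ --> X](mul0r (Num.sqrt (E (fun w => Y w ^+ 2)))); apply: cvgMl.
  rewrite -[X in _ --> X]sqrtr0; apply: (cvg_comp _ _ cf); exact: sqrt_continuous.
apply/cvgrPdist_le => e e0.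
move/cvgr0Pnorm_le: h => /(_ e e0); apply: filterS => n.
rewrite ger0_norm ?mulr_ge0 ?sqrtr_ge0//; apply: le_trans.
rewrite distrC -intgB; [|exact: L2_mul|exact: L2_mul].
apply: le_trans (L2_norm_E_mul (Lfd n) LY).
by under eq_fun do rewrite -mulrBl.
Qed.

Lemma cvgL2_E_cos (f_ : nat -> Omega -> R) f Y b : cvgL2 f_ f -> L2 Y ->
  E (fun w => Y w * cos (f_ n w + b)) @[n --> \oo] --> E (fun w => Y w * cos (f w + b)).
Proof.
move=> [Lf_ Lf cf] LY.
have Lfd n : L2 (fun w => f_ n w - f w) by exact: L2B.
have h : Num.sqrt (E (fun w => (f_ n w - f w) ^+ 2)) * Num.sqrt (E (fun w =>
  Y w ^+ 2)) @[n --> \oo] --> 0.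
  rewrite -[X in _ --> X](mul0r (Num.sqrt (E (fun w => Y w ^+ 2)))); apply: cvgMl.
  rewrite -[X in _ --> X]sqrtr0; apply: (cvg_comp _ _ cf); exact: sqrt_continuous.
have IYc g : L2 g -> L1 P (fun w => Y w * cos (g w + b)).
  move=> Lg; apply: (L1_bdd (L2_L1 LY) (L1_measurable (L1_cos P b Lg.1))) => w.
  exact: norm_cos_le1.
apply/cvgrPdist_le => e e0.
move/cvgr0Pnorm_le: h => /(_ e e0); apply: filterS => n.
rewrite ger0_norm ?mulr_ge0 ?sqrtr_ge0//; apply: le_trans.
rewrite distrC -intgB; [|exact: IYc|exact: IYc].
apply: le_trans (L2_CauchySchwarz (Lfd n) LY).
apply: (le_trans (norm_intg _)); first by apply: L1B; exact: IYc.
apply: le_intg.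
- by apply: L1_norm; apply: L1B; exact: IYc.
- by apply: L1_norm; exact: L2_mul.
- move=> w; rewrite -mulrBr !normrM mulrC ler_wpM2r//.
  have := cos_lipschitz (f_ n w + b) (f w + b).
  by rewrite (_ : f_ n w + b - (f w + b) = f_ n w - f w)//; ring.
Qed.

Lemma cvgL2_E_sqr (f_ : nat -> Omega -> R) f : cvgL2 f_ f -> E (fun w =>
  f_ n w ^+ 2) @[n --> \oo] --> E (fun w => f w ^+ 2).
Proof.
move=> cf; have [Lf_ Lf cf0] := cf.
have c1 := cvgL2_E_mul cf Lf.
rewrite (_ : (fun n => _) = (fun n => E (fun w => (f_ n w - f w) ^+ 2) +
   (2 * E (fun w => f_ n w * f w) - E (fun w => f w ^+ 2)))); last first.
  apply/funext => n; rewrite -intgZ; last exact: L2_mul.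
  rewrite -intgB; [|by apply: L1Z; exact: L2_mul|exact: Lf.2].
  rewrite -intgD; [|exact: (L2B (Lf_ n) Lf).2|].
    by congr intg; apply/funext => w; ring.
  by apply: L1B; [apply: L1Z; exact: L2_mul|exact: Lf.2].
have lE : E (fun w => f w ^+ 2) = 0 + (2 * E (fun w => f w * f w) - E (fun w => f w ^+ 2)).
  rewrite (_ : (fun w => f w * f w) = (fun w => f w ^+ 2)); last by apply/funext => w;
    rewrite expr2.
  ring.
have c2 : 2 * E (fun w => f_ n w * f w) @[n --> \oo] --> 2 * E (fun w => f w * f w).
  by apply: cvgMr.
rewrite [X in _ --> X]lE; exact: (cvgD cf0 (cvgB c2 (cvg_cst _))).
Qed.

Lemma cvgL2_gaussian (f_ : nat -> Omega -> R) f : cvgL2 f_ f -> (forall n, gaussian P (f_ n)) ->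
  gaussian P f.
Proof.
move=> cf Gf b.
have c1 := @cvgL2_E_cos f_ f _ b cf (L2_cst P 1).
have c2 : cos b * expR (- (E (fun w => f_ n w ^+ 2) / 2)) @[n --> \oo] -->
    cos b * expR (- (E (fun w => f w ^+ 2) / 2)).
  apply: cvgMr; apply: (cvg_comp _ expR); last exact: continuous_expR.
  by apply: cvgN; apply: cvgMl; exact: cvgL2_E_sqr.
have E1 n : E (fun w => 1 * cos (f_ n w + b)) = cos b * expR (- (E (fun w => f_ n w ^+ 2) / 2)).
  by under eq_fun do rewrite mul1r; exact: Gf.
move: c1; under eq_fun do rewrite E1.
move=> c1; rewrite -(cvg_lim _ c2)// (cvg_lim _ c1)//.
by congr intg; apply/funext => w; rewrite mul1r.
Qed.

End L2Convergence.

Lemma mul_coscos (R : realType) (x y : R) :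
  cos x * cos y = 2^-1 * cos (x + y) + 2^-1 * cos (x - y).
Proof. by rewrite cosD cosB; field. Qed.

(** * Integration by parts and moments of Gaussian variables *)

Section GaussianVariables.
Context (R : realType) d (Omega : measurableType d) (P : probability Omega R).
Local Notation E := (intg P).
Local Notation L2 := (L2 P).
Local Notation N := (@normal_prob R 0 1).

Lemma gaussian_sin X b : gaussian P X ->
  E (fun w => sin (X w + b)) = sin b * expR (- (E (fun w => X w ^+ 2) / 2)).
Proof.
move=> GX; rewrite -(cosBpihalf b) -GX; congr intg; apply/funext => w.
by rewrite addrA cosBpihalf.
Qed.

(** Differentiate E[sin (s Y + X + b)] at s = 0 in two ways: under the expectation, dominated by
    |Y|, and in the closed form sin b exp (-q(s) / 2), where q(s) is the variance of s Y + X. *)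
Lemma gaussian_ibp X Y b : L2 X -> L2 Y ->
  (forall s : R, gaussian P (fun w => s * Y w + X w)) ->
  E (fun w => Y w * cos (X w + b)) = - E (fun w => X w * Y w) * E (fun w => sin (X w + b)).
Proof.
move=> LX LY GXY.
pose f (s : R) (w : Omega) := sin (s * Y w + X w + b).
have df s w : is_derive s (1:R) (f ^~ w) (Y w * cos (s * Y w + X w + b)).
  by apply: is_derive_eq; rewrite /GRing.scale/=; ring.
have L2XY s : L2 (fun w => s * Y w + X w) by exact: L2P.
have fE s : (fun w => f s w) = (fun w => cos (s * Y w + X w + (b - pi / 2))).
  by apply/funext => w; rewrite /f addrA cosBpihalf.
have intf s : `]-1, 1[%classic s -> P.-integrable setT (EFin \o f s).
  move=> _; rewrite -[_.-integrable _ _]/(L1 P (fun w => f s w)) fE.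
  exact: L1_cos (L2XY s).1.
have der s w : `]-1, 1[%classic s -> setT w -> derivable (f ^~ w) s 1.
  by move=> _ _; have [] := df s w.
have IY : P.-integrable setT (EFin \o (fun w => `|Y w|)) := L1_norm (L2_L1 LY).
have ub (s : R) w : `]-1, 1[%classic s -> setT w -> `|partial1of2 f s w| <= `|Y w|.
  move=> _ _; rewrite partial1of2E; have [_ ->] := df s w.
  by rewrite normrM ler_piMr// norm_cos_le1.
have in0 : `]-1, 1[%classic (0 : R) by rewrite /= in_itv/= ltrN10 ltr01.
have d1 := differentiation_under_integral measurableT in0 intf der (fun w => normr_ge0 (Y w)) IY ub.
pose q s := s ^+ 2 * E (fun w => Y w ^+ 2) + 2 * s * E (fun w => X w * Y w) + E (fun w => X w ^+ 2).
have qE s : E (fun w => (s * Y w + X w) ^+ 2) = q s.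
  rewrite (_ : (fun w => _) = (fun w => s ^+ 2 * Y w ^+ 2 + (2 * s * (X w * Y w) + X w ^+ 2)));
    last first.
    by apply/funext => w; ring.
  rewrite intgP ?intgP ?addrA//; [exact: L2_mul|exact: LX.2|exact: LY.2|].
  by apply: L1P; [exact: L2_mul|exact: LX.2].
have FE : (fun s => \int[P]_w f s w) = (fun s => sin b * expR (- (q s / 2))).
  apply/funext => s; rewrite -qE -gaussian_sin//.
rewrite FE in d1.
have d2 : is_derive (0:R) (1:R) (fun s => sin b * expR (- (q s / 2)))
    (sin b * expR (- (q 0 / 2)) * - E (fun w => X w * Y w)).
  by apply: is_derive_eq; rewrite /GRing.scale/=; field.
have {}d2 : (fun s => sin b * expR (- (q s / 2)))^`()%classic 0 =
    sin b * expR (- (q 0 / 2)) * - E (fun w => X w * Y w).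
  by rewrite derive1E; have [_ ->] := d2.
rewrite d2 in d1.
have q0 : q 0 = E (fun w => X w ^+ 2) by rewrite /q; ring.
have GX : gaussian P X.
  by have := GXY 0; congr gaussian; apply/funext => w; rewrite mul0r add0r.
rewrite gaussian_sin// mulrC -q0 d1; congr intg; apply/funext => w.
by rewrite partial1of2E; have [_ ->] := df 0 w; rewrite mul0r add0r.
Qed.

Section Moments.
Variable f : Omega -> R.
Hypotheses (Lf : L2 f) (Gf : forall s, gaussian P (fun w => s * f w)).
Let sg := Num.sqrt (E (fun w => f w ^+ 2)).

(** The cosine factor makes the class stable under multiplication by cosines, since a product of two
    cosines is a combination of cosines. For h = 1 the identity is the equality of characteristic
    functions. *)
Let V (h : R -> R) := [/\ measurable_fun setT h, exists K : R, forall x, `|h x| <= K &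
  forall s b, E (fun w => h (f w) * cos (s * f w + b)) =
    intg N (fun x => h (sg * x) * cos (s * (sg * x) + b))].

Let mfc (s b : R) : measurable_fun setT (fun x : R => cos (s * x + b)).
Proof. exact: measurable_cos_lin. Qed.

Let I1 (h : R -> R) s b : measurable_fun setT h -> (exists K : R, forall x, `|h x| <= K) ->
  L1 P (fun w => h (f w) * cos (s * f w + b)).
Proof.
move=> mh [K hK]; apply: (@L1_bounded _ _ _ _ _ (K * 1)) => [|w].
  apply: (@measurableT_comp _ _ _ _ _ _ (fun x => h x * cos (s * x + b)) _ f _ Lf.1).
  by apply: measurable_funM => //; exact: mfc.
by rewrite normrM ler_pM// norm_cos_le1.
Qed.

Let I2 (h : R -> R) s b : measurable_fun setT h -> (exists K : R, forall x, `|h x| <= K) ->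
  L1 N (fun x => h (sg * x) * cos (s * (sg * x) + b)).
Proof.
move=> mh [K hK]; apply: (@L1_bounded _ _ _ N _ (K * 1)) => [|w].
  apply: (@measurableT_comp _ _ _ _ _ _ (fun x => h x * cos (s * x + b)) _ (fun x => sg * x)).
    by apply: measurable_funM => //; exact: mfc.
  exact: measurable_funM.
by rewrite normrM ler_pM// norm_cos_le1.
Qed.

Lemma gaussian_law (h : R -> R) (K : R) : continuous h -> (forall x, `|h x| <= K) ->
  E (h \o f) = intg N (fun x => h (sg * x)).
Proof.
move=> hc hK.
have VP (a : R) g1 g2 : V g1 -> V g2 -> V (fun x => a * g1 x + g2 x).
  move=> [m1 b1 e1] [m2 b2 e2]; split.
  - by apply: measurable_funD => //; exact: measurable_funM.
  - have [C gC] := b1; have [D gD] := b2; exists (`|a| * C + D) => w.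
    rewrite (le_trans (ler_normD _ _))// normrM lerD//.
    exact: ler_wpM2l.
  - move=> s b.
    transitivity (E (fun w => a * (g1 (f w) * cos (s * f w + b)) + g2 (f w) * cos (s * f w + b))).
      by congr intg; apply/funext => w; ring.
    rewrite intgP ?e1 ?e2//; try exact: I1.
    rewrite -intgP; try exact: I2.
    by congr intg; apply/funext => w; ring.
have Vlim (g_ : nat -> R -> R) (g : R -> R) (C : R) : (forall k, V (g_ k)) ->
    (forall k x, `|g_ k x| <= C * 1) -> (forall x, g_ k x @[k --> \oo] --> g x) -> V g.
  move=> Vg gC gg; have mg k : measurable_fun setT (g_ k) by have [] := Vg k.
  have bg k : exists K : R, forall x, `|g_ k x| <= K by have [] := Vg k.
  split.
  - by apply: measurable_fun_cvg => // w _; exact: gg.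
  - exists (C * 1) => w; apply: (cvgr_to_le (cvg_norm (gg w))).
    by apply: nearW => k; exact: gC.
  - move=> s b.
    have l1 : E (fun w => g_ k (f w) * cos (s * f w + b)) @[k --> \oo] -->
        E (fun w => g (f w) * cos (s * f w + b)).
      apply: (@intg_bounded_cvg _ _ _ _ _ _ (C * 1 * 1)) => [k|k w|w].
      + exact: (L1_measurable (I1 s b (mg k) (bg k))).
      + by rewrite normrM ler_pM// norm_cos_le1.
      + by apply: cvgMl; exact: gg.
    have l2 : intg N (fun x => g_ k (sg * x) * cos (s * (sg * x) + b)) @[k --> \oo] -->
        intg N (fun x => g (sg * x) * cos (s * (sg * x) + b)).
      apply: (@intg_bounded_cvg _ _ _ N _ _ (C * 1 * 1)) => [k|k w|w].
      + exact: (L1_measurable (I2 s b (mg k) (bg k))).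
      + by rewrite normrM ler_pM// norm_cos_le1.
      + by apply: cvgMl; exact: gg.
    have eqk k : E (fun w => g_ k (f w) * cos (s * f w + b)) =
        intg N (fun x => g_ k (sg * x) * cos (s * (sg * x) + b)) by have [_ _] := Vg k; exact.
    move: l1; under eq_fun do rewrite eqk.
    by move=> l1; rewrite -(cvg_lim _ l1)// (cvg_lim _ l2).
have V1 : V (fun=> 1).
  split=> [//||s b]; first by exists 1 => w; rewrite normr1.
  under eq_fun do rewrite mul1r.
  under [in RHS]eq_fun do rewrite mul1r mulrA.
  rewrite normal_cos Gf; congr (_ * expR (- (_ / 2))).
  rewrite exprMn sqr_sqrtr ?intg_ge0//; last by move=> w; rewrite sqr_ge0.
  rewrite -intgZ; last exact: Lf.2.
  by congr intg; apply/funext => w; rewrite exprMn.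
have mcos s b : multiplier V (fun x => cos (s * x + b)).
  split; first by exists 1 => x; exact: norm_cos_le1.
  move=> g [[mg bg eg] _]; split.
  - by apply: measurable_funM => //; exact: mfc.
  - by have [C gC] := bg; exists C => w; rewrite normrM (le_trans _ (gC w))// ler_piMr//
    norm_cos_le1.
  - move=> s' b'.
    have coscos x : g x * cos (s * x + b) * cos (s' * x + b') =
        2^-1 * (g x * cos ((s + s') * x + (b + b'))) + 2^-1 * (g x * cos ((s - s') * x + (b - b'))).
      rewrite -mulrA mul_coscos (_ : s * x + b + (s' * x + b') = (s + s') * x + (b + b'));
        last by ring.
      by rewrite (_ : s * x + b - (s' * x + b') = (s - s') * x + (b - b')); last ring; ring.
    under eq_fun do rewrite coscos.
    under [in RHS]eq_fun do rewrite coscos.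
    rewrite intgP ?intgZ ?eg; [|exact: I1|exact: I1|by apply: L1Z; exact: I1].
    by rewrite intgP ?intgZ//; [exact: I2|exact: I2|apply: L1Z; exact: I2].
have mlt (j : 'I_1) a : multiplier V (fun x => (x < a)%R%:R).
  exact: (@multiplier_lt R R V (fun=> 1) (fun=> lexx 1) VP Vlim id a mcos).
have := @class_continuous R R V (fun=> 1) VP Vlim 1 (fun _ => id) V1 mlt
  (fun y => h (y 0 0)) K.
have -> : (fun x => h ((\row__ id x : 'rV[R]_1) 0 0)) = h by apply/funext => w; rewrite mxE.
case.
- move=> y; apply: (@continuous_comp _ _ _ (fun y : 'rV[R]_1 => y 0 0) h); last exact: hc.
  exact: coord_continuous.
- by move=> w y _; rewrite mulr1.
move=> _ _ /(_ 0 0).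
under eq_fun do rewrite mul0r addr0 cos0 mulr1.
by under [in X in _ = X -> _]eq_fun do rewrite mul0r addr0 cos0 mulr1.
Qed.

(** [gaussian_law] treats bounded functions only. The truncations min(|x|^k, n) all have expectation
    at most the normal moment M, and monotone convergence removes the truncation. *)
Lemma gaussian_moments k : L1 P (fun w => `|f w| ^+ k).
Proof.
have mfk : measurable_fun setT (fun w => `|f w| ^+ k).
  apply: measurable_funX; apply: measurableT_comp => //; exact: Lf.1.
pose M := intg N (fun x => `|sg * x| ^+ k).
have IM : L1 N (fun x => `|sg * x| ^+ k).
  under [X in L1 _ X]eq_fun do rewrite normrM exprMn.
  by apply: L1Z; exact: L1_normal_normX.
pose h n (x : R) := Num.min (`|x| ^+ k) n%:R.
have h0 n x : 0 <= h n x by rewrite le_min exprn_ge0/=.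
have hc n : continuous (h n).
  move=> x; apply: (@continuous_min _ R (fun x : R => `|x| ^+ k) (fun=> n%:R)).
    apply: (@continuous_comp _ _ _ (fun x : R => `|x|) (fun x => x ^+ k)).
      exact: norm_continuous.
    exact: exprn_continuous.
  exact: cvg_cst.
have hn n x : `|h n x| <= n%:R by rewrite ger0_norm// ge_min lexx orbT.
have mh n : measurable_fun setT (h n) by exact: continuous_measurable_fun.
have hM n : E (h n \o f) <= M.
  rewrite (gaussian_law (hc n) (hn n)); apply: le_intg => //.
    apply: (L1_le _ _ IM) => [|x]; first by apply: measurableT_comp => //; exact: measurable_funM.
    rewrite (ger0_norm (h0 _ _)) [leRHS]ger0_norm ?exprn_ge0//.
    by rewrite /h ge_min lexx.
  by move=> x; rewrite ge_min lexx.
apply/integrableP; split; first exact/measurable_EFinP.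
have Ihn n : L1 P (h n \o f).
  apply: (@L1_bounded _ _ _ _ _ n%:R) => [|w]; last exact: hn.
  exact: (measurableT_comp (mh n) Lf.1).
have nd_h w : nondecreasing_seq (fun n => (h n (f w))%:E).
  by move=> m n mn; rewrite lee_fin le_min2// ler_nat.
have mEh n : measurable_fun setT (EFin \o (h n \o f)).
  by apply/measurable_EFinP; exact: L1_measurable (Ihn n).
have Eh0 n w : setT w -> (0 <= (EFin \o (h n \o f)) w)%E by rewrite /= lee_fin.
have := @monotone_convergence _ _ _ P setT measurableT (fun n => EFin \o (h n \o f))
  mEh Eh0 (fun w _ => nd_h w).
under eq_integral => w _.
  rewrite (_ : limn _ = (`|f w| ^+ k)%:E); last first.
    apply/cvg_lim => //; apply: cvg_near_cst; near=> n.
    rewrite /= /h min_l//; near: n; exact: nbhs_infty_ger.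
  over.
move=> mono.
rewrite (_ : (\int[P]_x `|(EFin \o _) x|)%E = (\int[P]_x (`|f x| ^+ k)%:E)%E); last first.
  by apply: eq_integral => w _ /=; rewrite ger0_norm// exprn_ge0.
rewrite mono (le_lt_trans _ (ltry M))//; apply: lime_le.
  apply: ereal_nondecreasing_is_cvgn => m n mn; apply: ge0_le_integral => //.
  - by move=> w; exact: Eh0.
  - by move=> w _; exact: nd_h.
by apply: nearW => n; rewrite -EFin_intg// lee_fin.
Unshelve. all: by end_near. Qed.

End Moments.
End GaussianVariables.

(** * Integration by parts on Wiener space *)

Section LebesgueRestriction.
Variable R : realType.
Implicit Types (T : R) (f : R -> R).

Lemma leb_setT T : 0 <= T -> leb T setT = T%:E.
Proof.
move=> T0; rewrite [LHS](_ : _ = lebesgue_measure (setT `&` `[0, T])) // setTI.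
by rewrite lebesgue_measure_itv/= lte_fin; case: ltP => [_|T0']; rewrite ?sube0//; congr EFin; lra.
Qed.

Lemma leb_integrable_cst T (K : R) : 0 <= T -> L1 (leb T) (fun=> K).
Proof.
move=> T0; apply/integrableP; split; first exact/measurable_EFinP.
rewrite (_ : (\int[leb T]_x _)%E = (\int[leb T]_x (cst `|K|%:E x))%E)//.
by rewrite integral_cst// leb_setT// -EFinM ltry.
Qed.

Lemma leb_L1_bounded T f (K : R) : 0 <= T ->
  measurable_fun setT (f : measurableTypeR R -> R) ->
  (forall t, `|f t| <= K) -> L1 (leb T) f.
Proof.
move=> T0 mf fK; apply: (L1_le _ _ (leb_integrable_cst K T0)) => // w.
by rewrite (le_trans (fK w))//; exact: ler_norm.
Qed.

Lemma leb_intg_cst T (K : R) : 0 <= T -> intg (leb T) (fun=> K) = K * T.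
Proof.
by move=> T0; rewrite /intg Rintegral_cst// -[X in _ * X]/(fine (leb T setT)) leb_setT.
Qed.

Lemma leb_compl T : leb T (~` `[0, T]) = 0%E.
Proof. by rewrite [LHS](_ : _ = lebesgue_measure (~` `[0, T] `&` `[0, T]))// setICl measure0. Qed.

Lemma leb_integral T f : L1 (leb T) f ->
  (\int[leb T]_t (f t)%:E = \int[lebesgue_measure]_(t in `[0%R, T]) (f t)%:E)%E.
Proof.
move=> If; have mD : measurable (~` `[0, T] : set (measurableTypeR R)) by apply: measurableC;
  exact: measurable_itv.
rewrite (@negligible_integral _ _ _ (leb T) setT (~` `[0, T]))//; last exact: leb_compl.
rewrite setTD setCK; apply: eq_measure_integral => A mA AT.
by rewrite [LHS](_ : _ = lebesgue_measure (A `&` `[0, T]))// setIidl.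
Qed.

Lemma leb_FTC T f (F : R -> R) (K : R) : 0 < T ->
  measurable_fun setT (f : measurableTypeR R -> R) -> (forall t, `|f t| <= K) ->
  continuous f -> (forall t, is_derive t (1:R) F (f t)) ->
  intg (leb T) f = F T - F 0.
Proof.
move=> T0 mf fK fc dF; have If := leb_L1_bounded (ltW T0) mf fK.
have Fc : continuous F.
  by move=> t; apply/differentiable_continuous/derivable1_diffP; have [] := dF t.
apply: EFin_inj; rewrite EFin_intg// leb_integral//.
rewrite (@continuous_FTC2 _ f F)//; first exact: continuous_subspaceT.
  by split=> [t _||]; [have [] := dF t|exact: cvg_at_right_filter (Fc 0)|exact:
    cvg_at_left_filter (Fc T)].
by move=> t _; rewrite derive1E; have [_ ->] := dF t.
Qed.

(* Integrands precomposed with [clip01] satisfy on all of [R] the bounds that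
   they only need on [`[0, 1]]. *)
Definition clip01 (t : R) : R := Num.min (Num.max t 0) 1.

Lemma clip01_itv t : 0 <= clip01 t <= 1.
Proof. by rewrite /clip01 le_min le_max ge_min !lexx ler01 !orbT. Qed.

Lemma clip01_id t : 0 <= t <= 1 -> clip01 t = t.
Proof. by move=> /andP[t0 t1]; rewrite /clip01 max_l// min_l. Qed.

Lemma measurable_clip01 : measurable_fun setT (clip01 : measurableTypeR R -> measurableTypeR R).
Proof.
apply: measurable_minr; last exact: measurable_cst.
by apply: measurable_maxr; [exact: measurable_id|exact: measurable_cst].
Qed.

Lemma leb_FTC_clip (f F : R -> R) (K : R) :
  continuous f -> (forall t, `|f t| <= K) -> (forall t, is_derive t (1:R) F (f t)) ->
  intg (leb 1) (fun t => f (clip01 t)) = F 1 - F 0.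
Proof.
move=> fc fK dF.
have mf : measurable_fun setT (f : measurableTypeR R -> R) by exact: continuous_measurable_fun.
rewrite -(leb_FTC ltr01 mf fK fc dF).
have mfc : measurable_fun setT (fun t : measurableTypeR R => f (clip01 t)).
  exact: (measurableT_comp mf measurable_clip01).
apply: eq_intg_ae => //.
have mD : measurable (~` `[0, 1] : set (measurableTypeR R)) by apply: measurableC;
  exact: measurable_itv.
exists (~` `[0, 1]); split => //; first exact: leb_compl.
apply: subsetC => t; rewrite /= in_itv/= => t01.
by rewrite clip01_id.
Qed.

End LebesgueRestriction.

(** * Variables with all moments *)

Section Moments.
Context (R : realType) d (Omega : measurableType d) (P : probability Omega R).
Implicit Types X Y : Omega -> R.

(** Unlike a single L^p, these variables form an algebra, so integrability of products needs no
    tracking of exponents. *)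
Definition moments X := measurable_fun setT X /\ forall k, L1 P (fun w => `|X w| ^+ k).

Lemma moments_le X Y : measurable_fun setT X -> (forall w, `|X w| <= `|Y w|) ->
  moments Y -> moments X.
Proof.
move=> mX XY [mY mk]; split=> // k; apply: (L1_le _ _ (mk k)).
  by apply: measurable_funX; exact: measurableT_comp.
by move=> w; rewrite !normrX !normr_id lerXn2r ?nnegrE.
Qed.

Lemma moments_cst c : moments (fun=> c).
Proof. by split=> // k; exact: finite_measure_integrable_cst. Qed.

Lemma moments_norm X : moments X -> moments (fun w => `|X w|).
Proof.
move=> mX; apply: (moments_le _ _ mX) => [|w]; last by rewrite normr_id.
by apply: measurableT_comp => //; exact: mX.1.
Qed.

Lemma momentsM X Y : moments X -> moments Y -> moments (fun w => X w * Y w).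
Proof.
move=> [mX kX] [mY kY]; split=> [|k]; first exact: measurable_funM.
apply: (L1_le _ _ (L1D (kX (k * 2)%N) (kY (k * 2)%N))) => [|w].
  by apply: measurable_funX; apply: measurableT_comp => //; exact: measurable_funM.
rewrite [leLHS]ger0_norm ?exprn_ge0// [leRHS]ger0_norm ?addr_ge0 ?exprn_ge0//.
rewrite normrM exprMn !exprM; set a := _ ^+ k; set b := _ ^+ k.
have : 0 <= a ^+ 2 by exact: sqr_ge0.
have : 0 <= b ^+ 2 by exact: sqr_ge0.
by have := sqr_ge0 (a - b); rewrite !expr2; nra.
Qed.

Lemma momentsD X Y : moments X -> moments Y -> moments (fun w => X w + Y w).
Proof.
move=> [mX kX] [mY kY]; split=> [|k]; first exact: measurable_funD.
apply: (L1_le _ _ (L1Z (2 ^+ k) (L1D (kX k) (kY k)))) => [|w].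
  by apply: measurable_funX; apply: measurableT_comp => //; exact: measurable_funD.
rewrite [leLHS]ger0_norm ?exprn_ge0// [leRHS]ger0_norm; last first.
  by rewrite mulr_ge0 ?exprn_ge0 ?addr_ge0 ?exprn_ge0.
have h (a b : R) : 0 <= a -> a <= b -> (a + b) ^+ k <= 2 ^+ k * (a ^+ k + b ^+ k).
  move=> a0 ab; have b0 := le_trans a0 ab.
  apply: (@le_trans _ _ ((2 * b) ^+ k)).
    by rewrite lerXn2r ?nnegrE ?addr_ge0 ?mulr_ge0//; lra.
  by rewrite exprMn ler_wpM2l ?exprn_ge0// lerDr exprn_ge0.
apply: (@le_trans _ _ ((`|X w| + `|Y w|) ^+ k)).
  by rewrite lerXn2r ?nnegrE ?addr_ge0// ler_normD.
have /orP[l|l] := le_total `|X w| `|Y w|; first exact: h.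
by rewrite addrC [X in _ <= _ * X]addrC; exact: h.
Qed.

Lemma momentsX X k : moments X -> moments (fun w => X w ^+ k).
Proof.
move=> mX; elim: k => [|k IH]; first exact: moments_cst.
by have := momentsM mX IH; congr moments; apply/funext => w; rewrite exprS.
Qed.

Lemma moments_sum (I : Type) (s : seq I) (F : I -> Omega -> R) :
  (forall i, moments (F i)) -> moments (fun w => \sum_(i <- s) F i w).
Proof.
move=> mF; elim: s => [|i s IH].
  by have := moments_cst 0; congr moments; apply/funext => w; rewrite big_nil.
by have := momentsD (mF i) IH; congr moments; apply/funext => w; rewrite big_cons.
Qed.

Lemma moments_L1 X : moments X -> L1 P X.
Proof.
move=> [mX kX]; apply: (L1_le _ _ (kX 1%N)) => // w.
by rewrite expr1 normr_id.
Qed.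

Lemma moments_bounded X K : measurable_fun setT X -> (forall w, `|X w| <= K) -> moments X.
Proof.
move=> mX XK; apply: (moments_le mX _ (moments_cst K)) => w.
by rewrite (le_trans (XK w))//; exact: ler_norm.
Qed.

End Moments.

(** * Trigonometric integration by parts in a Gaussian space *)

Section GaussianSpace.
Context (R : realType) d (Omega : measurableType d) (P : probability Omega R).
Variable GS : (Omega -> R) -> Prop.
Hypothesis GS_P : forall (a : R) X Y, GS X -> GS Y -> GS (fun w => a * X w + Y w).
Hypothesis GS_L2 : forall X, GS X -> L2 P X.
Hypothesis GS_gaussian : forall X, GS X -> gaussian P X.
Local Notation E := (intg P).
Implicit Types (X Y : Omega -> R) (b : R).

Lemma GS_ibp X Y b : GS X -> GS Y ->
  E (fun w => Y w * cos (X w + b)) = - E (fun w => X w * Y w) * E (fun w => sin (X w + b)).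
Proof.
move=> gX gY; apply: gaussian_ibp => [||s]; [exact: GS_L2|exact: GS_L2|].
by apply: GS_gaussian; exact: GS_P.
Qed.

Lemma GS0 X : GS X -> GS (fun=> 0).
Proof.
move=> gX; have := GS_P (-1) gX gX; congr GS; apply/funext => w; ring.
Qed.

Lemma GS_moments X : GS X -> moments P X.
Proof.
move=> gX; split; first exact: (GS_L2 gX).1.
move=> k; apply: gaussian_moments => [|s]; first exact: GS_L2.
apply: GS_gaussian; have := GS_P s gX (GS0 gX); congr GS.
by apply/funext => w; rewrite addr0.
Qed.

Lemma GS_sum (n : nat) (a : 'I_n -> R) (Z : 'I_n -> Omega -> R) : GS (fun=> 0) ->
  (forall j, GS (Z j)) -> GS (fun w => \sum_j a j * Z j w).
Proof.
move=> g0 gZ; elim: (index_enum _) => [|i s IH].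
  by move: g0; congr GS; apply/funext => w; rewrite big_nil.
by have := GS_P (a i) (gZ i) IH; congr GS; apply/funext => w; rewrite big_cons.
Qed.

Section IntegrationByParts.
Variables (Y X0 : Omega -> R) (b0 : R).
Hypotheses (gY : GS Y) (gX0 : GS X0).
Let k0 := E (fun w => X0 w * Y w).
Let Gc w := cos (X0 w + b0).

(* The divergence of [cos (X0 + b0)] in the direction dual to [Y]: integrating a
   smooth functional against it is integrating [cos (X0 + b0)] times the
   derivative of the functional in that direction. *)
Definition skorokhod w := Gc w * Y w + k0 * sin (X0 w + b0).

Let mgs X : GS X -> measurable_fun setT X. Proof. by move=> gX; exact: (GS_L2 gX).1. Qed.

Let mcos X b : measurable_fun setT X -> measurable_fun setT (fun w => cos (X w + b)).
Proof. by move=> mX; exact: L1_measurable (L1_cos P b mX). Qed.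

Let msin X b : measurable_fun setT X -> measurable_fun setT (fun w => sin (X w + b)).
Proof.
move=> mX; have := mcos (b - pi / 2) mX; congr measurable_fun.
by apply/funext => w; rewrite addrA cosBpihalf.
Qed.

Let mb_cos X b : measurable_fun setT X -> moments P (fun w => cos (X w + b)).
Proof. move=> mX; apply: (@moments_bounded _ _ _ _ _ 1) => [|w];
  [exact: mcos|exact: norm_cos_le1]. Qed.

Let mb_sin X b : measurable_fun setT X -> moments P (fun w => sin (X w + b)).
Proof. move=> mX; apply: (@moments_bounded _ _ _ _ _ 1) => [|w];
  [exact: msin|exact: norm_sin_le1]. Qed.

Lemma moments_skorokhod : moments P skorokhod.
Proof.
apply: momentsD; apply: momentsM.
- by apply: mb_cos; exact: mgs.
- exact: GS_moments.
- exact: moments_cst.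
- by apply: mb_sin; exact: mgs.
Qed.

(** Products of cosines reduce the part with [Y] to [GS_ibp] for X + X0 and X - X0. There the
    covariance with Y splits as E[X Y] + k0 and E[X Y] - k0; the k0 terms cancel against the sine
    term of [skorokhod]. *)
Lemma trig_ibp X b : GS X ->
  E (fun w => cos (X w + b) * skorokhod w) =
  - E (fun w => X w * Y w) * E (fun w => sin (X w + b) * Gc w).
Proof.
move=> gX.
have mX := mgs gX; have mX0 := mgs gX0.
pose A := fun w => 1 * X w + X0 w; pose B := fun w => -1 * X0 w + X w.
have gA : GS A by exact: GS_P.
have gB : GS B by exact: GS_P.
have e1 w : cos (X w + b) * skorokhod w =
  2^-1 * (Y w * cos (A w + (b + b0))) + (2^-1 * (Y w * cos (B w + (b - b0)))
   + k0 * (cos (X w + b) * sin (X0 w + b0))).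
  rewrite /skorokhod /Gc mulrDr mulrA mul_coscos /A /B.
  rewrite (_ : 1 * X w + X0 w + (b + b0) = X w + b + (X0 w + b0)); last by ring.
  rewrite (_ : -1 * X0 w + X w + (b - b0) = X w + b - (X0 w + b0)); last by ring.
  ring.
under eq_fun do rewrite e1.
have i1 : L1 P (fun w => Y w * cos (A w + (b + b0))).
  by apply: moments_L1; apply: momentsM; [exact: GS_moments|apply: mb_cos; exact: mgs].
have i2 : L1 P (fun w => Y w * cos (B w + (b - b0))).
  by apply: moments_L1; apply: momentsM; [exact: GS_moments|apply: mb_cos; exact: mgs].
have i3 : L1 P (fun w => cos (X w + b) * sin (X0 w + b0)).
  by apply: moments_L1; apply: momentsM; [exact: mb_cos|exact: mb_sin].
have i4 : L1 P (fun w => sin (X w + b) * Gc w).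
  by apply: moments_L1; apply: momentsM; [exact: mb_sin|exact: mb_cos].
have i5 X' X'' : GS X' -> GS X'' -> L1 P (fun w => X' w * X'' w).
  by move=> g' g''; apply: moments_L1; apply: momentsM; exact: GS_moments.
rewrite intgP//; last by apply: L1D; exact: L1Z.
rewrite intgP// ?intgZ//; last exact: L1Z.
rewrite (GS_ibp (b + b0) gA gY) (GS_ibp (b - b0) gB gY).
have -> : E (fun w => A w * Y w) = E (fun w => X w * Y w) + k0.
  by rewrite /k0 -intgD; [congr intg; apply/funext => w; rewrite /A; ring|exact: i5|exact: i5].
have -> : E (fun w => B w * Y w) = E (fun w => X w * Y w) - k0.
  by rewrite /k0 -intgB; [congr intg; apply/funext => w; rewrite /B; ring|exact: i5|exact: i5].
have -> : E (fun w => sin (A w + (b + b0))) = E (fun w => sin (X w + b) * Gc w) + E (fun w =>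
  cos (X w + b) * sin (X0 w + b0)).
  rewrite -intgD//; congr intg; apply/funext => w.
  by rewrite /A (_ : 1 * X w + X0 w + (b + b0) = X w + b + (X0 w + b0)) ?sinD//; ring.
have -> : E (fun w => sin (B w + (b - b0))) = E (fun w => sin (X w + b) * Gc w) - E (fun w =>
  cos (X w + b) * sin (X0 w + b0)).
  rewrite -intgB//; congr intg; apply/funext => w.
  by rewrite /B (_ : -1 * X0 w + X w + (b - b0) = X w + b - (X0 w + b0)) ?sinB//; ring.
by field.
Qed.

End IntegrationByParts.
End GaussianSpace.

Lemma measurable_cos_comp (R : realType) d (Omega : measurableType d) (X : Omega -> R) :
  measurable_fun setT X -> measurable_fun setT (fun w => cos (X w)).
Proof.
by move=> mX; apply: (@measurableT_comp _ _ _ _ _ _ (@cos R)) => //;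
  apply: continuous_measurable_fun; exact: continuous_cos.
Qed.

(** * Integration by parts along a segment *)

Section C1IntegrationByParts.
Context (R : realType) d (Omega : measurableType d) (P : probability Omega R).
Variable GS : (Omega -> R) -> Prop.
Hypothesis GS_P : forall (a : R) X Y, GS X -> GS Y -> GS (fun w => a * X w + Y w).
Hypothesis GS_L2 : forall X, GS X -> L2 P X.
Hypothesis GS_gaussian : forall X, GS X -> gaussian P X.
Local Notation E := (intg P).
Variables (n : nat) (Z : 'I_n -> Omega -> R) (Y X0 : Omega -> R) (b0 : R).
Hypotheses (gZ : forall j, GS (Z j)) (gY : GS Y) (gX0 : GS X0).
Let c j := E (fun w => Z j w * Y w).
Let Gc w := cos (X0 w + b0).
Let xi := skorokhod P Y X0 b0.
(** The Cameron-Martin shift in the direction dual to [Y]: it translates [Z j] by s times the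
    covariance of [Z j] with [Y], so the derivative of f(Zs) at s = 0 is the sum of c_j times the
    j-th partial derivative of f. *)
Let Zs (s : R) (w : Omega) : 'rV[R]_n := \row_j (Z j w + s * c j).
Let g0 : GS (fun=> 0) := GS0 GS_P gY.
Let mgs X : GS X -> measurable_fun setT X. Proof. by move=> gX; exact: (GS_L2 gX).1. Qed.
Let mom X : GS X -> moments P X := GS_moments GS_P GS_L2 GS_gaussian (X := X).
Let mxi : moments P xi := moments_skorokhod GS_P GS_L2 GS_gaussian b0 gY gX0.
Let mGc : moments P Gc.
Proof.
apply: (@moments_bounded _ _ _ _ _ 1) => [|w]; last exact: norm_cos_le1.
by apply: measurable_cos_comp; apply: measurable_funD => //; exact: mgs.
Qed.

Section Class.
Variable m : nat.
Let G (x : 'rV[R]_n) : R := (1 + \sum_j `|x 0 j|) ^+ m.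
Let D (w : Omega) : R := (1 + \sum_j (`|Z j w| + `|c j|)) ^+ m.

Let G_ge1 x : 1 <= G x.
Proof. by rewrite /G exprn_ege1// lerDl sumr_ge0. Qed.

Lemma moments_envelope : moments P D.
Proof.
apply: momentsX; apply: momentsD; first exact: moments_cst.
apply: moments_sum => j; apply: momentsD; last exact: moments_cst.
by apply: moments_norm; exact: mom.
Qed.

Lemma envelope_le s w : 0 <= s <= 1 -> G (Zs s w) <= D w.
Proof.
move=> /andP[s0 s1]; rewrite /G /D lerXn2r ?nnegrE ?addr_ge0 ?sumr_ge0//.
rewrite lerD2l; apply: ler_sum => j _; rewrite mxE (le_trans (ler_normD _ _))//.
by rewrite lerD2l normrM ger0_norm// ler_piMl.
Qed.

Variable eps : R.
Hypothesis eps01 : 0 <= eps <= 1.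

(** Rescaling [0, eps] to [0, 1] turns the integral along the segment into eps times an average, and
    that average converges as eps tends to 0. *)
Let sc t := eps * clip01 t.
Let sc01 t : 0 <= sc t <= 1.
Proof.
have /andP[c0 c1] := clip01_itv t; have /andP[e0 e1] := eps01.
by rewrite /sc mulr_ge0//= mulr_ile1.
Qed.

(** The twist by an arbitrary cosine makes the class below stable under multiplication by cosines of
    coordinates. *)
Let tw (psi : 'rV[R]_n -> R) (a : 'I_n -> R) (b : R) (x : 'rV[R]_n) :=
  psi x * cos (\sum_j a j * x 0 j + b).

(* The integration by parts formula along the segment from [Z] to [Z + eps c],
   integrated so that it mentions no derivative of [psi]: this form holds for
   trigonometric [psi] and survives dominated limits, hence holds for all
   continuous [psi] of polynomial growth. *)
Let V (psi : 'rV[R]_n -> R) := [/\ forall s, measurable_fun setT (fun w => psi (Zs s w)),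
  exists C : R, forall x, `|psi x| <= C * G x &
  forall a b,
   measurable_fun setT (fun t : measurableTypeR R => E (fun w =>
     tw psi a b (Zs (sc t) w) * xi w)) /\
   E (fun w => tw psi a b (Zs eps w) * Gc w) - E (fun w => tw psi a b (Zs 0 w) * Gc w) =
    eps * intg (leb 1) (fun t => E (fun w => tw psi a b (Zs (sc t) w) * xi w))].

Let lin a s w : \sum_j a j * Zs s w 0 j = \sum_j a j * Z j w + s * \sum_j a j * c j.
Proof. by rewrite mulr_sumr -big_split; apply: eq_bigr => j _; rewrite mxE /=; ring. Qed.

Let mtw (psi : 'rV[R]_n -> R) a b s : (forall s, measurable_fun setT (fun w => psi (Zs s w))) ->
  measurable_fun setT (fun w => tw psi a b (Zs s w)).
Proof.
move=> mpsi; apply: measurable_funM => //; apply: measurable_cos_comp.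
under eq_fun do rewrite lin.
apply: measurable_funD => //; apply: measurable_funD => //.
by apply: mgs; exact: GS_sum.
Qed.

Let tw_le (psi : 'rV[R]_n -> R) a b (C : R) x : (forall x, `|psi x| <= C * G x) -> `|tw psi a b
  x| <= C * G x.
Proof.
by move=> pC; rewrite normrM (le_trans _ (pC x))// ler_piMr// norm_cos_le1.
Qed.

Let twC (psi : 'rV[R]_n -> R) a b (C : R) s w : (forall x, `|psi x| <= C * G x) -> 0 <= s <= 1 ->
  `|tw psi a b (Zs s w)| <= C * D w.
Proof.
move=> pC s01; rewrite (le_trans (tw_le a b (Zs s w) pC))//.
have C0 : 0 <= C.
  have := le_trans (normr_ge0 _) (pC 0); rewrite pmulr_lge0//.
  by rewrite (lt_le_trans ltr01).
by apply: ler_wpM2l => //; exact: envelope_le.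
Qed.

Let twM (psi : 'rV[R]_n -> R) a b (C : R) s (X : Omega -> R) : (forall s, measurable_fun setT
  (fun w => psi (Zs s w))) ->
  (forall x, `|psi x| <= C * G x) -> 0 <= s <= 1 -> moments P X ->
  moments P (fun w => tw psi a b (Zs s w) * X w).
Proof.
move=> mpsi pC s01 mX; apply: momentsM => //.
apply: (moments_le _ _ (momentsM (moments_cst P C) moments_envelope)); first exact: mtw.
by move=> w; rewrite (le_trans (twC a b w pC s01))//; exact: ler_norm.
Qed.

Let K (X : Omega -> R) := E (fun w => D w * `|X w|).

Let tw_bound (psi : 'rV[R]_n -> R) a b (C : R) s X : (forall s, measurable_fun setT (fun w =>
  psi (Zs s w))) ->
  (forall x, `|psi x| <= C * G x) -> 0 <= s <= 1 -> moments P X ->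
  `|E (fun w => tw psi a b (Zs s w) * X w)| <= C * K X.
Proof.
move=> mpsi pC s01 mX; have i1 := moments_L1 (twM a b mpsi pC s01 mX).
have i2 : L1 P (fun w => D w * `|X w|).
  by apply: moments_L1; apply: momentsM; [exact: moments_envelope|exact: moments_norm].
rewrite (le_trans (norm_intg i1))// /K -intgZ//; apply: le_intg.
- exact: L1_norm.
- exact: L1Z.
- by move=> w; rewrite normrM mulrA ler_wpM2r//; exact: twC.
Qed.

Let V_P (r : R) (f g : 'rV[R]_n -> R) : V f -> V g -> V (fun x => r * f x + g x).
Proof.
move=> [mf [C fC] ef] [mg [C' gC] eg]; split.
- by move=> s; apply: measurable_funD => //; exact: measurable_funM.
- exists (`|r| * C + C') => x; rewrite (le_trans (ler_normD _ _))// normrM mulrDl lerD//.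
  by rewrite -mulrA ler_wpM2l.
move=> a b.
have e X s : 0 <= s <= 1 -> moments P X -> E (fun w => tw (fun x =>
  r * f x + g x) a b (Zs s w) * X w) =
    r * E (fun w => tw f a b (Zs s w) * X w) + E (fun w => tw g a b (Zs s w) * X w).
  move=> s01 mX; rewrite -intgP; first by congr intg; apply/funext => w; rewrite /tw; ring.
    exact: moments_L1 (twM _ _ mf fC s01 mX).
  exact: moments_L1 (twM _ _ mg gC s01 mX).
have [mf' ef'] := ef a b; have [mg' eg'] := eg a b.
have e' : (fun t => E (fun w => tw (fun x => r * f x + g x) a b (Zs (sc t) w) * xi w)) =
   (fun t => r * E (fun w => tw f a b (Zs (sc t) w) * xi w) + E (fun w =>
     tw g a b (Zs (sc t) w) * xi w)).
  by apply/funext => t; exact: e.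
rewrite e'; split.
  by apply: measurable_funD => //; exact: measurable_funM.
rewrite intgP; last 2 first.
- by apply: (@leb_L1_bounded _ _ _ (C * K xi)) => // t; exact: tw_bound.
- by apply: (@leb_L1_bounded _ _ _ (C' * K xi)) => // t; exact: tw_bound.
rewrite mulrDr mulrCA -ef' -eg' !e// ?lexx ?ler01//; ring.
Qed.

Let V_lim (f_ : nat -> 'rV[R]_n -> R) (f : 'rV[R]_n -> R) (C : R) :
  (forall k, V (f_ k)) -> (forall k x, `|f_ k x| <= C * G x) ->
  (forall x, f_ k x @[k --> \oo] --> f x) -> V f.
Proof.
move=> Vf fC ff.
have mf_ k s : measurable_fun setT (fun w => f_ k (Zs s w)) by have [] := Vf k.
have fC' x : `|f x| <= C * G x.
  by apply: (cvgr_to_le (cvg_norm (ff x))); apply: nearW => k; exact: fC.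
have mf s : measurable_fun setT (fun w => f (Zs s w)).
  by apply: (@measurable_fun_cvg _ _ _ _ (fun k w => f_ k (Zs s w))) => // w _; exact: ff.
split => //; first by exists C.
move=> a b.
have cv s X : 0 <= s <= 1 -> moments P X -> E (fun w =>
  tw (f_ k) a b (Zs s w) * X w) @[k --> \oo] -->
    E (fun w => tw f a b (Zs s w) * X w).
  move=> s01 mX.
  have i2 : L1 P (fun w => C * D w * `|X w|).
    apply: moments_L1; apply: momentsM; last exact: moments_norm.
    by apply: momentsM; [exact: moments_cst|exact: moments_envelope].
  have m1 k : measurable_fun setT (fun w => tw (f_ k) a b (Zs s w) * X w).
    exact: (twM a b (mf_ k) (fC k) s01 mX).1.
  have h1 k w : `|tw (f_ k) a b (Zs s w) * X w| <= C * D w * `|X w|.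
    by rewrite normrM ler_wpM2r//; exact: twC.
  have h2 w : tw (f_ k) a b (Zs s w) * X w @[k --> \oo] --> tw f a b (Zs s w) * X w.
    by apply: cvgMl; apply: cvgMl; exact: ff.
  by have [] := intg_dct m1 i2 h1 h2.
split.
  apply: (@measurable_fun_cvg _ _ _ _ (fun k (t : measurableTypeR R) => E (fun w =>
    tw (f_ k) a b (Zs (sc t) w) * xi w))) => [k|t _].
    by have [_ _ /(_ a b)[]] := Vf k.
  exact: cv.
have l1 : E (fun w => tw (f_ k) a b (Zs eps w) * Gc w) - E (fun w => tw (f_ k) a b (Zs 0 w) * Gc w)
    @[k --> \oo] --> E (fun w => tw f a b (Zs eps w) * Gc w) - E (fun w =>
      tw f a b (Zs 0 w) * Gc w).
  by apply: cvgB; [exact: cv|apply: cv => //; rewrite lexx ler01].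
have mt k : measurable_fun setT (fun t : measurableTypeR R => E (fun w =>
  tw (f_ k) a b (Zs (sc t) w) * xi w)).
  by have [_ _ /(_ a b)[]] := Vf k.
have h1 k t : `|E (fun w => tw (f_ k) a b (Zs (sc t) w) * xi w)| <= C * K xi.
  exact: tw_bound.
have h2 t : E (fun w => tw (f_ k) a b (Zs (sc t) w) * xi w) @[k --> \oo] -->
    E (fun w => tw f a b (Zs (sc t) w) * xi w) by exact: cv.
have [_ l2] := intg_dct mt (leb_integrable_cst (C * K xi) ler01) h1 h2.
have l3 : eps * intg (leb 1) (fun t => E (fun w =>
  tw (f_ k) a b (Zs (sc t) w) * xi w)) @[k --> \oo] -->
    eps * intg (leb 1) (fun t => E (fun w => tw f a b (Zs (sc t) w) * xi w)) by apply: cvgMr;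
      exact: l2.
have e k : E (fun w => tw (f_ k) a b (Zs eps w) * Gc w) - E (fun w =>
  tw (f_ k) a b (Zs 0 w) * Gc w) =
    eps * intg (leb 1) (fun t => E (fun w => tw (f_ k) a b (Zs (sc t) w) * xi w)).
  by have [_ _ /(_ a b)[]] := Vf k.
move: l1; under eq_fun do rewrite e.
by move=> l1; rewrite -(cvg_lim _ l1)// (cvg_lim _ l3).
Qed.

(** With A the linear combination of the Z j and k = E[A Y], the shift by s replaces A by A + s k.
    Addition formulas make both sides explicit in s, with two constants C and S, and [trig_ibp] says
    that one is the derivative of the other. *)
Let V_1 : V (fun=> 1).
Proof.
have p1 x : `|1 : R| <= 1 * G x by rewrite normr1 mul1r.
split => //; first by exists 1.
move=> a b; pose A w := \sum_j a j * Z j w; pose k := \sum_j a j * c j.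
have gA : GS A by exact: GS_sum.
have kE : E (fun w => A w * Y w) = k.
  rewrite /k /A; under eq_fun do rewrite mulr_suml.
  rewrite intg_sum => [|j]; last first.
    have := L1Z (a j) (moments_L1 (momentsM (mom (gZ j)) (mom gY))); congr L1.
    by apply/funext => w; rewrite mulrA.
  apply: eq_bigr => j _; rewrite /c -intgZ; last exact: moments_L1 (momentsM (mom (gZ j)) (mom gY)).
  by congr intg; apply/funext => w; rewrite mulrA.
have twE s : tw (fun=> 1) a b \o Zs s = fun w => cos (A w + (s * k + b)).
  by apply/funext => w; rewrite /= /tw mul1r lin /A addrA.
pose C := E (fun w => cos (A w + b) * Gc w); pose S := E (fun w => sin (A w + b) * Gc w).
have iC : L1 P (fun w => cos (A w + b) * Gc w).
  apply: moments_L1; apply: momentsM => //.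
  apply: (@moments_bounded _ _ _ _ _ 1) => [|w]; last exact: norm_cos_le1.
  by apply: measurable_cos_comp; apply: measurable_funD => //; exact: mgs.
have iS : L1 P (fun w => sin (A w + b) * Gc w).
  apply: moments_L1; apply: momentsM => //.
  apply: (@moments_bounded _ _ _ _ _ 1) => [|w]; last exact: norm_sin_le1.
  under eq_fun do rewrite -cosBpihalf.
  by apply: measurable_cos_comp; apply: measurable_funD => //; apply: measurable_funD => //;
    exact: mgs.
have EC s : E (fun w => tw (fun=> 1) a b (Zs s w) * Gc w) = cos (s * k) * C - sin (s * k) * S.
  rewrite -!intgZ// -intgB; [|exact: L1Z|exact: L1Z].
  congr intg; apply/funext => w; rewrite [tw _ _ _ _](congr1 (@^~ w) (twE s)).
  rewrite (_ : A w + (s * k + b) = s * k + (A w + b)) ?cosD; ring.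
have ES s : E (fun w => tw (fun=> 1) a b (Zs s w) * xi w) = - k * (sin (s * k) * C + cos (s * k)
  * S).
  under eq_fun => w do rewrite [tw _ _ _ _](congr1 (@^~ w) (twE s)).
  rewrite (trig_ibp GS_P GS_L2 GS_gaussian b0 gY gX0 (s * k + b) gA) kE; congr (_ * _).
  rewrite -!intgZ// -intgD; [|exact: L1Z|exact: L1Z].
  congr intg; apply/funext => w.
  rewrite (_ : A w + (s * k + b) = s * k + (A w + b)) ?sinD; rewrite ?/Gc; ring.
pose f t := - k * (sin (eps * t * k) * C + cos (eps * t * k) * S).
pose F t := cos (eps * t * k) * C - sin (eps * t * k) * S.
have dF t : is_derive t (1:R) F (eps * f t).
  by apply: is_derive_eq; rewrite /GRing.scale/= /f; ring.
have fE t : E (fun w => tw (fun=> 1) a b (Zs (sc t) w) * xi w) = f (clip01 t) by rewrite ES.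
under eq_fun do rewrite fE.
have cf : continuous f.
  move=> t; apply/differentiable_continuous/derivable1_diffP; apply: ex_derive.
have mf : measurable_fun setT (f : measurableTypeR R -> R) by exact: continuous_measurable_fun.
have mfc : measurable_fun setT (fun t : measurableTypeR R => f (clip01 t)).
  exact: (measurableT_comp mf (@measurable_clip01 R)).
split=> //.
have fK t : `|f t| <= `|k| * (`|C| + `|S|).
  rewrite normrM normrN ler_wpM2l// (le_trans (ler_normD _ _))// !normrM.
  by rewrite lerD// ler_piMl// ?norm_cos_le1 ?norm_sin_le1.
rewrite -intgZ; last first.
  apply: (leb_L1_bounded _ mfc) => // t; exact: fK.
rewrite (@leb_FTC_clip _ (fun t => eps * f t) F (`|eps| * (`|k| * (`|C| + `|S|)))) => //;
  last 2 first.
- by move=> t; apply: cvgMr; exact: cf.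
- by move=> t; rewrite normrM ler_wpM2l.
by rewrite !EC /F mulr1 mulr0 !mul0r.
Qed.

(** Multiplying a twist with frequency vector a by this cosine gives half the sum of the twists with
    vectors s e_j + a and s e_j - a. *)
Let V_cos j s b : multiplier V (fun x : 'rV[R]_n => cos (s * x 0 j + b)).
Proof.
split; first by exists 1 => x; exact: norm_cos_le1.
move=> f [Vf _]; have [mf [C fC] ef] := Vf; split.
- move=> t; apply: measurable_funM => //; apply: measurable_cos_comp.
  by under eq_fun do rewrite mxE; apply: measurable_funD => //; apply: measurable_funM => //;
    apply: measurable_funD => //; exact: mgs.
- by exists C => x; rewrite normrM (le_trans _ (fC x))// ler_piMr// norm_cos_le1.
move=> a b'.
pose a1 i := s * (i == j)%:R + a i; pose a2 i := s * (i == j)%:R - a i.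
have tE x : tw (fun x => f x * cos (s * x 0 j + b)) a b' x =
   2^-1 * tw f a1 (b + b') x + 2^-1 * tw f a2 (b - b') x.
  have e1 : \sum_i s * (i == j)%:R * x 0 i = s * x 0 j.
    rewrite (bigD1 j)//= eqxx mulr1 big1 ?addr0// => i /negbTE->.
    by rewrite mulr0 mul0r.
  have -> : tw f a1 (b + b') x = f x * cos (s * x 0 j + b + (\sum_i a i * x 0 i + b')).
    rewrite /tw; congr (_ * cos _); rewrite -e1.
    by under eq_bigr do rewrite mulrDl; rewrite big_split/=; ring.
  have -> : tw f a2 (b - b') x = f x * cos (s * x 0 j + b - (\sum_i a i * x 0 i + b')).
    rewrite /tw; congr (_ * cos _); rewrite -e1.
    by under eq_bigr do rewrite mulrBl; rewrite sumrB/=; ring.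
  by rewrite /tw -mulrA mul_coscos; ring.
have e X s' : 0 <= s' <= 1 -> moments P X -> E (fun w => tw (fun x =>
  f x * cos (s * x 0 j + b)) a b' (Zs s' w) * X w) =
    2^-1 * E (fun w => tw f a1 (b + b') (Zs s' w) * X w) + 2^-1 * E (fun w =>
      tw f a2 (b - b') (Zs s' w) * X w).
  move=> s01 mX; have i1 a' b1 := moments_L1 (twM a' b1 mf fC s01 mX).
  transitivity (E (fun w => 2^-1 * (tw f a1 (b + b') (Zs s' w) * X w) + 2^-1 * (tw f a2 (b - b')
    (Zs s' w) * X w))).
    by congr intg; apply/funext => w; rewrite tE; ring.
  by rewrite intgP ?intgZ//; exact: L1Z.
have [mf1 ef1] := ef a1 (b + b'); have [mf2 ef2] := ef a2 (b - b').
have e' : (fun t => E (fun w => tw (fun x => f x * cos (s * x 0 j + b)) a b' (Zs (sc t) w) * xi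
  w)) =
   (fun t => 2^-1 * E (fun w => tw f a1 (b + b') (Zs (sc t) w) * xi w) + 2^-1 * E (fun w =>
     tw f a2 (b - b') (Zs (sc t) w) * xi w)).
  by apply/funext => t; exact: e.
rewrite e'; split.
  by apply: measurable_funD => //; exact: measurable_funM.
have i1 a' b1 : measurable_fun setT (fun t : measurableTypeR R => E (fun w =>
  tw f a' b1 (Zs (sc t) w) * xi w)) ->
   L1 (leb 1) (fun t => E (fun w => tw f a' b1 (Zs (sc t) w) * xi w)).
  by move=> mt; apply: (@leb_L1_bounded _ _ _ (C * K xi)) => // t; exact: tw_bound.
rewrite intgP ?intgZ; [|exact: i1|exact: i1|by apply: L1Z; exact: i1].
rewrite mulrDr ![eps * (_ * _)]mulrCA -ef1 -ef2 !e// ?lexx ?ler01//; ring.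
Qed.

Lemma continuous_ibp_integral (f : 'rV[R]_n -> R) (C : R) : continuous f ->
  (forall x, `|f x| <= C * (1 + \sum_j `|x 0 j|) ^+ m) ->
  [/\ forall s, measurable_fun setT (fun w => f (Zs s w)),
     measurable_fun setT (fun t : measurableTypeR R => E (fun w => f (Zs (sc t) w) * xi w)) &
     E (fun w => f (Zs eps w) * Gc w) - E (fun w => f (Zs 0 w) * Gc w) =
    eps * intg (leb 1) (fun t => E (fun w => f (Zs (sc t) w) * xi w))].
Proof.
move=> cf fC.
have Vlt j (a : R) : multiplier V (fun x => (x 0 j < a)%R%:R).
  apply: (@multiplier_lt R 'rV[R]_n V G G_ge1 V_P V_lim (fun x : 'rV[R]_n => x 0 j) a) => s b.
  exact: V_cos.
have C0 : 0 <= C.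
  have := le_trans (normr_ge0 _) (fC 0); rewrite pmulr_lge0//.
  by rewrite (lt_le_trans ltr01)// G_ge1.
(* The factor (1 + n)^m pays for the unit neighbourhood: if y is within 1 of x in each coordinate,
   then 1 + sum |y_j| <= (1 + n) (1 + sum |x_j|). *)
have := @class_continuous R 'rV[R]_n V G V_P V_lim n (fun j (x : 'rV[R]_n) =>
  x 0 j) V_1 Vlt f (C * (1 + n%:R) ^+ m) cf.
case.
  move=> x y xy; rewrite (le_trans (fC y))// -mulrA ler_wpM2l// -exprMn.
  rewrite lerXn2r ?nnegrE ?mulr_ge0 ?addr_ge0 ?sumr_ge0//.
  have : \sum_j `|y 0 j| <= \sum_j (`|x 0 j| + 1).
    apply: ler_sum => j _; rewrite -[y 0 j](subrK (x 0 j)) addrC (le_trans (ler_normD _ _))//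
      lerD2l.
    exact: xy.
  rewrite big_split/= sumr_const card_ord.
  have : 0 <= \sum_j `|x 0 j| by exact: sumr_ge0.
  have : 0 <= n%:R :> R by [].
  set u := \sum_j `|x 0 j|; set v := \sum_j _; nra.
have e : (fun x : 'rV[R]_n => f (\row_j x 0 j)) = f.
  by apply/funext => x; congr f; apply/rowP => j; rewrite mxE.
rewrite e => mf _ /(_ (fun=> 0) 0).
have e2 x : tw f (fun=> 0) 0 x = f x.
  by rewrite /tw big1 ?addr0 ?cos0 ?mulr1// => j _; rewrite mul0r.
have e3 s X : (fun w => tw f (fun=> 0) 0 (Zs s w) * X w) = (fun w => f (Zs s w) * X w).
  by apply/funext => w; rewrite e2.
have e4 : (fun t => E (fun w => tw f (fun=> 0) 0 (Zs (sc t) w) * xi w)) =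
    (fun t => E (fun w => f (Zs (sc t) w) * xi w)).
  by apply/funext => t; rewrite e3.
rewrite e4 !e3 => -[m1 m2]; split => // s.
by have := mf s; congr measurable_fun; apply/funext => w; exact: (congr1 (@^~ (Zs s w)) e).
Qed.

End Class.
End C1IntegrationByParts.

(** * Growth of functions with polynomially bounded derivatives *)

Section C1Functions.
Variables (R : realType) (n : nat).
Implicit Types (x v y : 'rV[R]_n).

Lemma is_derive_line (f : 'rV[R]_n -> R) x v t : differentiable f (x + t *: v) ->
  is_derive t (1:R) (fun s => f (x + s *: v)) (\sum_j v 0 j * partial j f (x + t *: v)).
Proof.
move=> df.
have -> : \sum_j v 0 j * partial j f (x + t *: v) = 'D_v f (x + t *: v).
  move: (x + t *: v) df => y df.
  rewrite deriveE// [in RHS](row_sum_delta v) linear_sum; apply: eq_bigr => j _.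
  by rewrite /partial (deriveE _ df) linearZ.
have e : (fun h : R => h^-1 *: (((fun s => f (x + s *: v)) \o shift t) (h *: 1) - f (x + t *: v))) =
    (fun h : R => h^-1 *: ((f \o shift (x + t *: v)) (h *: v) - f (x + t *: v))).
  apply/funext => h /=; congr (_ *: (f _ - _)).
  by rewrite [h%:A]mulr1 scalerDl addrCA.
split; first by have := @diff_derivable _ _ _ f (x + t *: v) v df; rewrite /derivable e.
by rewrite /derive e.
Qed.

Lemma mean_value_line (f : 'rV[R]_n -> R) x v : (forall y, differentiable f y) ->
  exists2 t : R, 0 <= t <= 1 & f (x + v) - f x = \sum_j v 0 j * partial j f (x + t *: v).
Proof.
move=> df.
have dl (t : R) := is_derive_line (df (x + t *: v)).
have cl : {within `[0, 1], continuous (fun s => f (x + s *: v))}.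
  apply: continuous_subspaceT => s.
  by apply/differentiable_continuous/derivable1_diffP; have [] := dl s.
have [t t01] := MVT_segment ler01 (fun t _ => dl t) cl.
by rewrite scale1r scale0r addr0 subr0 mulr1 => h; exists t.
Qed.

Lemma rV_norm_le x : `|x| <= \sum_j `|x 0 j|.
Proof.
rewrite -[`|x|]/(mx_norm x) mx_normrE; apply: bigmax_le; first exact: sumr_ge0.
move=> [i j] _ /=; rewrite ord1 (bigD1 j)//= lerDl; exact: sumr_ge0.
Qed.

Let g x := 1 + \sum_j `|x 0 j|.
Let g_ge1 x : 1 <= g x. Proof. by rewrite lerDl sumr_ge0. Qed.
Let g_ge0 x : 0 <= g x. Proof. exact: le_trans ler01 (g_ge1 x). Qed.

(** Constants and degrees are summed over j to serve all partial derivatives at once; [g] is at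
    least 1, so a larger degree is harmless. *)
Lemma partial_growth (f : 'rV[R]_n -> R) : C1_poly_growth f ->
  exists (C : R) (m : nat), 0 <= C /\ forall j x, `|partial j f x| <= C * g x ^+ m.
Proof.
move=> [_ _ gr].
have /choice[Cm Cmf] : forall j, exists p : R * nat, forall x, `|partial j f x| <= p.1 * (1 +
  `|x|) ^+ p.2.
  by move=> j; have [C [m h]] := gr j; exists (C, m).
exists (\sum_j `|(Cm j).1|), (\sum_j (Cm j).2)%N; split=> [|j x]; first exact: sumr_ge0.
apply: (le_trans (Cmf j x)).
apply: (@le_trans _ _ (`|(Cm j).1| * (1 + `|x|) ^+ (Cm j).2)).
  by rewrite ler_wpM2r ?exprn_ge0 ?addr_ge0//; exact: ler_norm.
apply: ler_pM => //.
  by rewrite (bigD1 j)//= lerDl sumr_ge0.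
apply: (@le_trans _ _ (g x ^+ (Cm j).2)).
  apply: lerXn2r; [by rewrite nnegrE addr_ge0|by rewrite nnegrE g_ge0|].
  by rewrite /g lerD2l; exact: rV_norm_le.
by apply: ler_weXn2l => //; rewrite (bigD1 j)//= leq_addr.
Qed.

Let g_scale x t : 0 <= t <= 1 -> g (t *: x) <= g x.
Proof.
move=> /andP[t0 t1]; rewrite lerD2l; apply: ler_sum => j _.
by rewrite mxE normrM ger0_norm// ler_piMl.
Qed.

(** [C1_poly_growth] bounds the derivatives only; the mean value theorem on the segment from 0 to x
    bounds f itself, with the degree raised by one. *)
Lemma C1_growth (f : 'rV[R]_n -> R) : C1_poly_growth f ->
  exists (C : R) (m : nat), 0 <= C /\ forall x, `|f x| <= C * g x ^+ m.
Proof.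
move=> Cf; have [df _ _] := Cf; have [C [m [C0 fC]]] := partial_growth Cf.
exists (`|f 0| + C), m.+1; split=> [|x]; first exact: addr_ge0.
have [t t01] := mean_value_line 0 x df; rewrite !add0r => e.
have G1 k : 1 <= g x ^+ k by exact: exprn_ege1.
rewrite -[f x](subrK (f 0)) e addrC (le_trans (ler_normD _ _))// mulrDl lerD//.
  by rewrite ler_peMr.
rewrite (le_trans (ler_norm_sum _ _ _))// exprS mulrCA.
apply: (@le_trans _ _ (\sum_j `|x 0 j| * (C * g x ^+ m))).
  apply: ler_sum => j _; rewrite normrM ler_wpM2l// (le_trans (fC _ _))// ler_wpM2l//.
  by apply: lerXn2r; [rewrite nnegrE g_ge0|rewrite nnegrE g_ge0|exact: g_scale].
rewrite -mulr_suml ler_wpM2r// ?lerDr//.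
by rewrite mulr_ge0// exprn_ge0.
Qed.

Lemma C1_continuous (f : 'rV[R]_n -> R) : C1_poly_growth f -> continuous f.
Proof. by move=> [df _ _] x; exact: differentiable_continuous. Qed.

End C1Functions.

(** * Integration by parts for smooth functionals *)

Section MalliavinIntegrationByParts.
Context (R : realType) d (Omega : measurableType d) (P : probability Omega R).
Variable GS : (Omega -> R) -> Prop.
Hypothesis GS_P : forall (a : R) X Y, GS X -> GS Y -> GS (fun w => a * X w + Y w).
Hypothesis GS_L2 : forall X, GS X -> L2 P X.
Hypothesis GS_gaussian : forall X, GS X -> gaussian P X.
Local Notation E := (intg P).
Variables (n : nat) (Z : 'I_n -> Omega -> R) (Y X0 : Omega -> R) (b0 : R).
Hypotheses (gZ : forall j, GS (Z j)) (gY : GS Y) (gX0 : GS X0).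
Let c j := E (fun w => Z j w * Y w).
Let Gc w := cos (X0 w + b0).
Let xi := skorokhod P Y X0 b0.
Let Zs (s : R) (w : Omega) : 'rV[R]_n := \row_j (Z j w + s * c j).
Let D m w := (1 + \sum_j (`|Z j w| + `|c j|)) ^+ m.

Let mom_D m : moments P (D m) := moments_envelope GS_P GS_L2 GS_gaussian Y gZ m.

Let mxi : moments P xi := moments_skorokhod GS_P GS_L2 GS_gaussian b0 gY gX0.

Let mGc : moments P Gc.
Proof.
apply: (@moments_bounded _ _ _ _ _ 1) => [|w]; last exact: norm_cos_le1.
by apply: measurable_cos_comp; apply: measurable_funD => //; exact: (GS_L2 gX0).1.
Qed.

Let le_D m w s : 0 <= s <= 1 -> (1 + \sum_j `|Zs s w 0 j|) ^+ m <= D m w.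
Proof. exact: envelope_le. Qed.

Let Zs0 w : Zs 0 w = \row_j Z j w.
Proof. by apply/rowP => j; rewrite !mxE mul0r addr0. Qed.

Lemma moments_poly_growth (f : 'rV[R]_n -> R) (C : R) m : continuous f ->
  (forall x, `|f x| <= C * (1 + \sum_j `|x 0 j|) ^+ m) ->
  moments P (fun w => f (\row_j Z j w)).
Proof.
move=> cf fC; have e01 : 0 <= (0 : R) <= 1 by rewrite lexx ler01.
(* Invoked at eps = 0 for its first claim, the measurability of f(Zs). *)
have [mf _ _] := continuous_ibp_integral GS_P GS_L2 GS_gaussian b0 gZ gY gX0 e01 cf fC.
have := momentsM (moments_cst P C) (mom_D m); apply: moments_le.
  by under eq_fun do rewrite -Zs0; exact: mf.
move=> w; rewrite -Zs0 (le_trans (fC _))// (le_trans _ (ler_norm _))// ler_wpM2l ?le_D//.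
have := le_trans (normr_ge0 _) (fC 0); rewrite pmulr_lge0// (lt_le_trans ltr01)// exprn_ege1//.
by rewrite lerDl sumr_ge0.
Qed.

(** Divide the formula along the segment by eps = 1 / (k + 1) and let k tend to infinity: averages
    on one side, difference quotients on the other, both dominated by variables with all moments. *)
Lemma malliavin_ibp (f : 'rV[R]_n -> R) : C1_poly_growth f ->
  E (fun w => f (\row_j Z j w) * xi w) =
  \sum_j c j * E (fun w => partial j f (\row_k Z k w) * Gc w).
Proof.
move=> Cf; have [df cpf _] := Cf.
have cf := C1_continuous Cf.
have [C [m [C0 fC]]] := C1_growth Cf.
have [C' [m' [C'0 fC']]] := partial_growth Cf.
have e01 : 0 <= (0 : R) <= 1 by rewrite lexx ler01.
have [mf _ _] := continuous_ibp_integral GS_P GS_L2 GS_gaussian b0 gZ gY gX0 e01 cf fC.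
have mpf j s : measurable_fun setT (fun w => partial j f (Zs s w)).
  by have [h _ _] := continuous_ibp_integral GS_P GS_L2 GS_gaussian b0 gZ gY gX0 e01 (cpf j) (fC'
    j); exact: h.
pose e (k : nat) : R := k.+1%:R^-1.
have e_gt0 k : 0 < e k by rewrite invr_gt0.
have e_le1 k : e k <= 1 by rewrite invf_le1// ler1n.
have e_01 k : 0 <= e k <= 1 by rewrite (ltW (e_gt0 k)) e_le1.
have e_0 : e k @[k --> \oo] --> 0 by exact: cvg_harmonic.
have fZ s w : 0 <= s <= 1 -> `|f (Zs s w)| <= C * D m w.
  by move=> s01; rewrite (le_trans (fC _))// ler_wpM2l// le_D.
have fM s X : 0 <= s <= 1 -> moments P X -> moments P (fun w => f (Zs s w) * X w).
  move=> s01 mX; apply: momentsM => //.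
  have := momentsM (moments_cst P C) (mom_D m); apply: moments_le; first exact: mf.
  by move=> w; rewrite (le_trans (fZ s w s01))//; exact: ler_norm.
have Zs_cvg w (s_ : nat -> R) : s_ k @[k --> \oo] --> 0 -> Zs (s_ k) w @[k --> \oo] --> Zs 0 w.
  move=> s0; have -> : Zs 0 w = Zs 0 w + (0 : R) *: \row_j c j by rewrite scale0r addr0.
  have -> : (fun k => Zs (s_ k) w) = (fun k => Zs 0 w + s_ k *: \row_j c j).
    by apply/funext => k; apply/rowP => j; rewrite !mxE mul0r addr0.
  by apply: cvgD; [exact: cvg_cst|apply: cvgZr_tmp].
pose phi k t := E (fun w => f (Zs (e k * clip01 t) w) * xi w).
have ec k t : 0 <= e k * clip01 t <= 1.
  have /andP[t0 t1] := clip01_itv t; have /andP[k0 k1] := e_01 k.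
  by rewrite mulr_ge0//= mulr_ile1.
have iK : L1 P (fun w => C * D m w * `|xi w|).
  by apply: moments_L1; apply: momentsM; [apply: momentsM => //;
    exact: moments_cst|exact: moments_norm].
have right_lim : intg (leb 1) (phi k) @[k --> \oo] --> E (fun w => f (Zs 0 w) * xi w).
  have h0 k : measurable_fun setT (phi k : measurableTypeR R -> R).
    by have [] := continuous_ibp_integral GS_P GS_L2 GS_gaussian b0 gZ gY gX0 (e_01 k) cf fC.
  have h1 k t : `|phi k t| <= E (fun w => C * D m w * `|xi w|).
    have i1 : L1 P (fun w => f (Zs (e k * clip01 t) w) * xi w) by apply: moments_L1; exact: fM.
    rewrite (le_trans (norm_intg i1))//; apply: le_intg => //; first exact: L1_norm.
    by move=> w; rewrite normrM ler_wpM2r// fZ.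
  have h2 t : phi k t @[k --> \oo] --> E (fun w => f (Zs 0 w) * xi w).
    have m1 k : measurable_fun setT (fun w => f (Zs (e k * clip01 t) w) * xi w).
      by have [] : moments P (fun w => f (Zs (e k * clip01 t) w) * xi w) by exact: fM.
    have b1 k w : `|f (Zs (e k * clip01 t) w) * xi w| <= C * D m w * `|xi w|.
      by rewrite normrM ler_wpM2r// fZ.
    have l1 w : f (Zs (e k * clip01 t) w) * xi w @[k --> \oo] --> f (Zs 0 w) * xi w.
      apply: cvgMl; apply: (cvg_comp _ f); last exact: cf.
      by apply: Zs_cvg; rewrite -[X in _ --> X](mul0r (clip01 t)); apply: cvgMl.
    by have [] := intg_dct m1 iK b1 l1.
  have [_] := intg_dct h0 (leb_integrable_cst (E (fun w => C * D m w * `|xi w|)) ler01) h1 h2.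
  by rewrite leb_intg_cst// mulr1.
(* The mean value theorem rewrites the quotient with partial derivatives on the segment, where
   [D m'] bounds them uniformly in k. *)
pose q k w := (e k)^-1 * (f (Zs (e k) w) - f (Zs 0 w)).
have ZsD s w : Zs s w = Zs 0 w + s *: \row_j c j.
  by apply/rowP => j; rewrite !mxE mul0r addr0.
have q_le k w : `|q k w| <= \sum_j `|c j| * (C' * D m' w).
  rewrite /q ZsD; have [t t01 ->] := mean_value_line (Zs 0 w) (e k *: \row_j c j) df.
  rewrite normrM gtr0_norm ?invr_gt0// ler_pdivrMl//.
  rewrite (le_trans (ler_norm_sum _ _ _))// mulr_sumr; apply: ler_sum => j _.
  rewrite !mxE normrM normrM gtr0_norm// -mulrA ler_wpM2l ?(ltW (e_gt0 k))// ler_wpM2l//.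
  rewrite (le_trans (fC' _ _))// ler_wpM2l// scalerA -ZsD le_D//.
  have /andP[k0 k1] := e_01 k; have /andP[t0 t1] := t01.
  by rewrite mulr_ge0//= mulr_ile1.
have q_lim w : q k w @[k --> \oo] --> \sum_j c j * partial j f (Zs 0 w).
  have dl := @is_derive_line _ _ f (Zs 0 w) (\row_j c j) 0 (df _).
  have [+ e1] := dl; rewrite /derivable => dq.
  have {}dq : (fun h : R => h^-1 *: (((fun s => f (Zs 0 w + s *: \row_j c j)) \o shift 0) (h *: 1)
      - f (Zs 0 w + (0 : R) *: \row_j c j))) h @[h --> 0^'] --> \sum_j c j * partial j f (Zs 0 w).
    rewrite [X in _ --> X](_ : _ = 'D_1 (fun s : R => f (Zs 0 w + s *: \row_j c j)) (0 : R));
      first exact: dq.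
    by rewrite e1; apply: eq_bigr => j _; rewrite mxE scale0r addr0.
  move/cvgr_dnbhsP: dq => /(_ e) dq.
  have {}dq := dq (conj (fun k => lt0r_neq0 (e_gt0 k)) e_0).
  apply: (cvg_trans _ dq); apply: near_eq_cvg; apply: nearW => k.
  rewrite /= /q scale0r !addr0 [(e k)%:A]mulr1 -ZsD; reflexivity.
have mq k : measurable_fun setT (q k).
  by apply: measurable_funM; [exact: measurable_cst|apply: measurable_funB; exact: mf].
have left_lim : E (fun w => q k w * Gc w) @[k --> \oo] -->
    E (fun w => (\sum_j c j * partial j f (Zs 0 w)) * Gc w).
  have m1 k : measurable_fun setT (fun w => q k w * Gc w) by apply: measurable_funM => //;
    exact: mGc.1.
  have i1 : L1 P (fun w => (\sum_j `|c j| * (C' * D m' w)) * `|Gc w|).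
    apply: moments_L1; apply: momentsM; last exact: moments_norm.
    by apply: moments_sum => j; apply: momentsM; [exact: moments_cst|apply: momentsM => //;
      exact: moments_cst].
  have b1 k w : `|q k w * Gc w| <= (\sum_j `|c j| * (C' * D m' w)) * `|Gc w|.
    by rewrite normrM ler_wpM2r.
  have l1 w : q k w * Gc w @[k --> \oo] --> (\sum_j c j * partial j f (Zs 0 w)) * Gc w.
    by apply: cvgMl.
  by have [] := intg_dct m1 i1 b1 l1.
have lr k : E (fun w => q k w * Gc w) = intg (leb 1) (phi k).
  have [_ _ ibp] := continuous_ibp_integral GS_P GS_L2 GS_gaussian b0 gZ gY gX0 (e_01 k) cf fC.
  transitivity ((e k)^-1 * (E (fun w => f (Zs (e k) w) * Gc w) - E (fun w => f (Zs 0 w) * Gc w))).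
    rewrite -intgB; [|by apply: moments_L1; exact: fM|by apply: moments_L1; exact: fM].
    rewrite -intgZ; last by apply: L1B; apply: moments_L1; exact: fM.
    by congr intg; apply/funext => w; rewrite /q; ring.
  by rewrite ibp mulKf// gt_eqF.
have pZ j : moments P (fun w => partial j f (\row_k Z k w)) := moments_poly_growth (cpf j) (fC' j).
have e1 : \sum_j c j * E (fun w => partial j f (\row_k Z k w) * Gc w) =
    E (fun w => (\sum_j c j * partial j f (Zs 0 w)) * Gc w).
  under [in RHS]eq_fun do rewrite mulr_suml.
  rewrite intg_sum => [|j].
    apply: eq_bigr => j _; rewrite -intgZ; last by apply: moments_L1; exact: momentsM.
    by congr intg; apply/funext => w; rewrite Zs0 mulrA.
  apply: moments_L1; apply: momentsM => //; apply: momentsM; first exact: moments_cst.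
  by under eq_fun do rewrite Zs0.
rewrite e1; move: left_lim; under eq_fun do rewrite lr.
move=> left_lim; rewrite -(cvg_lim _ left_lim)// (cvg_lim _ right_lim)//.
by congr intg; apply/funext => w; rewrite Zs0.
Qed.

End MalliavinIntegrationByParts.

Lemma eq_cvgn (R : realType) (u v : nat -> R) (l : R) : (forall n, u n = v n) ->
  u n @[n --> \oo] --> l -> v n @[n --> \oo] --> l.
Proof. by move=> /funext ->. Qed.

Section L2Lnorm.
Context (R : realType) d (Omega : measurableType d) (P : probability Omega R).
Local Notation E := (intg P).
Implicit Types (f g : Omega -> R).

Lemma cvgL2_ae (f_ g_ : nat -> Omega -> R) f : (forall n, measurable_fun setT (g_ n)) ->
  (forall n, {ae P, forall w, f_ n w = g_ n w}) -> cvgL2 P f_ f -> cvgL2 P g_ f.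
Proof.
move=> mg fg [Lf_ Lf cf]; split=> [n|//|].
- exact: L2_ae (mg n) (Lf_ n) (fg n).
- apply: eq_cvgn cf => n.
  have Lg := L2_ae (mg n) (Lf_ n) (fg n).
  apply: eq_intg_ae; [exact: L1_measurable (L2B (Lf_ n) Lf).2|exact: L1_measurable (L2B Lg Lf).2|].
  by apply: filterS (fg n) => w ->.
Qed.

Lemma Lnorm2_sqr f : measurable_fun setT f ->
  ((Lnorm P 2%:E (EFin \o f)) `^ 2 = \int[P]_w (f w ^+ 2)%:E)%E.
Proof.
move=> mf; rewrite poweR_Lnorm ?pnatr_eq0//; apply: eq_integral => w _ /=.
by rewrite powR_mulrn ?normr_ge0// real_normK ?num_real.
Qed.

Lemma L2_of_Lnorm f : measurable_fun setT f -> (Lnorm P 2%:E (EFin \o f) < +oo)%E -> L2 P f.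
Proof.
move=> mf foo; split=> //; apply/integrableP; split.
  by apply/measurable_EFinP; exact: measurable_funX.
under eq_integral => w _ do rewrite /= ger0_norm ?sqr_ge0//.
rewrite -Lnorm2_sqr//; have : (0 <= Lnorm P 2%:E (EFin \o f))%E by exact: Lnorm_ge0.
by move: foo; case: (Lnorm _ _ _) => [r||]// _ _; rewrite poweR_EFin ltry.
Qed.

(** Square integrability of the limit is part of the conclusion: f differs from some f_ n by a
    function of norm less than 1. *)
Lemma cvgL2_of_Lnorm (f_ : nat -> Omega -> R) f : (forall n, L2 P (f_ n)) ->
  measurable_fun setT f ->
  Lnorm P 2%:E (fun w => (f_ n w - f w)%:E) @[n --> \oo] --> 0%E -> cvgL2 P f_ f.
Proof.
move=> Lf_ mf c0.
have mfd n : measurable_fun setT (fun w => f_ n w - f w).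
  by apply: measurable_funB => //; exact: (Lf_ n).1.
have Lf : L2 P f.
  have [n _ /(_ n (leqnn n)) h] : \forall n \near \oo,
      (Lnorm P 2%:E (fun w => (f_ n w - f w)%:E) < 1%:E)%E.
    by have := c0 => /fine_cvgP[+ /cvgr_lt/(_ 1%R ltr01)]; apply: filterS2 => n fin;
      rewrite -lte_fin fineK.
  have := L2B (Lf_ n) (L2_of_Lnorm (mfd n) (lt_trans h (ltry _))).
  by congr L2; apply/funext => w; ring.
split=> //.
have Lfd n : L2 P (fun w => f_ n w - f w) by exact: L2B.
have E2 n : (Lnorm P 2%:E (fun w => (f_ n w - f w)%:E)) = (Num.sqrt (E (fun w =>
  (f_ n w - f w) ^+ 2)))%:E.
  have sq := Lnorm2_sqr (mfd n); rewrite -EFin_intg in sq; last exact: (Lfd n).2.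
  have N0 : (0 <= Lnorm P 2%:E (fun w => (f_ n w - f w)%:E))%E by exact: Lnorm_ge0.
  move: sq N0; rewrite [EFin \o _](_ : _ = (fun w => (f_ n w - f w)%:E))//.
  case: (Lnorm _ _ _) => [r||//]; last by rewrite poweRyr ?pnatr_eq0.
  rewrite poweR_EFin lee_fin => -[<-] r0.
  by rewrite powR_mulrn// sqrtr_sqr ger0_norm.
move: c0; under eq_fun do rewrite E2.
move=> /fine_cvgP[_ c0].
pose r n := Num.sqrt (E (fun w => (f_ n w - f w) ^+ 2)).
have c1 : r n * r n @[n --> \oo] --> (0 : R).
  by rewrite -[X in _ --> X](mulr0 (0 : R)); exact: (cvgM c0 c0).
apply: eq_cvgn c1 => n; rewrite /r -expr2 sqr_sqrtr// intg_ge0// => w.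
exact: sqr_ge0.
Qed.

End L2Lnorm.

(** * Wiener integrals and their covariances *)

Section WienerIntegrals.
Variables (R : realType) (T : R) (H : completeNormedModType R) (ip : {dot H for idfun}).
Hypothesis T_ge0 : 0 <= T.
Hypothesis H_hilbert : inner_product_norm ip.
Variable Q : {linear H -> H}.
Local Notation U := (H0 ip Q).
Context d (Omega : measurableType d) (P : probability Omega R).
Variable W : R -> U -> Omega -> R.
Hypothesis W_wiener : cylindrical_wiener P (natural_filtration W) T W.
Hypothesis F_gen : @measurable d Omega = natural_filtration W T.
Local Notation E := (intg P).

(** The mean-square closure of the finite sums. It contains every I(phi) and every W(t)u, and is the
    Gaussian space to which the integration by parts is applied. *)
Definition first_chaos (X : Omega -> R) := exists2 l_ : nat -> seq (R * U),
  forall n, valid_times T (l_ n) & cvgL2 P (fun n => chaos W (l_ n)) X.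

Lemma first_chaos_L2 X : first_chaos X -> L2 P X.
Proof. by move=> [l_ _ []]. Qed.

Lemma first_chaos_gaussian X : first_chaos X -> gaussian P X.
Proof.
by move=> [l_ vl cl]; apply: (cvgL2_gaussian cl) => n;
  exact: (chaos_gaussian T_ge0 H_hilbert W_wiener F_gen).
Qed.

Lemma first_chaos_of l : valid_times T l -> first_chaos (chaos W l).
Proof.
by move=> vl; exists (fun=> l) => //; apply: cvgL2_cst; exact: (chaos_L2 W_wiener F_gen).
Qed.

Lemma first_chaos_W t u : 0 <= t <= T -> first_chaos (W t u).
Proof.
move=> tT; have := @first_chaos_of [:: (t, u)]; rewrite /= tT => /(_ isT); congr first_chaos.
by apply/funext => w; rewrite /chaos big_seq1.
Qed.

Let scale_chaos (a : R) (l : seq (R * U)) := [seq (x.1, a *: x.2) | x <- l].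

Let valid_scale a l : valid_times T l -> valid_times T (scale_chaos a l).
Proof. by move=> vl; rewrite /valid_times all_map; apply: sub_all vl => x. Qed.

Let valid_cat (l l' : seq (R * U)) : valid_times T (l ++ l') = valid_times T l && valid_times T l'.
Proof. exact: all_cat. Qed.

Let scale_chaos_ae a l : valid_times T l ->
  {ae P, forall w, a * chaos W l w = chaos W (scale_chaos a l) w}.
Proof.
elim: l => [_|x l IH /= /andP[xT vl]].
  by apply: aeW => w; rewrite /chaos !big_nil mulr0.
apply: filterS2 (IH vl) (W_scale_ae H_hilbert W_wiener F_gen a x.2 xT) => w h1 h2.
by rewrite !chaos_cons mulrDr h1 -h2.
Qed.

Lemma first_chaosP (a : R) X Y : first_chaos X -> first_chaos Y ->
  first_chaos (fun w => a * X w + Y w).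
Proof.
move=> [lX vX cX] [lY vY cY]; exists (fun n => scale_chaos a (lX n) ++ lY n).
  by move=> n; rewrite valid_cat vY andbT; exact: valid_scale.
apply: (cvgL2_ae _ _ (cvgL2P a cX cY)) => n.
  have vn : valid_times T (scale_chaos a (lX n) ++ lY n).
    by rewrite valid_cat vY andbT; exact: valid_scale.
  exact: (chaos_L2 W_wiener F_gen vn).1.
by apply: filterS (scale_chaos_ae a (vX n)) => w h; rewrite chaos_cat h.
Qed.

(** The minus sign of an increment is carried by the vector, so the resulting sum equals
    [step_integral] only almost surely. *)
Let step_list (s : seq (R * R * U)) : seq (R * U) :=
  flatten [seq [:: (x.1.2, x.2); (x.1.1, -1 *: x.2)] | x <- s].

Let valid_step_list s : valid_step T s -> valid_times T (step_list s).
Proof.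
elim: s => //= x s IH /andP[/and3P[x0 x1 x2] vs]; rewrite IH// andbT.
by rewrite x2 (le_trans x0 x1) x0 (le_trans x1 x2).
Qed.

Let step_chaos_ae s : valid_step T s ->
  {ae P, forall w, chaos W (step_list s) w = step_integral W s w}.
Proof.
elim: s => [_|x s IH /= /andP[/and3P[x0 x1 x2] vs]].
  by apply: aeW => w; rewrite /chaos /step_integral !big_nil.
have x1T : 0 <= x.1.1 <= T by rewrite x0 (le_trans x1 x2).
apply: filterS2 (IH vs) (W_scale_ae H_hilbert W_wiener F_gen (-1) x.2 x1T) => w h1 h2.
by rewrite /step_integral big_cons [step_list _]/= !chaos_cons h1 /= h2 mulN1r addrA.
Qed.

Lemma step_integral_L2 s : valid_step T s -> L2 P (step_integral W s).
Proof.
elim: s => [_|x s IH /= /andP[/and3P[x0 x1 x2] vs]].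
  by have := L2_cst P 0; congr L2; apply/funext => w; rewrite /step_integral big_nil.
have L1 : L2 P (W x.1.2 x.2) by apply: (W_L2 W_wiener F_gen); rewrite (le_trans x0 x1).
have L2' : L2 P (W x.1.1 x.2) by apply: (W_L2 W_wiener F_gen); rewrite x0 (le_trans x1 x2).
have := L2D (L2B L1 L2') (IH vs); congr L2.
by apply/funext => w; rewrite /step_integral big_cons.
Qed.

(** The length of ]a, c] cut at b, in the form produced by the covariance of an increment with
    W(b)e. *)
Lemma leb_intg_itv a c b : 0 <= a -> a <= c -> c <= T ->
  L1 (leb T) (fun t => (t <= b)%R%:R * (a < t <= c)%R%:R) /\
  intg (leb T) (fun t => (t <= b)%R%:R * (a < t <= c)%R%:R) = Num.min c b - Num.min a b.
Proof.
move=> a0 ac cT.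
have mle : Num.min a b <= Num.min c b by apply: le_min2.
pose A : set (measurableTypeR R) := `]Num.min a b, Num.min c b]%classic.
have mA : measurable A by exact: measurable_itv.
have -> : (fun t => (t <= b)%R%:R * (a < t <= c)%R%:R) = \1_A :> (R -> R).
  apply/funext => t; rewrite indicE -natrM mulnb; congr (nat_of_bool _)%:R.
  apply/idP/idP.
    by move=> /and3P[tb at_ tc]; rewrite inE /A /= in_itv/= le_min gt_min tb tc at_.
  rewrite inE /A /= in_itv/= le_min gt_min => /andP[+ /andP[tc tb]].
  by rewrite tb tc /= andbT => /orP[//|bt]; move: (le_lt_trans tb bt); rewrite ltxx.
have mi : measurable_fun setT (\1_A : measurableTypeR R -> R) by exact: measurable_indic.
split; first by apply: (leb_L1_bounded (K := 1) _ mi) => // t; exact: norm_indic_le1.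
rewrite /intg /Rintegral integral_indic// setIT [leb T A](_ : _ = lebesgue_measure (A `&` `[0,
  T])%classic)//.
have [e|l] := eqVneq (Num.min a b) (Num.min c b).
  rewrite e subrr /A e set_itvoc0 ?lexx// set0I measure0//.
have {}l : Num.min a b < Num.min c b by rewrite lt_neqAle l.
have ab : a < b.
  rewrite ltNge; apply/negP => ba; move: l; rewrite (min_r ba) min_r ?ltxx//.
  exact: le_trans ba ac.
rewrite setIidl; last first.
  move=> t; rewrite /A /= !in_itv/= (min_l (ltW ab)) le_min => /and3P[at_ tc tb].
  by rewrite (le_trans a0 (ltW at_)) (le_trans tc cT).
by rewrite lebesgue_measure_itv/= lte_fin l.
Qed.

Lemma step_covariance s b e : 0 <= b <= T -> valid_step T s ->
  L1 (leb T) (fun t => (t <= b)%R%:R * ipH0 (step_fun s t) e) /\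
  E (fun w => step_integral W s w * W b e w) =
  intg (leb T) (fun t => (t <= b)%R%:R * ipH0 (step_fun s t) e).
Proof.
move=> bT; have Wb := W_L2 W_wiener F_gen e bT.
elim: s => [_|x s IH /= /andP[/and3P[x0 x1 x2] vs]].
  have e0 : (fun t : R => (t <= b)%R%:R * ipH0 (step_fun [::] t) e) = (fun=> 0 : R).
    apply/funext => t; rewrite /step_fun big_nil.
    by rewrite (bform0l (@ipH0Pl _ _ _ H_hilbert Q)) mulr0.
  rewrite e0; split; first exact: L1_0.
  rewrite leb_intg_cst// mul0r -[RHS](intg_cst P 0); congr intg.
  by apply/funext => w; rewrite /step_integral big_nil mul0r.
have [Is eqs] := IH vs; have [Ix eqx] := leb_intg_itv b x0 x1 x2.
have es : (fun t => (t <= b)%R%:R * ipH0 (step_fun (x :: s) t) e) =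
    (fun t => ipH0 x.2 e * ((t <= b)%R%:R * (x.1.1 < t <= x.1.2)%R%:R) +
      (t <= b)%R%:R * ipH0 (step_fun s t) e).
  apply/funext => t; rewrite /step_fun big_cons (bformDl (@ipH0Pl _ _ _ H_hilbert Q)) mulrDr.
  congr (_ + _); case: ifP => _; rewrite ?mulr1 ?mulr0.
    by rewrite mulrC.
  by rewrite (bform0l (@ipH0Pl _ _ _ H_hilbert Q)) mulr0.
rewrite es; split; first exact: L1P.
have x1T : 0 <= x.1.1 <= T by rewrite x0 (le_trans x1 x2).
have x2T : 0 <= x.1.2 <= T by rewrite x2 (le_trans x0 x1).
have L1x := W_L2 W_wiener F_gen x.2 x1T; have L2x := W_L2 W_wiener F_gen x.2 x2T.
rewrite intgP// eqx -eqs.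
transitivity (E (fun w => (W x.1.2 x.2 w - W x.1.1 x.2 w) * W b e w + step_integral W s w * W b e
  w)).
  by congr intg; apply/funext => w; rewrite /step_integral big_cons mulrDl.
rewrite intgD; [|by apply: L2_mul => //; exact: L2B|by apply: L2_mul => //;
  exact: step_integral_L2].
congr (_ + _).
under eq_fun do rewrite mulrBl.
rewrite intgB; [|exact: L2_mul|exact: L2_mul].
rewrite !(W_cov W_wiener F_gen)//; ring.
Qed.

Section Integral.
Variables (phi : R -> U) (Z : Omega -> R).
Hypothesis IZ : is_wiener_integral P T W phi Z.

Lemma wiener_integral_approx : exists s : nat -> seq (R * R * U),
  [/\ forall n, valid_step T (s n),
      LqH0_enorm T 2%:E (step_fun (s n) - phi) @[n --> \oo] --> 0%E
    & cvgL2 P (fun n => step_integral W (s n)) Z].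
Proof.
have [mZ [s [vs sphi sZ]]] := IZ; exists s; split => //.
by apply: cvgL2_of_Lnorm => // n; exact: step_integral_L2.
Qed.

Lemma wiener_integral_first_chaos : first_chaos Z.
Proof.
have [s [vs _ cZ]] := wiener_integral_approx.
exists (fun n => step_list (s n)) => [n|]; first exact: valid_step_list.
apply: cvgL2_ae cZ => n.
  exact: (chaos_L2 W_wiener F_gen (valid_step_list (vs n))).1.
by apply: filterS (step_chaos_ae (vs n)).
Qed.

Lemma pairing_lipschitz (e u v : U) : (`|ipH0 u e - ipH0 v e|%:E <= (normH0 e)%:E * enormH0 (u -
  v)%R)%E.
Proof.
rewrite -(bformBl (@ipH0Pl _ _ _ H_hilbert Q)) /enormH0 -EFinM lee_fin mulrC.
exact: ipH0_CauchySchwarz.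
Qed.

Lemma measurable_pairing e (g : R -> U) : strongly_measurable (X := measurableTypeR R) (@enormH0
  R H ip Q) g ->
  measurable_fun setT (fun t : measurableTypeR R => ipH0 (g t) e).
Proof.
move=> mg; have lip (u v : U) : (enormH0 u < +oo)%E -> (enormH0 v < +oo)%E ->
    (`|ipH0 u e - ipH0 v e|%:E <= (normH0 e)%:E * enormH0 (u - v)%R)%E.
  by move=> _ _; exact: pairing_lipschitz.
exact: (strongly_measurable_lip (enormH0_seminorm H_hilbert Q) lip mg).
Qed.

Lemma measurable_cut b : measurable_fun setT (fun t : measurableTypeR R => (t <= b)%R%:R : R).
Proof.
rewrite (_ : (fun t => _) = \1_(`]-oo, b]%classic)); first by apply: measurable_indic;
  exact: measurable_itv.
by apply/funext => t; rewrite indicE mem_setE in_itv.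
Qed.

(** The isometry of the integral, tested on W(b)e, whose integrand is 1_[0,b] e. It holds for step
    functions and passes to the limit on the right because on [0, T] the L^1 norm is controlled by
    the L^2 norm. *)
Lemma wiener_integral_covariance b e : 0 <= b <= T ->
  strongly_measurable (X := measurableTypeR R) (@enormH0 R H ip Q) phi ->
  L1 (leb T) (fun t => (t <= b)%R%:R * ipH0 (phi t) e) /\
  E (fun w => Z w * W b e w) = intg (leb T) (fun t => (t <= b)%R%:R * ipH0 (phi t) e).
Proof.
move=> bT mphi; have [s [vs sphi cZ]] := wiener_integral_approx.
have Wb := W_L2 W_wiener F_gen e bT.
have [Lb_ [B0 LB]] : exists C : R, 0 <= C /\ forall f, measurable_fun setT (f : measurableTypeR R
  -> R) ->
    (\int[leb T]_x `|f x|%:E <= C%:E * Lnorm (leb T) 2%:E (EFin \o f))%E.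
  have [||C C0 h] := @integral_le_Lnorm _ _ _ (leb T) 2%:E.
  - by rewrite lee_fin ler1n.
  - by rewrite leb_setT.
  - by exists C.
pose D n t := ipH0 (step_fun (s n) t - phi t) e.
have N1 : (1 <= 2%:E :> \bar R)%E by rewrite lee_fin ler1n.
(* Convergence to 0 leaves finitely many terms free to be +oo, so all bounds below hold only from
   some n on. *)
have fin : \forall n \near \oo, (LqH0_enorm T 2%:E (step_fun (s n) - phi)%R < 1%:E)%E.
  by have := sphi => /fine_cvgP[+ /cvgr_lt/(_ 1%R ltr01)]; apply: filterS2 => n f1;
      rewrite -lte_fin fineK.
have bnd : \forall n \near \oo, measurable_fun setT (D n : measurableTypeR R -> R) /\
  (\int[leb T]_t `|D n t|%:E <= (Lb_ * normH0 e)%:E * LqH0_enorm T 2%:E (step_fun (s n) - phi)%R)%E.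
  apply: filterS fin => n fn; have md := bochner_enorm_lty (lt_trans fn (ltry _)).
  have mD := measurable_pairing e md; split=> //.
  rewrite (le_trans (LB _ mD))// EFinM -muleA lee_wpmul2l ?lee_fin//.
  rewrite /LqH0_enorm /bochner_enorm asboolT// (fine_normK (enormH0_seminorm H_hilbert Q) md).
  have mN := measurable_fine_norm (enormH0_seminorm H_hilbert Q) md.
  rewrite -[normH0 e]ger0_norm ?normH0_ge0// -LnormZ_real//.
  apply: le_Lnorm => //; first exact: measurable_funM.
  move=> t; rewrite [leRHS]ger0_norm ?mulr_ge0 ?normH0_ge0//.
  by rewrite mulrC; exact: ipH0_CauchySchwarz.
have cutM (g : R -> R) : L1 (leb T) g -> L1 (leb T) (fun t => (t <= b)%R%:R * g t).
  move=> Ig; have := L1_bdd (C := 1) Ig (measurable_cut b); under eq_fun do rewrite mulrC.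
  by apply=> t; case: (t <= b); rewrite ?normr1 ?normr0.
have ID : \forall n \near \oo, L1 (leb T) (D n) /\
    intg (leb T) (fun t => `|D n t|) <= Lb_ * normH0 e * fine (LqH0_enorm T 2%:E (step_fun (s n)
      - phi)).
  have h0 f : (0 <= LqH0_enorm T 2%:E (f : R -> U))%E.
    exact: esn_ge0 (bochner_enorm_seminorm (enormH0_seminorm H_hilbert Q) (leb T) N1) _.
  near=> n.
  have [mD le] : measurable_fun setT (D n : measurableTypeR R -> R) /\
    (\int[leb T]_t `|D n t|%:E <= (Lb_ * normH0 e)%:E * LqH0_enorm T 2%:E (step_fun (s n) -
      phi)%R)%E.
    by near: n.
  have n1 : (LqH0_enorm T 2%:E (step_fun (s n) - phi)%R < 1%:E)%E by near: n.
  have nf : LqH0_enorm T 2%:E (step_fun (s n) - phi) \is a fin_num.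
    by rewrite ge0_fin_numE// (lt_trans n1 (ltry _)).
  have I : L1 (leb T) (D n).
    apply/integrableP; split; first exact/measurable_EFinP.
    by rewrite (le_lt_trans le)// -(fineK nf) -EFinM ltry.
  by split=> //; rewrite -lee_fin EFin_intg ?EFinM ?fineK//; exact: L1_norm.
have cutD n t : (t <= b)%R%:R * D n t = (t <= b)%R%:R * ipH0 (step_fun (s n) t) e - (t <= b)%R%:R
  * ipH0 (phi t) e.
  by rewrite /D (bformBl (@ipH0Pl _ _ _ H_hilbert Q)) mulrBr.
have Iphi : L1 (leb T) (fun t => (t <= b)%R%:R * ipH0 (phi t) e).
  have [n _ /(_ n (leqnn n)) [I _]] := ID.
  have [Is _] := step_covariance e bT (vs n).
  have := L1B Is (cutM _ I); congr L1; apply/funext => t.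
  by rewrite cutD; ring.
split=> //.
have l1 := cvgL2_E_mul cZ Wb.
have l2 : E (fun w => step_integral W (s n) w * W b e w) @[n --> \oo] -->
    intg (leb T) (fun t => (t <= b)%R%:R * ipH0 (phi t) e).
  have := sphi => /fine_cvgP[_ c0].
  apply/cvgrPdist_le => eps eps0.
  have c1 : Lb_ * normH0 e * fine (LqH0_enorm T 2%:E (step_fun (s n) - phi)) @[n --> \oo] --> (0
    : R).
    by rewrite -[X in _ --> X](mulr0 (Lb_ * normH0 e)); apply: cvgMr; exact: c0.
  move/cvgr0Pnorm_le: c1 => /(_ _ eps0) c1.
  near=> n.
  have [I le] : L1 (leb T) (D n) /\
    intg (leb T) (fun t => `|D n t|) <= Lb_ * normH0 e * fine (LqH0_enorm T 2%:E (step_fun (s n)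
      - phi)).
    by near: n.
  have [Is ->] := step_covariance e bT (vs n).
  rewrite distrC -intgB//; under eq_fun do rewrite -cutD.
  rewrite (le_trans (norm_intg (cutM _ I)))//.
  apply: (@le_trans _ _ (intg (leb T) (fun t => `|D n t|))).
    apply: le_intg; [exact: L1_norm (cutM _ I)|exact: L1_norm|move=> t].
    by rewrite normrM ler_piMl//; case: (t <= b); rewrite ?normr1 ?normr0.
  by rewrite (le_trans le)// (le_trans (ler_norm _))//; near: n.
by rewrite -(cvg_lim _ l1)// (cvg_lim _ l2).
Unshelve. all: by end_near. Qed.

End Integral.
End WienerIntegrals.

Lemma ae_countable d (X : measurableType d) (R : realType) (mu : {measure set X -> \bar R})
  (A : Type) (D : set A) (Q : A -> X -> Prop) : countable D ->
  (forall a, D a -> {ae mu, forall x, Q a x}) -> {ae mu, forall x, forall a, D a -> Q a x}.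
Proof.
move=> /countable_injP[c c_inj] DQ.
have : {ae mu, forall x, forall n a, D a -> c a = n -> Q a x}.
  apply: ae_foralln => n.
  have [[a [Da can]]|na] := pselect (exists a, D a /\ c a = n).
    apply: filterS (DQ a Da) => x Qa b Db cbn.
    suff -> : b = a by [].
    by apply: c_inj; rewrite ?inE// cbn can.
  by apply: aeW => x a Da can; exfalso; apply: na; exists a.
by apply: filterS => x h a Da; exact: h (c a) a Da erefl.
Qed.

(** * Closability *)

Section LipschitzIntegrals.
Context d (X : measurableType d) (R : realType).
Variables (V : lmodType R) (N : V -> \bar R).
Hypothesis sN : eseminorm N.
Variables (mu : {measure set X -> \bar R}) (r : \bar R).
Hypothesis r1 : (1 <= r)%E.

Lemma Lnorm_ae0 (f : X -> R) : measurable_fun setT f -> {ae mu, forall x, f x = 0} ->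
  Lnorm mu r (EFin \o f) = 0%E.
Proof.
move=> mf f0; rewrite unlock; case: r r1 => [s|_|//].
  rewrite lee_fin => s1; have s0 : 0 < s := lt_le_trans ltr01 s1.
  rewrite (_ : (\int[mu]_x _)%E = 0%E); first by rewrite poweR_EFin powR0 ?invr_eq0 ?gt_eqF.
  rewrite (ae_eq_integral (cst 0%E))//; first exact: integral0.
    by apply/measurable_EFinP; exact: measurable_powR_norm.
  by apply: filterS f0 => x fx _ /=; rewrite fx normr0 powR0// gt_eqF.
case: ifPn => // mu0; apply: ess_sup_ae_cst => //.
by apply: filterS f0 => x fx /=; rewrite fx normr0.
Qed.

Lemma bochner_enorm_ae0 (f : X -> V) : strongly_measurable N f ->
  {ae mu, forall x, N (f x) = 0%E} -> bochner_enorm mu r N f = 0%E.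
Proof.
move=> mf f0; rewrite /bochner_enorm asboolT// (fine_normK sN mf).
apply: Lnorm_ae0; first exact: measurable_fine_norm.
by apply: filterS f0 => x /= ->.
Qed.

Variables (lam : V -> R) (C : R).
Hypotheses (C0 : 0 <= C) (lam0 : lam 0 = 0).
Hypothesis lip : forall x y, (N x < +oo -> N y < +oo ->
  `|lam x - lam y|%:E <= C%:E * N (x - y)%R)%E.
Hypothesis mu_fin : mu setT \is a fin_num.

(** Used at both stages of the iterated norm: on [0, T] for the evaluation of an operator, then on
    Omega for [pairing], whose Lipschitz constant the first use provides. *)
Lemma lip_integral : exists2 K : R, 0 <= K & forall f g : X -> V,
  (bochner_enorm mu r N f < +oo -> bochner_enorm mu r N g < +oo ->
  L1 mu (fun x => (lam (f x) - lam (g x))%R) /\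
  (intg mu (fun x => `|lam (f x) - lam (g x)|%R))%:E <= K%:E * bochner_enorm mu r N (f - g)%R)%E.
Proof.
have [K K0 KL] := integral_le_Lnorm r1 mu_fin.
exists (C * K) => [|f g foo goo]; first exact: mulr_ge0.
have sB := bochner_enorm_seminorm (d := d) (X := X) sN mu r1.
have mf := bochner_enorm_lty foo; have mg := bochner_enorm_lty goo.
have fgoo : (bochner_enorm mu r N (f - g)%R < +oo)%E.
  by rewrite (le_lt_trans (esnB sB _ _))// lte_add_pinfty.
have mfg := bochner_enorm_lty fgoo.
have ml : measurable_fun setT (fun x => lam (f x) - lam (g x)).
  by apply: measurable_funB; [exact: (strongly_measurable_lip sN lip mf)|exact:
    (strongly_measurable_lip sN lip mg)].
have mn := measurable_fine_norm sN mfg.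
have le : (\int[mu]_x `|lam (f x) - lam (g x)|%:E <= (C * K)%:E * bochner_enorm mu r N (f - g)%R)%E.
  rewrite /bochner_enorm asboolT// (fine_normK sN mfg) EFinM -muleA.
  have := KL _ mn; move=> /(lee_wpmul2l (x := C%:E)) h.
  apply: le_trans (h _); last by rewrite lee_fin.
  have mn' : measurable_fun setT (fun x => `|(fine \o (N \o (f - g))) x|).
    exact: measurableT_comp.
  rewrite -ge0_integralZl//; last exact/measurable_EFinP.
  apply: ge0_le_integral => //.
  - by apply/measurable_EFinP; exact: measurableT_comp.
  - by apply/measurable_EFinP; apply: measurable_funM.
  move=> x _; rewrite -EFinM /=.
  have xoo : (N (f x - g x)%R < +oo)%E := strongly_measurable_lty sN x mfg.
  rewrite [X in C * X]ger0_norm ?fine_ge0 ?(esn_ge0 sN)// EFinM fineK ?ge0_fin_numE ?(esn_ge0 sN)//.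
  by apply: lip; exact: (strongly_measurable_lty sN).
have B0 : (0 <= bochner_enorm mu r N (f - g)%R)%E := esn_ge0 sB _.
have I : L1 mu (fun x => lam (f x) - lam (g x)).
  apply/integrableP; split; first exact/measurable_EFinP.
  rewrite (le_lt_trans le)// -(@fineK _ (bochner_enorm mu r N (f - g)%R)) ?ge0_fin_numE//.
  by rewrite -EFinM ltry.
by split=> //; rewrite EFin_intg//; exact: L1_norm.
Qed.

Lemma lip_L1 (f : X -> V) : (bochner_enorm mu r N f < +oo)%E -> L1 mu (fun x => lam (f x)).
Proof.
move=> foo; have [K K0 h] := lip_integral.
have sB := bochner_enorm_seminorm (d := d) (X := X) sN mu r1.
have oo0 : (bochner_enorm mu r N (0%R : X -> V) < +oo)%E by rewrite (esn0 sB).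
have [+ _] := h f 0 foo oo0; congr L1; apply/funext => x.
by rewrite lam0 subr0.
Qed.

End LipschitzIntegrals.

Section MomentsLnorm.
Context (R : realType) d (Omega : measurableType d) (P : probability Omega R).

Lemma moments_Lnorm (X : Omega -> R) (p : R) : 1 <= p -> moments P X ->
  (Lnorm P p%:E (EFin \o X) < +oo)%E.
Proof.
move=> p1 [mX kX]; rewrite unlock.
have p0 : 0 < p := lt_le_trans ltr01 p1.
(* The real exponent p is dominated by the integer one: |x|^p <= 1 + |x|^(k+1). *)
pose k := Num.truncn p; have pk : p <= k.+1%:R by exact/ltW/truncnS_gt.
have I : L1 P (fun w => 1 + `|X w| ^+ k.+1).
  by apply: L1D => //; exact: finite_measure_integrable_cst.
have le w : `|X w| `^ p <= 1 + `|X w| ^+ k.+1.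
  have [x1|/ltW x1] := leP `|X w| 1.
    rewrite (@le_trans _ _ 1) ?lerDl ?exprn_ge0//.
    have -> : 1 = 1 `^ p :> R by rewrite powR1.
    by rewrite ge0_ler_powR ?nnegrE// ltW.
  rewrite -powR_mulrn// (@le_trans _ _ (`|X w| `^ k.+1%:R)) ?lerDr//.
  exact: ler_powR.
have Ip : L1 P (fun w => `|X w| `^ p).
  apply: (L1_le _ _ I) => [|w]; first exact: measurable_powR_norm.
  by rewrite ger0_norm ?powR_ge0// (le_trans (le w)) ?ler_norm.
rewrite (_ : (\int[P]_x _)%E = (intg P (fun w => `|X w| `^ p))%:E); last by rewrite EFin_intg.
by rewrite poweR_EFin ltry.
Qed.

End MomentsLnorm.

(** * Totality of the cosines *)

Section ChaosTotal.
Variables (R : realType) (T : R) (H : completeNormedModType R) (ip : {dot H for idfun}).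
Hypothesis T_ge0 : 0 <= T.
Hypothesis H_hilbert : inner_product_norm ip.
Variable Q : {linear H -> H}.
Local Notation U := (H0 ip Q).
Context d (Omega : measurableType d) (P : probability Omega R).
Variable W : R -> U -> Omega -> R.
Hypothesis W_wiener : cylindrical_wiener P (natural_filtration W) T W.
Hypothesis F_gen : @measurable d Omega = natural_filtration W T.
Local Notation E := (intg P).

(** With half-line constraints, concatenating lists intersects events, and the indicator is a
    product of the multipliers given by [multiplier_lt]. *)
Let cylinder (l : seq (R * U * R)) : set Omega :=
  [set w | all (fun x => W x.1.1 x.1.2 w < x.2) l].

Let cylinders : set (set Omega) := [set A | exists l : seq (R * U * R),
  all (fun x => 0 <= x.1.1 <= T) l /\ A = cylinder l].

Let cylinders_setI : setI_closed cylinders.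
Proof.
move=> A B [l [vl ->]] [l' [vl' ->]]; exists (l ++ l'); rewrite all_cat vl vl'; split=> //.
apply/seteqP; split=> w; rewrite /cylinder /= all_cat; first by case=> -> ->.
by move=> /andP.
Qed.

Let measurable_cylinder l : all (fun x => 0 <= x.1.1 <= T) l -> measurable (cylinder l).
Proof.
elim: l => [_|x l IH /= /andP[xT vl]].
  by rewrite (_ : cylinder [::] = setT)//; apply/seteqP; split.
rewrite (_ : cylinder _ = W x.1.1 x.1.2 @^-1` `]-oo, x.2[%classic `&` cylinder l); last first.
  by apply/seteqP; split=> w; rewrite /cylinder /= in_itv/=; [move=> /andP[]|case=> -> ->].
apply: measurableI; last exact: IH.
apply: (measurable_preimage (W_measurable W_wiener F_gen x.1.2 xT)); exact: measurable_itv.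
Qed.

Let cylinders_generate : @measurable d Omega = <<s cylinders >>.
Proof.
apply/seteqP; split; last first.
  apply: smallest_sub; first exact: sigma_algebra_measurable.
  by move=> A [l [vl ->]]; exact: measurable_cylinder.
rewrite F_gen; apply: smallest_sub; first exact: smallest_sigma_algebra.
move=> A [s [u [C [s0 sT mC ->]]]].
have mW : @measurable_fun _ _ (g_sigma_algebraType cylinders) (measurableTypeR R) setT (W s u).
  apply: (@measurability _ _ (g_sigma_algebraType cylinders) (measurableTypeR R) setT (W s u) _
    (RGenInftyO.measurableE R)).
  move=> _ [_ [x ->] <-]; rewrite setTI; apply: sub_gen_smallest.
  exists [:: (s, u, x)]; rewrite /= s0 sT; split=> //.
  by apply/seteqP; split=> w; rewrite /cylinder /= in_itv/= andbT.
by have := mW measurableT C mC; rewrite setTI.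
Qed.

Variable Y : Omega -> R.
Hypothesis IY : L1 P Y.
Hypothesis Y_chaos : forall l b, valid_times T l -> E (fun w => Y w * cos (chaos W l w + b)) = 0.

Let V (psi : Omega -> R) := [/\ measurable_fun setT psi, exists C : R, forall w, `|psi w| <= C &
  forall l b, valid_times T l -> E (fun w => Y w * psi w * cos (chaos W l w + b)) = 0].

Let mchaos l : valid_times T l -> measurable_fun setT (chaos W l).
Proof. by move=> vl; exact: (chaos_L2 W_wiener F_gen vl).1. Qed.

Let IV (psi : Omega -> R) l b : measurable_fun setT psi -> (exists C : R, forall w, `|psi w| <=
  C) ->
  valid_times T l -> L1 P (fun w => Y w * psi w * cos (chaos W l w + b)).
Proof.
move=> mpsi [C psiC] vl; apply: (L1_bdd (C := 1)); first exact: L1_bdd psiC.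
  by apply: measurable_cos_comp; apply: measurable_funD => //; exact: mchaos.
by move=> w; exact: norm_cos_le1.
Qed.

Let VP (a : R) (f g : Omega -> R) : V f -> V g -> V (fun w => a * f w + g w).
Proof.
move=> [m1 b1 e1] [m2 b2 e2]; split.
- by apply: measurable_funD => //; exact: measurable_funM.
- have [C gC] := b1; have [D gD] := b2; exists (`|a| * C + D) => w.
  by rewrite (le_trans (ler_normD _ _))// normrM lerD// ler_wpM2l.
- move=> l b vl.
  transitivity (E (fun w => a * (Y w * f w * cos (chaos W l w + b)) + Y w * g w * cos (chaos W l
    w + b))).
    by congr intg; apply/funext => w; ring.
  by rewrite intgP ?e1 ?e2//; [rewrite mulr0 addr0|exact: IV|exact: IV].
Qed.

Let Vlim (f_ : nat -> Omega -> R) (f : Omega -> R) (C : R) : (forall k, V (f_ k)) ->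
  (forall k w, `|f_ k w| <= C * 1) -> (forall w, f_ k w @[k --> \oo] --> f w) -> V f.
Proof.
move=> Vf fC ff; have mf k : measurable_fun setT (f_ k) by have [] := Vf k.
have bf k : exists K : R, forall x, `|f_ k x| <= K by have [] := Vf k.
split.
- by apply: (@measurable_fun_cvg _ _ _ _ f_) => // w _; exact: ff.
- exists (C * 1) => w; apply: (cvgr_to_le (cvg_norm (ff w))).
  by apply: nearW => k; exact: fC.
move=> l b vl.
have h1 k w : `|Y w * f_ k w * cos (chaos W l w + b)| <= `|C * 1| * `|Y w|.
  rewrite normrM normrM (le_trans (_ : _ <= `|Y w| * `|f_ k w|))//.
    by rewrite ler_piMr// norm_cos_le1.
  by rewrite mulrC ler_wpM2r// (le_trans (fC k w))// ler_norm.
have h2 w : Y w * f_ k w * cos (chaos W l w + b) @[k --> \oo] --> Y w * f w * cos (chaos W l w + b).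
  by apply: cvgMl; apply: cvgMr; exact: ff.
have [_ l1] := intg_dct (fun k => L1_measurable (IV b (mf k) (bf k) vl))
   (L1Z `|C * 1| (L1_norm IY)) h1 h2.
have e k : E (fun w => Y w * f_ k w * cos (chaos W l w + b)) = 0 by have [_ _] := Vf k; exact.
move: l1; under eq_fun do rewrite e.
by move=> l1; rewrite -(cvg_lim _ l1)// lim_cst.
Qed.

Let V1 : V (fun=> 1).
Proof.
split=> [//||l b vl]; first by exists 1 => w; rewrite normr1.
by under eq_fun do rewrite mulr1; exact: Y_chaos.
Qed.

Let V_cos t u s b : 0 <= t <= T -> multiplier V (fun w => cos (s * W t u w + b)).
Proof.
move=> tT; split; first by exists 1 => w; exact: norm_cos_le1.
have mW := W_measurable W_wiener F_gen u tT.
move=> f [[mf bf ef] _]; split.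
- apply: measurable_funM => //; apply: measurable_cos_comp.
  by apply: measurable_funD => //; exact: measurable_funM.
- by have [C gC] := bf; exists C => w; rewrite normrM (le_trans _ (gC w))// ler_piMr// norm_cos_le1.
move=> l b' vl.
(* The product-to-sum formula turns the extra cosine into two longer lists, up to the null sets
   where [W] is not homogeneous. *)
pose l1 := (t, s *: u) :: l; pose l2 := (t, - s *: u) :: l.
have v1 : valid_times T l1 by rewrite /= tT.
have v2 : valid_times T l2 by rewrite /= tT.
transitivity (E (fun w => 2^-1 * (Y w * f w * cos (chaos W l1 w + (b' + b))) +
   2^-1 * (Y w * f w * cos (chaos W l2 w + (b' - b))))); last first.
  rewrite intgP ?intgZ ?ef// ?mulr0 ?addr0//; [exact: IV|exact: IV|apply: L1Z; exact: IV].
apply: eq_intg_ae.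
- apply: measurable_funM; last first.
    by apply: measurable_cos_comp; apply: measurable_funD => //; exact: mchaos.
  apply: measurable_funM; first exact: L1_measurable IY.
  apply: measurable_funM => //; apply: measurable_cos_comp.
  by apply: measurable_funD => //; exact: measurable_funM.
- by apply: (@L1_measurable _ _ _ P); apply: L1P; [exact: IV|apply: L1Z; exact: IV].
apply: filterS2 (W_scale_ae H_hilbert W_wiener F_gen s u tT) (W_scale_ae H_hilbert W_wiener F_gen
  (- s) u tT) => w e1 e2.
rewrite !chaos_cons /= e1 e2.
rewrite [LHS](_ : _ = Y w * f w * (cos (s * W t u w + b) * cos (chaos W l w + b'))); last by ring.
rewrite mul_coscos.
rewrite (_ : s * W t u w + b + (chaos W l w + b') = s * W t u w + chaos W l w + (b' + b));
  last by ring.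
rewrite -(cosN (s * W t u w + b - _)).
rewrite (_ : - (s * W t u w + b - (chaos W l w + b')) = - s * W t u w + chaos W l w + (b' - b));
  ring.
Qed.

Let V_cylinder l : all (fun x => 0 <= x.1.1 <= T) l -> multiplier V (\1_(cylinder l) : Omega -> R).
Proof.
elim: l => [_|x l IH /= /andP[xT vl]].
  have := multiplier1 V; congr multiplier; apply/funext => w.
  by rewrite indicE mem_set.
have m1 : multiplier V (fun w => (W x.1.1 x.1.2 w < x.2)%R%:R).
  apply: (@multiplier_lt R Omega V (fun=> 1) (fun=> lexx 1) VP Vlim (W x.1.1 x.1.2) x.2) => s b.
  exact: V_cos.
have := multiplierM m1 (IH vl); congr multiplier; apply/funext => w.
rewrite !indicE -natrM mulnb; congr (nat_of_bool _)%:R.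
by rewrite /cylinder !mem_setE.
Qed.

(* The bounded [psi] with [E (Y * psi * cos (chaos l + b)) = 0] for all [l] and [b]
   are stable under multiplication by [cos (s * W t u + b)], hence contain the
   indicators of the events [W t1 u1 < a1, ..., W tk uk < ak]. *)
Lemma chaos_total : {ae P, forall w, Y w = 0}.
Proof.
apply: (ae0_of_pi_system cylinders_generate cylinders_setI IY).
  have := Y_chaos 0 (isT : valid_times T ([::] : seq (R * U))); rewrite /chaos.
  by under eq_fun do rewrite big_nil addr0 cos0 mulr1.
move=> A [l [vl ->]].
have [_ /(_ (fun=> 1))] := V_cylinder vl.
case; first by split; [exact: V1|exists 1 => w; rewrite normr1].
move=> _ _ /(_ [::] 0 isT); rewrite /chaos.
by under eq_fun do rewrite big_nil addr0 cos0 mulr1 mul1r.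
Qed.

End ChaosTotal.

(** * Functions with vanishing integrals over initial segments *)

Section Rays.
Variable R : realType.

Lemma L1_cut (T b : R) (k : R -> R) : L1 (leb T) k -> L1 (leb T) (fun t => (t <= b)%R%:R * k t).
Proof.
move=> Ik; have := L1_bdd (C := 1) Ik (measurable_cut b); under eq_fun do rewrite mulrC.
by apply=> t; case: (t <= b); rewrite ?normr1 ?normr0.
Qed.

Lemma leb_ae_eq (T : R) (f g : R -> R) : L1 (leb T) f -> L1 (leb T) g ->
  (forall t, 0 <= t <= T -> f t = g t) -> intg (leb T) f = intg (leb T) g.
Proof.
move=> If Ig fg; apply: eq_intg_ae; [exact: L1_measurable If|exact: L1_measurable Ig|].
have mD : measurable (~` `[0, T] : set (measurableTypeR R)) by apply: measurableC;
  exact: measurable_itv.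
exists (~` `[0, T]); split => //; first exact: leb_compl.
by apply: subsetC => t; rewrite /= in_itv/=; exact: fg.
Qed.

(** Rational end points keep the family of test elements countable, and clipping keeps them in
    [0, T], where W(b)e is defined as a Brownian value. The half-lines ]x, +oo[ then serve as
    pi-system. *)
Lemma leb_ae0_of_rays (T : R) (k : R -> R) : 0 <= T -> L1 (leb T) k ->
  (forall r : rat, intg (leb T) (fun t => (t <= Num.min (Num.max (ratr r) 0) T)%R%:R * k t) = 0) ->
  {ae leb T, forall t, k t = 0}.
Proof.
move=> T0 Ik k0.
have cut0 x : intg (leb T) (fun t => (t <= x)%R%:R * k t) = 0.
  have [x0|x0] := ltP x 0.
    rewrite (@leb_ae_eq _ _ (fun=> 0))//; [by rewrite leb_intg_cst// mul0r|exact: L1_cut|exact: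
      L1_0|].
    by move=> t /andP[t0 _]; rewrite leNgt (lt_le_trans x0 t0) mul0r.
  (* Approximation from above, since the indicator of t <= b is right-continuous in b. *)
  have /choice[r rx] : forall n : nat, exists r : rat, x < ratr r < x + n.+1%:R^-1.
    move=> n; have : x < x + n.+1%:R^-1 by rewrite ltrDl invr_gt0.
    by move=> /rat_in_itvoo[r]; rewrite in_itv/= => rx; exists r.
  have e n : intg (leb T) (fun t => (t <= ratr (r n))%R%:R * k t) = 0.
    rewrite -[RHS](k0 (r n)); apply: leb_ae_eq; [exact: L1_cut|exact: L1_cut|].
    move=> t /andP[t0 tT]; have /andP[xr _] := rx n.
    by rewrite max_l ?(ltW (le_lt_trans x0 xr))// le_min tT andbT.
  have h0 n : measurable_fun setT (fun t : measurableTypeR R => (t <= ratr (r n))%R%:R * k t).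
    exact: L1_measurable (L1_cut _ Ik).
  have h1 n t : `|(t <= ratr (r n))%R%:R * k t| <= `|k t|.
    by rewrite normrM ler_piMl//; case: (t <= _); rewrite ?normr1 ?normr0.
  have h2 t : (t <= ratr (r n))%R%:R * k t @[n --> \oo] --> (t <= x)%R%:R * k t.
    apply: cvgMl; apply: cvg_near_cst.
    have [tx|xt] := leP t x.
      by apply: nearW => n; have /andP[xr _] := rx n; rewrite (le_trans tx (ltW xr)).
    near=> n.
    have /andP[_ rn] := rx n; rewrite leNgt (lt_trans rn)// -ltrBrDl.
    by near: n; apply: near_infty_natSinv_lt (PosNum (_ : 0 < t - x)); rewrite subr_gt0.
  have [_ l1] := intg_dct h0 (L1_norm Ik) h1 h2.
  move: l1; under eq_fun do rewrite e.
  by move=> l1; rewrite -(cvg_lim _ l1)// lim_cst.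
have kT : intg (leb T) k = 0.
  rewrite -(cut0 T); apply: leb_ae_eq; [exact: Ik|exact: L1_cut|].
  by move=> t /andP[_ ->]; rewrite mul1r.
apply: (ae0_of_pi_system (RGenOInfty.measurableE R) _ Ik kT).
  move=> _ _ [x ->] [y ->]; exists (Num.max x y).
  by apply/seteqP; split=> t; rewrite /= !in_itv/= !andbT gt_max; [case=> -> ->|move=> /andP[]].
move=> _ [x ->].
transitivity (intg (leb T) k - intg (leb T) (fun t => (t <= x)%R%:R * k t));
  last by rewrite kT cut0 subrr.
rewrite -intgB; [|exact: Ik|exact: L1_cut]; congr intg; apply/funext => t.
by rewrite indicE mem_setE in_itv/= andbT; case: (leP t x) => _;
  rewrite ?mulr0 ?mulr1 ?mul1r ?mul0r ?subrr ?subr0.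
Unshelve. all: by end_near. Qed.

End Rays.

(** * Pairings with elementary tensors *)

Section Pairing.
Variables (R : realType) (T : R) (H : completeNormedModType R) (ip : {dot H for idfun}).
Hypothesis T_ge0 : 0 <= T.
Hypothesis H_hilbert : inner_product_norm ip.
Hypothesis H_separable : separable H.
Variable Q : {linear H -> H}.
Variable q : \bar R.
Hypothesis q1 : (1 <= q)%E.
Local Notation U := (H0 ip Q).
Local Notation hs := (@hs_enorm R H ip Q).
Local Notation basis := (@basisH0 R H ip Q).
Local Notation Nq := (bochner_enorm (leb T) q hs).

(** The pairing of g with 1_[0,b] e (x) h. *)
Definition pairing b (e : U) (h : H) (g : R -> U -> H) : R :=
  intg (leb T) (fun t => (t <= b)%R%:R * ip (g t e) h).

Let lam (e : U) (h : H) (A : U -> H) : R := ip (A e) h.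

Let ipB x y h : ip (x - y) h = ip x h - ip y h.
Proof. exact: (bformBl (dotPl ip)). Qed.

Let lam_lip e h A B : basis e -> (hs A < +oo -> hs B < +oo ->
  `|lam e h A - lam e h B|%:E <= `|h|%:E * hs (A - B)%R)%E.
Proof.
move=> be _ _; rewrite /lam -ipB.
apply: (@le_trans _ _ (`|h|%:E * `|A e - B e|%:E)%E).
  by rewrite -EFinM lee_fin mulrC; exact: dot_CauchySchwarz.
by apply: lee_wpmul2l; [rewrite lee_fin|exact: (hs_ge (A - B) be)].
Qed.

Let lam0 e h : lam e h 0 = 0.
Proof. exact: (bform0l (dotPl ip)). Qed.

Let leb_fin : leb T setT \is a fin_num.
Proof. by rewrite leb_setT. Qed.

Lemma L1_pairing e h g : basis e -> (Nq g < +oo)%E -> L1 (leb T) (fun t => ip (g t e) h).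
Proof.
move=> be goo.
exact: (@lip_L1 _ _ _ _ _ (hs_seminorm ip Q) (leb T) q q1 (lam e h) `|h| (normr_ge0 h) (lam0 e h)
  (fun A B => lam_lip h (A := A) (B := B) be) leb_fin g goo).
Qed.

Lemma pairing_lip b e h : basis e -> exists2 K : R, 0 <= K & forall f g,
  (Nq f < +oo -> Nq g < +oo -> `|pairing b e h f - pairing b e h g|%:E <= K%:E * Nq (f - g)%R)%E.
Proof.
move=> be.
have [K K0 Kfg] := @lip_integral _ _ _ _ _ (hs_seminorm ip Q) (leb T) q q1 (lam e h) `|h|
  (normr_ge0 h) (fun A B => lam_lip h (A := A) (B := B) be) leb_fin.
exists K => // f g foo goo; have [I le] := Kfg f g foo goo.
apply: le_trans le; rewrite lee_fin /pairing.
have If := L1_pairing h be foo; have Ig := L1_pairing h be goo.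
rewrite -intgB; [|exact: L1_cut|exact: L1_cut].
have Id : L1 (leb T) (fun t => (t <= b)%R%:R * ip (f t e) h - (t <= b)%R%:R * ip (g t e) h).
  by apply: L1B; exact: L1_cut.
rewrite (le_trans (norm_intg Id))//; apply: le_intg; [exact: L1_norm|exact: L1_norm|move=> t].
by rewrite -mulrBr normrM ler_piMl//; case: (t <= b); rewrite ?normr1 ?normr0.
Qed.

Lemma pairing0 b e h : pairing b e h 0 = 0.
Proof.
rewrite /pairing (_ : (fun t => _) = fun=> 0); first by rewrite leb_intg_cst// mul0r.
by apply/funext => t; rewrite [ip _ _](lam0 e h) mulr0.
Qed.

(** Vanishing for all r kills <g(t) e, h> for almost every t. Countability of the basis and of D
    yields one null set for all e and h, and density of D gives g(t) e = 0. *)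
Lemma pairing_separates (D : set H) g : countable D -> dense D -> (Nq g < +oo)%E ->
  (forall e h (r : rat), basis e -> D h ->
     pairing (Num.min (Num.max (ratr r) 0) T) e h g = 0) -> Nq g = 0%E.
Proof.
move=> cD dD goo g0; have mg := bochner_enorm_lty goo.
apply: (bochner_enorm_ae0 (hs_seminorm ip Q) q1 mg).
have cE : countable basis by exact: basisH0_countable.
have : {ae leb T, forall t, forall e, basis e -> forall h, D h -> ip (g t e) h = 0}.
  apply: ae_countable cE _ => e be; apply: ae_countable cD _ => h Dh.
  by apply: leb_ae0_of_rays => //; [exact: L1_pairing|move=> r; exact: g0].
apply: filterS => t gt0; apply: hs_eq0 => //.
  by apply: hs_lty; exact: (strongly_measurable_lty (hs_seminorm ip Q) t mg).
move=> e be; apply: (dot_eq0_dense H_hilbert dD) => h Dh; exact: gt0.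
Qed.

End Pairing.

(** * Duality for the Malliavin derivative *)

Section MalliavinDerivative.
Variables (R : realType) (T : R) (H : completeNormedModType R) (ip : {dot H for idfun}).
Hypothesis T_ge0 : 0 <= T.
Hypothesis H_hilbert : inner_product_norm ip.
Variable Q : {linear H -> H}.
Local Notation U := (H0 ip Q).
Context d (Omega : measurableType d) (P : probability Omega R).
Variable W : R -> U -> Omega -> R.
Hypothesis W_wiener : cylindrical_wiener P (natural_filtration W) T W.
Hypothesis F_gen : @measurable d Omega = natural_filtration W T.
Variables (p : R) (q : \bar R).
Hypotheses (p1 : 1 <= p) (q1 : (1 <= q)%E).
Local Notation E := (intg P).
Local Notation hs := (@hs_enorm R H ip Q).
Local Notation Nq := (bochner_enorm (leb T) q hs).
Local Notation S := (first_chaos T P W).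

Let p1E : (1 <= p%:E)%E. Proof. by rewrite lee_fin. Qed.

Let S_P (a : R) X Y : S X -> S Y -> S (fun w => a * X w + Y w) :=
  first_chaosP H_hilbert W_wiener F_gen a (X := X) (Y := Y).
Let S_L2 X : S X -> L2 P X := first_chaos_L2 (X := X).
Let S_gaussian X : S X -> gaussian P X := first_chaos_gaussian T_ge0 H_hilbert W_wiener F_gen (X
  := X).
Let S_W b e : 0 <= b <= T -> S (W b e). Proof. exact: first_chaos_W. Qed.

Let S0 : S (W 0 0). Proof. by apply: S_W; rewrite lexx T_ge0. Qed.

Let moments_f n (Z : 'I_n -> Omega -> R) (f : 'rV[R]_n -> R) (C : R) m : (forall j, S (Z j)) ->
  continuous f -> (forall x, `|f x| <= C * (1 + \sum_j `|x 0 j|) ^+ m) ->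
  moments P (fun w => f (\row_j Z j w)).
Proof.
by move=> SZ cf fC; apply: (moments_poly_growth S_P S_L2 S_gaussian 0 SZ S0 S0 cf fC).
Qed.

Let cut_ipH0_sum b e n (a : 'I_n -> R) (g : 'I_n -> R -> U) t :
  (t <= b)%R%:R * ipH0 (\sum_j a j *: g j t) e = \sum_j a j * ((t <= b)%R%:R * ipH0 (g j t) e) :> R.
Proof.
rewrite (bform_suml (@ipH0Pl _ _ _ H_hilbert Q)) mulr_sumr; apply: eq_bigr => j _.
by rewrite (bformZl (@ipH0Pl _ _ _ H_hilbert Q)) mulrCA.
Qed.

(** This is [malliavin_ibp] with Y = W(b)e: the coefficient c_j = E[Z_j W(b)e] is the integral of
    <phi_j, e> over [0, b], so the sum of the c_j times the partial derivatives is the pairing of DF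
    with 1_[0,b] e. *)
Lemma malliavin_duality F DF b e X0 b0 : malliavin P T W q F DF -> 0 <= b <= T -> S X0 ->
  let G w := intg (leb T) (fun t => (t <= b)%R%:R * ipH0 (DF w t) e) in
  [/\ moments P F, moments P G, forall w, L1 (leb T) (fun t => (t <= b)%R%:R * ipH0 (DF w t) e) &
    E (fun w => F w * skorokhod P (W b e) X0 b0 w) = E (fun w => G w * cos (X0 w + b0))].
Proof.
move=> [n [phi [Z [f [phiq IZ Cf -> ->]]]]] bT SX0 G.
have SZ j : S (Z j) := wiener_integral_first_chaos H_hilbert W_wiener F_gen (IZ j).
have [C [m [C0 fC]]] := C1_growth Cf.
have [C' [m' [C'0 fC']]] := partial_growth Cf.
have [df cpf _] := Cf.
have mF := moments_f SZ (C1_continuous Cf) fC.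
have mpF j := moments_f SZ (cpf j) (fC' j).
have cov j := wiener_integral_covariance T_ge0 H_hilbert W_wiener F_gen (IZ j) e bT
  (bochner_enorm_lty (phiq j)).
have I w : L1 (leb T) (fun t => (t <= b)%R%:R * ipH0 (\sum_j partial j f (\row_k Z k w) *: phi j
  t) e).
  under [X in L1 _ X]eq_fun do rewrite cut_ipH0_sum.
  by apply: L1_sum => j; apply: L1Z; exact: (cov j).1.
have GE w : G w = \sum_j E (fun w => Z j w * W b e w) * partial j f (\row_k Z k w).
  rewrite /G; under eq_fun do rewrite cut_ipH0_sum.
  rewrite intg_sum => [|j]; last by apply: L1Z; exact: (cov j).1.
  by apply: eq_bigr => j _; rewrite intgZ ?(cov j).2 1?mulrC//; exact: (cov j).1.
have mG : moments P G.
  rewrite (_ : G = fun w => \sum_j E (fun w => Z j w * W b e w) * partial j f (\row_k Z k w));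
    last exact/funext.
  by apply: moments_sum => j; apply: momentsM => //; exact: moments_cst.
split=> //.
rewrite (malliavin_ibp S_P S_L2 S_gaussian b0 SZ (S_W e bT) SX0 Cf).
have mc : moments P (fun w => cos (X0 w + b0)).
  apply: (@moments_bounded _ _ _ _ _ 1) => [|w]; last exact: norm_cos_le1.
  by apply: measurable_cos_comp; apply: measurable_funD => //; exact: (S_L2 SX0).1.
under [in RHS]eq_fun do rewrite GE mulr_suml.
rewrite intg_sum => [|j]; last first.
  by apply: moments_L1; apply: momentsM => //; apply: momentsM => //; exact: moments_cst.
apply: eq_bigr => j _; rewrite -intgZ; last by apply: moments_L1; exact: momentsM.
by congr intg; apply/funext => w; rewrite mulrA.
Qed.

Let ip_sum n (F : 'I_n -> R) (h : 'I_n -> H) (x : H) :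
  ip (\sum_j F j *: h j) x = \sum_j F j * ip (h j) x.
Proof.
rewrite (bform_suml (dotPl ip)); apply: eq_bigr => j _.
exact: (bformZl (dotPl ip)).
Qed.

Lemma malliavinH_duality X DX b e h X0 b0 : malliavinH P T W q X DX -> 0 <= b <= T -> S X0 ->
  E (fun w => ip (X w) h * skorokhod P (W b e) X0 b0 w) =
  E (fun w => pairing T b e h (DX w) * cos (X0 w + b0)).
Proof.
move=> [n [k [F [DF [FDF -> ->]]]]] bT SX0.
have dual j := malliavin_duality e b0 (FDF j) bT SX0.
pose G j w := intg (leb T) (fun t => (t <= b)%R%:R * ipH0 (DF j w t) e).
have mxi : moments P (skorokhod P (W b e) X0 b0).
  exact: (moments_skorokhod S_P S_L2 S_gaussian b0 (S_W e bT) SX0).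
have mc : moments P (fun w => cos (X0 w + b0)).
  apply: (@moments_bounded _ _ _ _ _ 1) => [|w]; last exact: norm_cos_le1.
  by apply: measurable_cos_comp; apply: measurable_funD => //; exact: (S_L2 SX0).1.
have e1 w : pairing T b e h (fun t => \sum_j tensor (k j) (DF j w t)) = \sum_j ip (k j) h * G j w.
  rewrite /pairing (_ : (fun t => _) =
    (fun t => \sum_j ip (k j) h * ((t <= b)%R%:R * ipH0 (DF j w t) e))); last first.
    apply/funext => t; rewrite fct_sumE /tensor ip_sum mulr_sumr; apply: eq_bigr => j _; ring.
  rewrite intg_sum => [|j]; last by apply: L1Z; have [_ _ + _] := dual j; exact.
  by apply: eq_bigr => j _; rewrite intgZ//; have [_ _ + _] := dual j; exact.
under [in RHS]eq_fun do rewrite e1 mulr_suml.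
under [in LHS]eq_fun do rewrite ip_sum mulr_suml.
rewrite intg_sum => [|j]; last first.
  have [mF _ _ _] := dual j; apply: moments_L1; apply: momentsM => //.
  by apply: momentsM => //; exact: moments_cst.
rewrite intg_sum => [|j]; last first.
  have [_ mG _ _] := dual j; apply: moments_L1; apply: momentsM => //.
  by apply: momentsM => //; exact: moments_cst.
apply: eq_bigr => j _; have [mF mG _ eFG] := dual j.
transitivity (ip (k j) h * E (fun w => F j w * skorokhod P (W b e) X0 b0 w)).
  rewrite -intgZ; last by apply: moments_L1; exact: momentsM.
  by congr intg; apply/funext => w; ring.
rewrite eFG -intgZ; last by apply: moments_L1; exact: momentsM.
by congr intg; apply/funext => w; rewrite mulrA.
Qed.

Lemma malliavinH_dom X DX : malliavinH P T W q X DX -> (LpH_enorm P p X < +oo)%E.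
Proof.
move=> [n [k [F [DF [FDF -> _]]]]].
have -> : (fun w => \sum_j F j w *: k j) = \sum_j (fun w => F j w *: k j) by rewrite fct_sumE.
apply: (esn_sum_lty (bochner_enorm_seminorm (enormH_seminorm H) P p1E)) => j.
have bT : 0 <= (0 : R) <= T by rewrite lexx T_ge0.
have [mF _ _ _] := malliavin_duality 0 0 (FDF j) bT S0.
by apply: (bochner_enorm_scale_lty (enormH_seminorm H)) => //;
  [exact: mF.1|exact: moments_Lnorm|exact: ltry].
Qed.

(** The derivative is a finite double sum of random scalars with all moments times fixed elements k
    (x) phi of L^q([0, T], L_2(H_0, H)). *)
Lemma malliavinH_cod X DX : malliavinH P T W q X DX -> (LpLqHS_enorm P T p q DX < +oo)%E.
Proof.
move=> [n [k [F [DF [FDF _ ->]]]]].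
have sq := bochner_enorm_seminorm (hs_seminorm ip Q) (leb T) q1.
have -> : (fun w t => \sum_j tensor (k j) (DF j w t)) = \sum_j (fun w t => tensor (k j) (DF j w t)).
  by rewrite fct_sumE; apply/funext => w; rewrite fct_sumE.
apply: (esn_sum_lty (bochner_enorm_seminorm sq P p1E)) => j.
have [m [phi [Z [f [phiq IZ Cf _ ->]]]]] := FDF j.
have SZ i : S (Z i) := wiener_integral_first_chaos H_hilbert W_wiener F_gen (IZ i).
have [C' [m' [C'0 fC']]] := partial_growth Cf.
have [_ cpf _] := Cf.
have mpF i := moments_f SZ (cpf i) (fC' i).
have -> : (fun w t => tensor (k j) (\sum_i partial i f (\row_k Z k w) *: phi i t)) =
    \sum_i (fun w => partial i f (\row_k Z k w) *: (fun t => tensor (k j) (phi i t))).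
  rewrite fct_sumE; apply/funext => w; rewrite fct_sumE; apply/funext => t; rewrite fct_sumE.
  apply/funext => u; rewrite /tensor (bform_suml (@ipH0Pl _ _ _ H_hilbert Q)) scaler_suml.
  by apply: eq_bigr => i _; rewrite (bformZl (@ipH0Pl _ _ _ H_hilbert Q)) -scalerA.
apply: (esn_sum_lty (bochner_enorm_seminorm sq P p1E)) => i.
apply: (bochner_enorm_scale_lty sq) => //; [exact: (mpF i).1|exact: moments_Lnorm|].
apply: (bochner_enorm_image_lty (enormH0_seminorm H_hilbert Q) (hs_seminorm ip Q)
  (normr_ge0 (k j)) _ _ q1 (phiq i)) => [x y|x].
  exact: tensorB.
exact: hs_tensor_le.
Qed.

End MalliavinDerivative.

(** Here p > 1 enters: the conjugate exponent p' is finite, so all moments of xi suffice for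
    Hoelder's inequality. *)
Lemma E_ip_le_LpH (R : realType) (H : completeNormedModType R) (ip : {dot H for idfun})
  (H_hilbert : inner_product_norm ip)
  d (Omega : measurableType d) (P : probability Omega R) (p : R) (h : H) (xi : Omega -> R) :
  1 < p -> moments P xi -> exists2 C : R, 0 <= C & forall X : Omega -> H,
  (LpH_enorm P p X < +oo ->
   `|intg P (fun w => ip (X w) h * xi w)%R|%:E <= C%:E * LpH_enorm P p X)%E.
Proof.
move=> p_gt1 mxi; have p0 : 0 < p := lt_trans ltr01 p_gt1.
pose p' := (1 - p^-1)^-1.
have p'D : 0 < 1 - p^-1 by rewrite subr_gt0 invf_lt1.
have p'0 : 0 < p' by rewrite invr_gt0.
have p'1 : 1 <= p' by rewrite invf_ge1// gerBl invr_ge0 ltW.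
have pp' : p^-1 + p'^-1 = 1 by rewrite invrK addrC subrK.
have xi_oo := moments_Lnorm p'1 mxi.
have xi0 : (0 <= Lnorm P p'%:E (EFin \o xi))%E by exact: Lnorm_ge0.
have xi_fin : Lnorm P p'%:E (EFin \o xi) \is a fin_num by rewrite ge0_fin_numE.
exists (`|h| * fine (Lnorm P p'%:E (EFin \o xi))) => [|X Xoo].
  by rewrite mulr_ge0// fine_ge0.
have mX := bochner_enorm_lty Xoo.
have mnX := measurable_fine_norm (enormH_seminorm H) mX.
have lip (x y : H) : (enormH x < +oo)%E -> (enormH y < +oo)%E ->
    (`|ip x h - ip y h|%:E <= `|h|%:E * enormH (x - y)%R)%E.
  move=> _ _; rewrite -(bformBl (dotPl ip)) /enormH -EFinM lee_fin mulrC.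
  exact: dot_CauchySchwarz.
have mip := strongly_measurable_lip (enormH_seminorm H) lip mX.
have mf : measurable_fun setT (fun w => ip (X w) h * xi w).
  by apply: measurable_funM; [exact: mip|exact: mxi.1].
have le : (\int[P]_w `|ip (X w) h * xi w|%:E <=
    (`|h| * fine (Lnorm P p'%:E (EFin \o xi)))%:E * LpH_enorm P p X)%E.
  have hol := @hoelder _ _ _ P _ xi p p' mnX mxi.1 p0 p'0 pp'.
  rewrite Lnorm1 in hol.
  rewrite EFinM fineK// -muleA [X in (_ * X)%E]muleC /LpH_enorm /bochner_enorm asboolT//.
  rewrite (fine_normK (enormH_seminorm H) mX).
  apply: le_trans (lee_wpmul2l _ hol); last by rewrite lee_fin.
  have mm : measurable_fun setT (fun w => `|X w| * xi w) by exact: measurable_funM mnX mxi.1.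
  rewrite -ge0_integralZl//; last first.
    by apply/measurable_EFinP; apply: measurableT_comp => //; exact: mm.
  apply: ge0_le_integral => //.
  - by apply/measurable_EFinP; exact: measurableT_comp.
  - apply/measurable_EFinP; apply: measurable_funM => //.
    by apply: measurableT_comp => //; exact: mm.
  move=> w _; rewrite lee_fin /= !normrM normr_id mulrA ler_wpM2r// mulrC.
  exact: dot_CauchySchwarz.
have I : L1 P (fun w => ip (X w) h * xi w).
  apply/integrableP; split; first exact/measurable_EFinP.
  rewrite (le_lt_trans le)//.
  have X0 : (0 <= LpH_enorm P p X)%E.
    have p1E : (1 <= p%:E)%E by rewrite lee_fin ltW.
    exact: (esn_ge0 (bochner_enorm_seminorm (enormH_seminorm H) P p1E)).
  by rewrite -(@fineK _ (LpH_enorm P p X)) ?ge0_fin_numE// -EFinM ltry.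
apply: le_trans le; rewrite -EFin_intg; last exact: L1_norm.
by rewrite lee_fin; exact: norm_intg.
Qed.

(** * The Malliavin derivative as an unbounded operator *)

Section MalliavinOperator.
Variables (R : realType) (T : R) (H : completeNormedModType R) (ip : {dot H for idfun}).
Hypothesis T_ge0 : 0 <= T.
Hypothesis H_hilbert : inner_product_norm ip.
Hypothesis H_separable : separable H.
Variable Q : {linear H -> H}.
Local Notation U := (H0 ip Q).
Context d (Omega : measurableType d) (P : probability Omega R).
Variable W : R -> U -> Omega -> R.
Hypothesis W_wiener : cylindrical_wiener P (natural_filtration W) T W.
Hypothesis F_gen : @measurable d Omega = natural_filtration W T.
Variables (p : R) (q : \bar R).
Hypotheses (p_gt1 : 1 < p) (q1 : (1 <= q)%E).
Local Notation E := (intg P).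
Local Notation hs := (@hs_enorm R H ip Q).
Local Notation Nq := (bochner_enorm (leb T) q hs).
Local Notation NU := (LpH_enorm P p).
Local Notation NV := (LpLqHS_enorm P T p q).
Local Notation D := (malliavinH P T W q).

Let p1 : 1 <= p := ltW p_gt1.
Let p1E : (1 <= p%:E)%E. Proof. by rewrite lee_fin. Qed.
Let sNq : eseminorm Nq := bochner_enorm_seminorm (hs_seminorm ip Q) (leb T) q1.
Let sNV : eseminorm NV := bochner_enorm_seminorm sNq P p1E.

Lemma malliavinH0 : D 0 0.
Proof.
exists 0%N, (fun=> 0), (fun=> fun=> 0), (fun=> fun=> fun=> 0); split=> [[]//||].
- by apply/funext => w; rewrite big_ord0.
- by apply/funext => w; apply/funext => t; rewrite big_ord0.
Qed.

(** The two families are concatenated and the scalar is put on the vectors h, which leaves the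
    elements of S^q untouched. *)
Lemma malliavinH_linear (a : R) u v u' v' : D u v -> D u' v' ->
  D (a *: u + u') (a *: v + v').
Proof.
move=> [n [h [F [DF [FDF -> ->]]]]] [n' [h' [F' [DF' [FDF' -> ->]]]]].
pose pick (A : Type) (x : 'I_n -> A) (y : 'I_n' -> A) (i : 'I_(n + n')) :=
  match fintype.split i with inl j => x j | inr j => y j end.
have pl A x y (j : 'I_n) : @pick A x y (lshift n' j) = x j.
  by rewrite /pick (unsplitK (inl j)).
have pr A x y (j : 'I_n') : @pick A x y (rshift n j) = y j.
  by rewrite /pick (unsplitK (inr j)).
exists (n + n')%N, (pick _ (fun j => a *: h j) h'), (pick _ F F'), (pick _ DF DF'); split.
- by move=> i; rewrite /pick; case: (fintype.split i).
- apply/funext => w; rewrite big_split_ord/= fctE; congr (_ + _).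
    rewrite [LHS]scaler_sumr; apply: eq_bigr => j _.
    by rewrite !pl !scalerA mulrC.
  by apply: eq_bigr => j _; rewrite !pr.
- apply/funext => w; apply/funext => t; rewrite big_split_ord/=.
  have -> : (a *: (fun w t => \sum_j tensor (h j) (DF j w t)) + (fun w t =>
    \sum_j tensor (h' j) (DF' j w t))) w t
     = a *: (\sum_j tensor (h j) (DF j w t)) + \sum_j tensor (h' j) (DF' j w t) by [].
  congr (_ + _).
    rewrite scaler_sumr; apply: eq_bigr => j _; rewrite !pl.
    by apply/funext => z; rewrite /tensor /= fctE scalerA mulrC -scalerA.
  by apply: eq_bigr => j _; rewrite !pr.
Qed.

Lemma malliavinH_closable : closable NU NV D.
Proof.
move=> u Du v uD u0 voo Dv.
have [dD cD dense_D] := H_separable.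
have mv := bochner_enorm_lty voo.
apply: (bochner_enorm_ae0 sNq p1E mv).
have Duoo n : (NV (Du n) < +oo)%E.
  exact: (malliavinH_cod T_ge0 H_hilbert W_wiener F_gen p1 q1 (uD n)).
have uoo n : (NU (u n) < +oo)%E.
  exact: (malliavinH_dom T_ge0 H_hilbert W_wiener F_gen p1 (uD n)).
have Dv_oo n : (NV (Du n - v)%R < +oo)%E.
  by rewrite (le_lt_trans (esnB sNV _ _))// lte_add_pinfty.
have P_fin : P setT \is a fin_num by rewrite probability_setT.
(* The paired value of v is integrable, so by [chaos_total] it is enough to test it against
   cos(chaos l + b0). *)
have zero e h b : @basisH0 R H ip Q e -> 0 <= b <= T -> {ae P, forall w, pairing T b e h (v w) = 0}.
  move=> be bT.
  have [K K0 lip] := pairing_lip T_ge0 H_hilbert q1 b h be.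
  have l0 := pairing0 T_ge0 b e h.
  have [K' K'0 lipE] := lip_integral sNq p1E K0 lip P_fin.
  have IY := lip_L1 sNq p1E K0 l0 lip P_fin voo.
  apply: (chaos_total H_hilbert W_wiener F_gen IY) => l b0 vl.
  have Sl : first_chaos T P W (chaos W l) by exact: first_chaos_of.
  have mc : measurable_fun setT (fun w => cos (chaos W l w + b0)).
    by apply: measurable_cos_comp; apply: measurable_funD => //; exact: (first_chaos_L2 Sl).1.
  have mxi : moments P (skorokhod P (W b e) (chaos W l) b0).
    apply: (moments_skorokhod (first_chaosP H_hilbert W_wiener F_gen) (@first_chaos_L2 _ _ _ _ _
      _ _ P W)
      (first_chaos_gaussian T_ge0 H_hilbert W_wiener F_gen) b0 _ Sl).
    exact: first_chaos_W.
  have [C C0 uC] := E_ip_le_LpH H_hilbert h p_gt1 mxi.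
  pose x n := E (fun w => ip (u n w) h * skorokhod P (W b e) (chaos W l) b0 w).
  have xE n : x n = E (fun w => pairing T b e h (Du n w) * cos (chaos W l w + b0)).
    exact: (malliavinH_duality T_ge0 H_hilbert W_wiener F_gen e h b0 (uD n) bT Sl).
  (* From the side of the divergence: xi does not depend on n and [u n] tends to 0 in L^p. *)
  have x0 : x n @[n --> \oo] --> (0 : R).
    have := u0 => /fine_cvgP[_ c0].
    have c1 : C * fine (NU (u n)) @[n --> \oo] --> (0 : R).
      by rewrite -[X in _ --> X](mulr0 C); apply: cvgMr; exact: c0.
    apply/cvgr0Pnorm_le => eps eps0; move/cvgr0Pnorm_le: c1 => /(_ _ eps0).
    apply: filterS => n; apply: le_trans; rewrite (le_trans _ (ler_norm _))//.
    have uf : NU (u n) \is a fin_num.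
      rewrite ge0_fin_numE//; exact: (esn_ge0 (bochner_enorm_seminorm (enormH_seminorm H) P p1E)).
    by rewrite -lee_fin EFinM fineK//; exact: uC.
  (* From the side of the derivative: [pairing] is Lipschitz for the inner norm, its expectation is
     controlled by the outer one, and the cosine is bounded by 1. *)
  have xY : x n @[n --> \oo] --> E (fun w => pairing T b e h (v w) * cos (chaos W l w + b0)).
    have := Dv => /fine_cvgP[_ c0].
    have c1 : K' * fine (NV (Du n - v)) @[n --> \oo] --> (0 : R).
      by rewrite -[X in _ --> X](mulr0 K'); apply: cvgMr; exact: c0.
    apply/cvgrPdist_le => eps eps0; move/cvgr0Pnorm_le: c1 => /(_ _ eps0).
    apply: filterS => n; apply: le_trans; rewrite (le_trans _ (ler_norm _))//.
    have [Id le] := lipE (Du n) v (Duoo n) voo.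
    have vf : NV (Du n - v) \is a fin_num by rewrite ge0_fin_numE//; exact: (esn_ge0 sNV).
    have In := lip_L1 sNq p1E K0 l0 lip P_fin (Duoo n).
    have c1 w : `|cos (chaos W l w + b0)| <= 1 := norm_cos_le1 _.
    rewrite distrC xE -intgB; [|exact: L1_bdd In mc c1|exact: L1_bdd IY mc c1].
    under eq_fun do rewrite -mulrBl.
    rewrite (le_trans (norm_intg (L1_bdd Id mc c1)))//.
    apply: (@le_trans _ _ (E (fun w => `|pairing T b e h (Du n w) - pairing T b e h (v w)|)));
      last first.
      by rewrite -lee_fin EFinM (fineK vf).
    apply: le_intg; [exact: L1_norm (L1_bdd Id mc c1)|exact: L1_norm|move=> w].
    by rewrite normrM ler_piMr.
  by rewrite -(cvg_lim _ xY)// (cvg_lim _ x0).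
(* Countably many e, h and r, so that one null set of Omega serves them all and [pairing_separates]
   applies pathwise. *)
have zeros : {ae P, forall w, forall e, @basisH0 R H ip Q e -> forall h, dD h ->
    forall r : rat, setT r -> pairing T (Num.min (Num.max (ratr r) 0) T) e h (v w) = 0}.
  have cE : countable (@basisH0 R H ip Q) by exact: basisH0_countable.
  apply: ae_countable cE _ => e be.
  apply: ae_countable cD _ => h Dh;
  apply: (@ae_countable _ _ _ P rat setT (fun r w =>
    pairing T (Num.min (Num.max (ratr r) 0) T) e h (v w) = 0)) => [|r _].
    exact: countableP.
  by apply: zero => //; rewrite le_min le_max lexx orbT T_ge0 ge_min lexx orbT.
apply: filterS zeros => w zw.
apply: (pairing_separates T_ge0 H_hilbert H_separable q1 cD dense_D).
  exact: (strongly_measurable_lty sNq w mv).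
by move=> e h r be Dh; exact: zw.
Qed.

End MalliavinOperator.

Theorem lemma3p2 (R : realType) (T : R) (T_gt0 : 0 < T)
  (H : completeNormedModType R) (ip : {dot H for idfun})
  (H_hilbert : inner_product_norm ip) (H_separable : separable H)
  (Q : {linear H -> H}) (Q_pos : positive_op ip Q)
  (d : measure_display) (Omega : measurableType d) (P : probability Omega R)
  (W : R -> H0 ip Q -> Omega -> R)
  (W_wiener : cylindrical_wiener P (natural_filtration W) T W)
  (F_gen : @measurable d Omega = natural_filtration W T)
  (p : R) (p_gt1 : 1 < p) (q : \bar R) (q_ge2 : (2%:E <= q)%E) :
  unbounded_operator (LpH_enorm P p) (LpLqHS_enorm P T p q)
    (malliavinH P T W q) /\
  closable (LpH_enorm P p) (LpLqHS_enorm P T p q) (malliavinH P T W q).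
Proof.
have T0 := ltW T_gt0.
have q1 : (1 <= q)%E by apply: le_trans q_ge2; rewrite lee_fin ler1n.
have p1 := ltW p_gt1; have p1E : (1 <= p%:E)%E by rewrite lee_fin.
have cl := malliavinH_closable T0 H_hilbert H_separable W_wiener F_gen p_gt1 q1.
split=> //; split.
- by move=> u v; exact: (malliavinH_dom T0 H_hilbert W_wiener F_gen p1).
- by move=> u v; exact: (malliavinH_cod T0 H_hilbert W_wiener F_gen p1 q1).
- exact: malliavinH0.
- by move=> a u v u' v'; exact: malliavinH_linear.
(* That D descends to classes is closability applied to constant sequences. *)
- move=> u v uv u0; apply: (cl (fun=> u) (fun=> v)) => //.
  + by rewrite u0; exact: cvg_cst.
  + exact: (malliavinH_cod T0 H_hilbert W_wiener F_gen p1 q1 uv).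
  + have sNV := bochner_enorm_seminorm (bochner_enorm_seminorm (hs_seminorm ip Q) (leb T) q1) P p1E.
    by under eq_fun do rewrite subrr; rewrite [LpLqHS_enorm _ _ _ _ _](esn0 sNV); exact: cvg_cst.
Qed.
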